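(* Let $r,s\ge0$ be integers, let $x,y$ be distinct vertices of $B_{r,s}=P_3^{\square r}\square Q_s$, and suppose that $H=B_{r,s}-\{x,y\}$ is nonempty. Write $p=p(x,y)$ and $q=q(x,y)$. Then: (1) $H$ is a partial cube if and only if one of the following holds: $x,y$ are corners and [$(p,q)\ne(0,2)$, or $(p,q)=(0,2)$ and $r+s=3$]; or $\{x,y\}$ is a boundary $P_3$-edge; or $\{x,y\}$ lies in one of the eleven sporadic orbits listed in the context. (2) $H$ is a daisy cube if and only if either $x,y$ are corners and [$q=0$ or $(p,q)=(0,1)$]; or $(r,s)=(1,0)$ and $\{x,y\}$ is a boundary $P_3$-edge. (3) $H\in\mathcal O_{\mathrm D}$ if and only if either $x,y$ are opposite corners, $s\ge1$ and $2r+s\ge3$; or $(r,s)=(1,1)$ and $\{x,y\}$ is a boundary $P_3$-edge. In particular, if at least one of $x,y$ is not a corner and $H$ is not an isometric subgraph of $B_{r,s}$, then $H\notin\mathcal O_{\mathrm D}$.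
   Context: Graphs are finite and simple; partial cubes are connected by convention. $P_3$ is the path on three vertices, $Q_s$ the hypercube on $\{0,1\}^s$, $\square$ the Cartesian product, $G^{\square0}=Q_0=K_1$. Coordinate model: $V(B_{r,s})=\{0,1,2\}^r\times\{0,1\}^s$, two vertices being adjacent iff they differ in exactly one coordinate and there by exactly $1$. The first $r$ coordinates are the $P_3$-coordinates, the last $s$ the binary coordinates. A corner is a vertex all of whose $P_3$-coordinates lie in $\{0,2\}$. For vertices $x,y$: $p(x,y)=|\{i\in[r]:\{x_i,y_i\}=\{0,2\}\}|$ and $q(x,y)=|\{j\in[s]:x_{r+j}\ne y_{r+j}\}|$. Two corners are opposite if $p=r$ and $q=s$. $\{x,y\}$ is a boundary $P_3$-edge if $x,y$ are adjacent, differ in a $P_3$-coordinate, and one of them is a corner. $B_{r,s}-\{x,y\}$ is the subgraph induced by the remaining vertices. A subgraph $H$ of $G$ is isometric if $d_H(u,v)=d_G(u,v)$ for all $u,v\in V(H)$. A partial cube is a graph isomorphic to an isometric subgraph of a hypercube. A daisy cube is a graph isomorphic to the induced subgraph $Q_n[D]$ for some $n\ge0$ and nonempty down-set $D\subseteq\{0,1\}^n$ (coordinatewise order). In a partial cube, $ab\,\Theta\,uv$ iff $d(a,u)+d(b,v)\ne d(a,v)+d(b,u)$; this is an equivalence relation on edges, and each class ($\Theta$-class) determines two complementary halfspaces $\{z:d(a,z)<d(b,z)\}$, $\{z:d(b,z)<d(a,z)\}$. A restriction of a partial cube is the subgraph induced by a halfspace of a $\Theta$-class; a contraction is obtained by contracting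 all edges of one $\Theta$-class (suppressing loops and parallel edges). A pc-minor is any graph obtained by a finite sequence of restrictions and contractions; it is proper if not isomorphic to the original graph. $\mathcal O_{\mathrm D}$ is the set of all partial cubes that are not daisy cubes but all of whose proper pc-minors are daisy cubes. The eleven sporadic orbits: $\{x,y\}$ is the image, under some automorphism of $B_{r,s}$, of one of the following pairs (a semicolon separates $P_3$-coordinates from binary coordinates). In $B_{2,0}$: $\{(1,1),(0,0)\}$, $\{(0,1),(2,0)\}$, $\{(1,1),(1,0)\}$, $\{(1,0),(1,2)\}$. In $B_{1,2}$: $\{(1;00),(0;01)\}$, $\{(1;00),(1;01)\}$. In $B_{2,1}$: $\{(0,1;0),(1,0;0)\}$, $\{(1,1;0),(1,1;1)\}$, $\{(0,1;0),(0,0;1)\}$, $\{(0,1;0),(0,1;1)\}$. In $B_{3,0}$: $\{(0,0,1),(0,1,0)\}$. *)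

(* Defs.v *)
From mathcomp Require Import all_boot.
Set Implicit Arguments. Unset Strict Implicit. Unset Printing Implicit Defensive.

Record sgraph := SGraph {
  vert :> finType;
  adj : rel vert;
  adj_sym : symmetric adj;
  adj_irr : irreflexive adj }.

Definition graph_iso (G H : sgraph) (f : G -> H) : Prop :=
  bijective f /\ forall u v, adj (f u) (f v) = adj u v.

Definition isomorphic (G H : sgraph) : Prop := exists f : G -> H, graph_iso f.

Definition walk (G : sgraph) (u v : G) (n : nat) : bool :=
  [exists w : n.-tuple G, path (@adj G) u w && (last u w == v)].

(* A shortest walk has length < #|G|; the value #|G| on pairs in different
   components is junk, which [edist] replaces by None (infinite distance). *)
Definition dist (G : sgraph) (u v : G) : nat := find (walk u v) (iota 0 #|G|).

Definition edist (G : sgraph) (u v : G) : option nat :=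
  if connect (@adj G) u v then Some (dist u v) else None.

Section Induced.
Variables (G : sgraph) (A : {set G}).
Let T : finType := {u : G | u \in A}.
Let e : rel T := fun u v => adj (val u) (val v).
Lemma induced_sym : symmetric e. Proof. by move=> u v; apply: adj_sym. Qed.
Lemma induced_irr : irreflexive e. Proof. by move=> u; apply: adj_irr. Qed.
Definition induced : sgraph := SGraph induced_sym induced_irr.
End Induced.

(* A subgraph of G, up to isomorphism, is the source of an injective
   edge-preserving map to G (the inclusion); it need not be induced. *)
Definition subgraph_map (H G : sgraph) (f : H -> G) : Prop :=
  injective f /\ forall u v, adj u v -> adj (f u) (f v).

Definition isometric (H G : sgraph) (f : H -> G) : Prop :=
  subgraph_map f /\ forall u v, edist u v = edist (f u) (f v).

Definition isometric_set (G : sgraph) (A : {set G}) : Prop :=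
  isometric (fun u : induced A => val u : G).

Section Hypercube.
Variable n : nat.
Let T : finType := {ffun 'I_n -> bool}.
Let e : rel T := fun u v => #|[set i | u i != v i]| == 1.
Lemma hypercube_sym : symmetric e.
Proof.
move=> u v; rewrite /e; congr (_ == _).
by apply: eq_card => i; rewrite !inE eq_sym.
Qed.
Lemma hypercube_irr : irreflexive e.
Proof.
move=> u; rewrite /e; suff -> : [set i | u i != u i] = set0 by rewrite cards0.
by apply/setP => i; rewrite !inE eqxx.
Qed.
Definition hypercube : sgraph := SGraph hypercube_sym hypercube_irr.
End Hypercube.

(* Partial cubes are connected; connected graphs are nonempty. *)
Definition partial_cube (G : sgraph) : Prop :=
  0 < #|G| /\ exists n (f : G -> hypercube n), isometric f.

Definition down_set n (D : {set {ffun 'I_n -> bool}}) : Prop :=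
  forall u v : {ffun 'I_n -> bool},
    v \in D -> (forall i, u i ==> v i) -> u \in D.

Definition daisy_cube (G : sgraph) : Prop :=
  exists n (D : {set hypercube n}),
    [/\ D != set0, down_set D & isomorphic G (induced D)].

Definition Theta (G : sgraph) (a b u v : G) : bool :=
  dist a u + dist b v != dist a v + dist b u.

(* For an edge ab: one halfspace of its Theta-class (swap a, b for the other). *)
Definition halfspace (G : sgraph) (a b : G) : {set G} :=
  [set z | dist a z < dist b z].

Definition restriction (G : sgraph) (a b : G) : sgraph :=
  induced (halfspace a b).

Section Contraction.
Variables (G : sgraph) (a b : G).
Definition class_edge : rel G := fun u v => adj u v && Theta a b u v.
Let T : finType :=
  {A : {set G} | A \in equivalence_partition (connect class_edge) [set: G]}.
Let e : rel T := fun A B =>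
  (A != B) && [exists u in val A, exists v in val B, adj u v].
Lemma contraction_sym : symmetric e.
Proof.
suff h A B : e A B -> e B A by move=> A B; apply/idP/idP; apply: h.
case/andP=> nAB /exists_inP[u uA /exists_inP[v vB uv]].
rewrite /e eq_sym nAB; apply/exists_inP; exists v => //.
by apply/exists_inP; exists u; rewrite // adj_sym.
Qed.
Lemma contraction_irr : irreflexive e. Proof. by move=> A; rewrite /e eqxx. Qed.
(* Contraction of all edges in the Theta-class of the edge ab: the vertices are
   the components of the graph formed by these edges. *)
Definition contraction : sgraph := SGraph contraction_sym contraction_irr.
End Contraction.

Inductive pc_minor (G : sgraph) : sgraph -> Prop :=
| pc_minor_refl : pc_minor G G
| pc_minor_restriction (K : sgraph) (a b : K) :
    pc_minor G K -> adj a b -> pc_minor G (restriction a b)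
| pc_minor_contraction (K : sgraph) (a b : K) :
    pc_minor G K -> adj a b -> pc_minor G (contraction a b).

Definition in_OD (G : sgraph) : Prop :=
  [/\ partial_cube G, ~ daisy_cube G &
      forall K, pc_minor G K -> ~ isomorphic K G -> daisy_cube K].

Definition bvert (r s : nat) : finType :=
  ({ffun 'I_r -> 'I_3} * {ffun 'I_s -> bool})%type.

Section BGraph.
Variables r s : nat.
Let e : rel (bvert r s) := fun x y =>
  (#|[set i | x.1 i != y.1 i]| + #|[set j | x.2 j != y.2 j]| == 1) &&
  [forall i, (x.1 i != y.1 i) ==>
     ((x.1 i == (y.1 i).+1 :> nat) || (y.1 i == (x.1 i).+1 :> nat))].
Lemma bgraph_sym : symmetric e.
Proof.
move=> x y; rewrite /e; congr (_ && _).
  congr (_ == _); congr (_ + _).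
    by apply: eq_card => i; rewrite !inE eq_sym.
  by apply: eq_card => i; rewrite !inE eq_sym.
by apply: eq_forallb => i; rewrite eq_sym orbC.
Qed.
Lemma bgraph_irr : irreflexive e.
Proof.
move=> x; rewrite /e.
suff [-> ->] : [set i | x.1 i != x.1 i] = set0 /\ [set j | x.2 j != x.2 j] = set0.
  by rewrite !cards0.
by split; apply/setP => i; rewrite !inE eqxx.
Qed.
Definition bgraph : sgraph := SGraph bgraph_sym bgraph_irr.
End BGraph.

Definition corner r s (x : bvert r s) : bool :=
  [forall i, (x.1 i == 0 :> nat) || (x.1 i == 2 :> nat)].

Definition pnum r s (x y : bvert r s) : nat :=
  #|[set i | ((x.1 i == 0 :> nat) && (y.1 i == 2 :> nat))
          || ((x.1 i == 2 :> nat) && (y.1 i == 0 :> nat))]|.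

Definition qnum r s (x y : bvert r s) : nat := #|[set j | x.2 j != y.2 j]|.

Definition opposite_corners r s (x y : bvert r s) : Prop :=
  [/\ corner x, corner y, pnum x y = r & qnum x y = s].

Definition boundary_P3_edge r s (x y : bvert r s) : Prop :=
  [/\ @adj (bgraph r s) x y, exists i, x.1 i != y.1 i & corner x || corner y].

Definition rest r s (x y : bvert r s) : {set bgraph r s} := ~: [set x; y].

Definition bdel r s (x y : bvert r s) : sgraph := induced (rest x y).

(* The vertex with P_3-coordinates l and binary coordinates m; meant for
   size l = r, entries of l at most 2, size m = s, entries of m at most 1. *)
Definition bvtx r s (l m : seq nat) : bvert r s :=
  ([ffun i : 'I_r => inord (nth 0 l i)], [ffun j : 'I_s => nth 0 m j == 1]).

Definition sporadic_pairs (r s : nat) : seq (bvert r s * bvert r s) :=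
  let v := bvtx r s in
  match r, s with
  | 2, 0 => [:: (v [:: 1; 1] [::], v [:: 0; 0] [::]);
                (v [:: 0; 1] [::], v [:: 2; 0] [::]);
                (v [:: 1; 1] [::], v [:: 1; 0] [::]);
                (v [:: 1; 0] [::], v [:: 1; 2] [::])]
  | 1, 2 => [:: (v [:: 1] [:: 0; 0], v [:: 0] [:: 0; 1]);
                (v [:: 1] [:: 0; 0], v [:: 1] [:: 0; 1])]
  | 2, 1 => [:: (v [:: 0; 1] [:: 0], v [:: 1; 0] [:: 0]);
                (v [:: 1; 1] [:: 0], v [:: 1; 1] [:: 1]);
                (v [:: 0; 1] [:: 0], v [:: 0; 0] [:: 1]);
                (v [:: 0; 1] [:: 0], v [:: 0; 1] [:: 1])]
  | 3, 0 => [:: (v [:: 0; 0; 1] [::], v [:: 0; 1; 0] [::])]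
  | _, _ => [::]
  end.

Definition sporadic r s (x y : bvert r s) : Prop :=
  exists2 ab, ab \in sporadic_pairs r s &
  exists2 phi : bgraph r s -> bgraph r s, graph_iso phi &
    [set phi ab.1; phi ab.2] = [set x; y].

(* Main.v *)
Require Import Defs.
From mathcomp Require Import all_boot.
From mathcomp Require Import zify.
Set Implicit Arguments. Unset Strict Implicit. Unset Printing Implicit Defensive.

(* All graphs are handled through an isometric embedding f into a cube {0,1}^I, that
   is, a map whose image contains, for any two of its points, a flip of the first one
   towards the second. If such an f exists, then G is a daisy cube iff some vertex z is
   a center: for every v, all flips of f v towards f z lie in the image. Restrictions
   and contractions become faces and coordinate projections of the image.

   The unary code of B_{r,s} in {0,1}^(2(r+s)) remains isometric on the complement of
   two corners, unless (p,q) = (0,2), and on the complement of a boundary P_3-edge; in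
   these cases centers can be read off from the coordinates. In every other case some
   path o - x - t of length 2 has lost its middle vertex x and o, t have no other common
   neighbour left. If the box spanned by this path and two further directions meets the
   deleted set only in x, a chain of squares shows that an edge at o and one at t are
   parallel, which forces d(o, t) = 2 in every partial cube. Such a box exists whenever
   r + s >= 4. For r + s <= 3 a computation over all pairs finds a box, a box in which
   a hexagon replaces two of the squares, two octagons or a cut, except for
   the sporadic pairs and the corners with (p,q) = (0,2), where explicit codes show that
   the graph is a partial cube and that both it and one contraction have no center.

   A daisy cube stays one under minors, so membership in O_D is decided by the minors
   obtained in one step. *)

(** Two deleted corners ruin every candidate for the minimum as soon as they differ in a binary
    coordinate and somewhere else, because each vertex agrees with one of them in that binary
    coordinate. If they also agree in some coordinate, a halfspace contains both and inherits the
    defect; so minimality forces opposite corners. For opposite corners a halfspace loses only one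
    of the two, and a contraction merges at least one of them with a surviving neighbour. What is
    left is a smaller product without at most one corner, which is a daisy cube. The bound of four
    coordinates comes from the second deleted vertex, which may lie in the box. When [y] differs
    from a middle vertex [x] in a direction [c] outside the path, four coordinates leave two further
    directions that avoid both the path and [c], and then the box misses [y]. When [x] and [y] are
    opposite in a square, the path itself takes two directions. With three coordinates this room is
    missing, which is why the small products behave irregularly. *)

Section Hamming.
Variable I : finType.
Implicit Types (u v w : {ffun I -> bool}) (i j k : I).

Definition ham u v : nat := #|[set i | u i != v i]|.

Definition flip i u : {ffun I -> bool} := [ffun j => u j (+) (j == i)].

Lemma hamC u v : ham u v = ham v u.
Proof. by apply: eq_card => i; rewrite !inE eq_sym. Qed.

Lemma ham_eq0 u v : (ham u v == 0) = (u == v).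
Proof.
rewrite cards_eq0; apply/eqP/eqP => [/setP h|->]; last first.
  by apply/setP => i; rewrite !inE eqxx.
by apply/ffunP => i; have := h i; rewrite !inE; move/negbFE/eqP.
Qed.

Lemma ham_triangle u v w : ham u w <= ham u v + ham v w.
Proof.
apply: leq_trans (leq_card_setU _ _); apply: subset_leq_card.
apply/subsetP => i; rewrite !inE => h.
by case: (eqVneq (u i) (v i)) => //= <-.
Qed.

Lemma flipK i : involutive (flip i).
Proof. by move=> u; apply/ffunP => j; rewrite !ffunE -addbA addbb addbF. Qed.

Lemma flipi i u : flip i u i = ~~ u i.
Proof. by rewrite ffunE eqxx addbT. Qed.

Lemma flip_neq i j u : j != i -> flip i u j = u j.
Proof. by move=> /negbTE h; rewrite ffunE h addbF. Qed.

Lemma ham_flip_lt i u v : u i != v i -> ham u v = (ham (flip i u) v).+1.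
Proof.
move=> h; rewrite /ham (cardsD1 i) inE h add1n; congr _.+1.
apply: eq_card => j; rewrite !inE ffunE.
by case: (eqVneq j i) h => [->|_ _]; rewrite ?addbF //; case: (u i); case: (v i).
Qed.

Lemma ham_flip_gt i u v : u i = v i -> ham (flip i u) v = (ham u v).+1.
Proof.
move=> h; rewrite (@ham_flip_lt i) ?flipK // flipi h; by case: (v i).
Qed.

Lemma hamxx u : ham u u = 0.
Proof. by apply/eqP; rewrite ham_eq0. Qed.

Lemma ham_flip i u : ham u (flip i u) = 1.
Proof. by rewrite hamC ham_flip_gt // hamxx. Qed.

Lemma ham1P u v : reflect (exists2 i, u i != v i & v = flip i u) (ham u v == 1).
Proof.
apply: (iffP cards1P) => [[i /setP h]|[i ui ->]]; last first.
  by apply/cards1P; rewrite -/(ham _ _) ham_flip.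
have hi j : (u j != v j) = (j == i) by have := h j; rewrite !inE.
exists i; first by rewrite hi.
by apply/ffunP => j; rewrite ffunE -hi; case: (u j); case: (v j).
Qed.

Lemma flip_inj u : injective (flip^~ u).
Proof.
move=> i j /= /ffunP /(_ i); rewrite flipi ffunE.
by case: eqVneq => // _; rewrite addbF; case: (u i).
Qed.

End Hamming.

(** * Isometric embeddings as maps closed under distance-decreasing flips *)

Section Geodesic.
Variables (G : sgraph) (I : finType).
Implicit Types f : G -> {ffun I -> bool}.

(* The image of f is closed under some distance-decreasing flip between any two
   of its points; this amounts to f being an isometric embedding. *)
Definition geodesic f : Prop :=
  (forall u v, adj u v = (ham (f u) (f v) == 1)) /\
  (forall u v, u != v -> exists w i, f u i != f v i /\ f w = flip i (f u)).

Lemma geodesic_inj f : geodesic f -> injective f.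
Proof.
move=> [_ h] u v fuv; apply/eqP/negPn/negP => /h [w [i []]].
by rewrite fuv eqxx.
Qed.

Lemma path_ham f u p : (forall u v, adj u v -> ham (f u) (f v) = 1) ->
  path (@adj G) u p -> ham (f u) (f (last u p)) <= size p.
Proof.
move=> h; elim: p u => [|w p IH] u /=; first by rewrite hamxx.
case/andP=> /h uw /IH wp; apply: leq_trans (ham_triangle _ (f w) _) _.
by rewrite uw add1n ltnS.
Qed.

Lemma walkP (u v : G) n :
  reflect (exists p, [/\ size p = n, path (@adj G) u p & last u p = v]) (walk u v n).
Proof.
apply: (iffP existsP) => [[w /andP[wp /eqP wv]]|[p [sp pp pv]]].
  by exists w; rewrite size_tuple.
by rewrite -sp; exists (in_tuple p); rewrite pp pv eqxx.
Qed.

Lemma walk_dist (u v : G) : connect (@adj G) u v -> walk u v (dist u v).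
Proof.
case/connectP => p pp pv.
have : has (walk u v) (iota 0 #|G|).
  case/shortenP: pp pv => q qp uq _ pv.
  apply/hasP; exists (size q); last by apply/walkP; exists q.
  rewrite mem_iota add0n /=.
  by have := card_uniqP uq; rewrite /= => <-; apply: max_card.
move=> hw; have := nth_find 0 hw; rewrite nth_iota //.
by rewrite has_find size_iota in hw.
Qed.

Lemma geodesic_path f u v : geodesic f -> exists p,
  [/\ path (@adj G) u p, last u p = v, size p = ham (f u) (f v) & uniq (u :: p)].
Proof.
move=> gf; have [ga gs] := gf.
(* The added conjunct, that the distance to [v] drops below its initial value, gives [uniq]; a path
   without repetition keeps its length below [#|G|], the range searched by [dist]. *)
suff [p [pp pv sp up _]] : exists p, [/\ path (@adj G) u p, last u p = v,
    size p = ham (f u) (f v), uniq (u :: p)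
    & {in p, forall w, ham (f w) (f v) < ham (f u) (f v)}] by exists p.
have [n] := ubnP (ham (f u) (f v)); elim: n u => // n IH u hn.
case: (eqVneq u v) => [->|nuv]; first by exists [::]; rewrite hamxx.
have [w [i [hi fw]]] := gs u v nuv.
have hl := ham_flip_lt hi; rewrite -fw in hl.
have [|p [pp pv sp up hp]] := IH w; first by rewrite -ltnS -hl.
have hu w' : w' \in w :: p -> ham (f w') (f v) < ham (f u) (f v).
  by rewrite inE => /predU1P[->|/hp]; rewrite hl // => /leqW.
exists (w :: p); split=> //=.
- by rewrite pp ga fw ham_flip.
- by rewrite sp hl.
- rewrite -/(uniq (w :: p)) up andbT.
  by apply/negP => /hu; rewrite ltnn.
Qed.

Lemma geodesic_edist f u v : geodesic f -> edist u v = Some (ham (f u) (f v)).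
Proof.
move=> gf; have [p [pp pv sp up]] := geodesic_path u v gf.
have cuv : connect (@adj G) u v by apply/connectP; exists p.
rewrite /edist cuv; congr Some; apply/eqP; rewrite eqn_leq; apply/andP; split.
  rewrite leqNgt; apply/negP => /(before_find 0).
  rewrite nth_iota; last first.
    have := card_uniqP up; rewrite /= sp => <-; exact: max_card.
  by move/walkP; apply; exists p.
have /walkP[q [<- qp <-]] := walk_dist cuv.
by apply: path_ham qp => x y; case: gf => -> _ /eqP.
Qed.

Lemma geodesic_dist f u v : geodesic f -> dist u v = ham (f u) (f v).
Proof.
by move=> gf; have := geodesic_edist u v gf; rewrite /edist; case: ifP => // _ [].
Qed.

End Geodesic.

Lemma hypercube_geodesic n : geodesic (id : hypercube n -> {ffun 'I_n -> bool}).
Proof.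
split=> // u v nuv; have : 0 < ham u v by rewrite lt0n ham_eq0.
by case/card_gt0P => i; rewrite inE => hi; exists (flip i u), i.
Qed.

Lemma geodesic_isometric (G H : sgraph) (I : finType) (g : G -> H)
    (f : H -> {ffun I -> bool}) :
  geodesic f -> geodesic (f \o g) -> isometric g.
Proof.
move=> gf gfg; split; first split.
- by move=> u v guv; apply: (geodesic_inj gfg); rewrite /= guv.
- by move=> u v; case: gf => -> _; case: gfg => -> _.
- by move=> u v; rewrite (geodesic_edist _ _ gfg) (geodesic_edist _ _ gf).
Qed.

Lemma partial_cube_geodesic (G : sgraph) : partial_cube G ->
  exists n, exists f : G -> {ffun 'I_n -> bool}, geodesic f.
Proof.
case=> _ [n [f [[fi fa] fd]]]; exists n, f.
have ed u v : edist u v = Some (ham (f u) (f v)).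
  by rewrite fd (geodesic_edist _ _ (hypercube_geodesic n)).
have wd u v : walk u v (ham (f u) (f v)).
  have := ed u v; rewrite /edist; case: ifP => // c [<-]; exact: walk_dist.
have fa1 u v : adj u v -> ham (f u) (f v) = 1 by move/fa/eqP.
split=> [u v|u v nuv].
  apply/idP/eqP => [/fa1 //|h]; have := wd u v; rewrite h => /walkP[[|w [|a l]] [//= _]].
  by rewrite andbT => uw <-.
have := wd u v; case E: (ham _ _) => [|m] /walkP[[|w p] //= [//]].
  by move=> _ _ uv; rewrite uv eqxx in nuv.
case=> sp /andP[uw wp] lv; have := path_ham fa1 wp; rewrite lv sp => hm.
have /ham1P[i hi fw] : ham (f u) (f w) == 1 by rewrite fa1.
(* If [f u] and [f v] agreed at [i], the first step would lead away from [f v], and the rest of the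
   walk would be too short. *)
exists w, i; split=> //; apply: contraTN hm => /eqP hu.
by rewrite fw ham_flip_gt // E -ltnNge ltnW.
Qed.

(** The codes used later are indexed by pairs or by other finite types; here the indices are
    renumbered to fit [hypercube]. *)
Lemma geodesic_partial_cube (G : sgraph) (I : finType) (f : G -> {ffun I -> bool}) :
  0 < #|G| -> geodesic f -> partial_cube G.
Proof.
move=> G0 gf; split=> //.
pose t (u : {ffun I -> bool}) := [ffun j : 'I_#|I| => u (enum_val j)].
have ht u v : ham (t u) (t v) = ham u v.
  rewrite /ham -[RHS](card_imset _ enum_rank_inj); apply: eq_card => j.
  rewrite !inE !ffunE; apply/idP/imsetP => [h|[i]]; last first.
    by rewrite inE => h ->; rewrite enum_rankK.
  by exists (enum_val j); rewrite ?inE ?enum_valK.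
exists #|I|, (t \o f); apply: (geodesic_isometric (hypercube_geodesic _)).
case: gf => ga gs; split=> [u v|u v /gs [w [i [hi fw]]]] /=.
  by rewrite ht ga.
exists w, (enum_rank i); rewrite !ffunE enum_rankK; split=> //.
apply/ffunP => j; rewrite !ffunE fw ffunE; congr addb.
by apply/eqP/eqP => [<-|->]; rewrite ?enum_valK ?enum_rankK.
Qed.

(** * Daisy cubes as graphs whose code has a center *)

Section Daisy.
Variable G : sgraph.

(** The admissible [u] are the points of the subcube spanned by [z] and [f v]. Adding [z] modulo 2
    moves [z] to the origin and turns the condition into closure under going down. *)
Definition centered (I : finType) (f : G -> {ffun I -> bool}) (z : {ffun I -> bool}) : Prop :=
  forall v (u : {ffun I -> bool}),
    (forall i, u i != z i -> u i = f v i) -> exists w, f w = u.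

(** Down-sets are isometric: from [f u] first go down in coordinates where [f u] exceeds the minimum
    [z] and differs from [f v]. When none is left, [f u] lies below [f v], and so does its flip in
    any coordinate where the two differ. *)
Lemma centered_geodesic (I : finType) (f : G -> {ffun I -> bool}) z :
  injective f -> (forall u v, adj u v = (ham (f u) (f v) == 1)) ->
  centered f z -> geodesic f.
Proof.
move=> fi fa fc; split=> // u v nuv.
have : [exists i, (f u i != f v i) && (f u i != z i)]
    || [forall i, (f u i != f v i) ==> (f u i == z i)].
  by rewrite orbC -implyNb negb_forall; apply/implyP => /existsP[i];
     rewrite negb_imply => h; apply/existsP; exists i.
case/orP => [/existsP[i /andP[h1 h2]]|/forallP h].
  have [|w fw] := fc u (flip i (f u)); last by exists w, i.
  move=> j; rewrite ffunE; case: (eqVneq j i) => [->|_]; last by rewrite addbF.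
  by rewrite addbT; case: (f u i) h2; case: (z i).
have [i hi] : exists i, f u i != f v i.
  apply/existsP; apply: contraR nuv; rewrite negb_exists => /forallP e.
  by apply/eqP/fi/ffunP => i; have := e i; move/negPn/eqP.
have [|w fw] := fc v (flip i (f u)); last by exists w, i.
move=> j; rewrite ffunE; case: (eqVneq j i) => [->|_].
  by rewrite addbT; case: (f u i) hi; case: (f v i).
rewrite addbF => /negbTE hj; have := h j; rewrite hj implybF => /negPn/eqP //.
Qed.

Lemma centered_daisy (I : finType) (f : G -> {ffun I -> bool}) z :
  0 < #|G| -> injective f -> (forall u v, adj u v = (ham (f u) (f v) == 1)) ->
  centered f z -> daisy_cube G.
Proof.
move=> G0 fi fa fc; pose g x : hypercube #|I| :=
  [ffun i => f x (enum_val i) (+) z (enum_val i)].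
have gi : injective g.
  move=> x y /ffunP h; apply/fi/ffunP => i.
  have := h (enum_rank i); rewrite !ffunE enum_rankK; exact: addIb.
pose D := g @: [set: G].
have gD x : g x \in D by apply: imset_f.
exists #|I|, D; split.
- by case/card_gt0P: G0 => x _; apply/set0Pn; exists (g x).
- move=> u _ /imsetP[x _ ->] le.
  have [|w fw] := fc x [ffun i => u (enum_rank i) (+) z i].
    move=> i; rewrite ffunE; have := le (enum_rank i).
    by rewrite ffunE enum_rankK; case: (u _); case: (f x i); case: (z i).
  suff -> : u = g w by [].
  by apply/ffunP => i; rewrite ffunE fw ffunE enum_valK -addbA addbb addbF.
- exists (fun x => Sub (g x) (gD x)); split.
    apply: inj_card_bij => [x y /(congr1 val)/gi //|].
    by rewrite card_sig card_imset // cardsT.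
  move=> u v; rewrite fa; change ((ham (g u) (g v) == 1) = (ham (f u) (f v) == 1)).
  congr (_ == _); rewrite /ham -[RHS](card_imset _ enum_rank_inj).
  apply: eq_card => j; rewrite !inE !ffunE.
  apply/idP/imsetP => [h|[i]]; last by rewrite inE => h ->; rewrite enum_rankK;
    case: (f u i) h; case: (f v i); case: (z i).
  exists (enum_val j); rewrite ?enum_valK // inE.
  by move: h; case: (f u _); case: (f v _); case: (z _).
Qed.

Lemma daisy_centered : daisy_cube G -> exists n (f : G -> {ffun 'I_n -> bool}) z,
  [/\ injective f, forall u v, adj u v = (ham (f u) (f v) == 1) & centered f z].
Proof.
case=> n [D [_ dD [g [gb ga]]]].
exists n, (fun x => val (g x)), [ffun=> false]; split=> [x y /val_inj|u v|v u h].
- exact: (bij_inj gb).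
- by rewrite -ga.
have uD : u \in D.
  apply: dD (valP (g v)) _ => i; apply/implyP => ui.
  by rewrite -h // ui ffunE.
by case: gb => g' _ g'K; exists (g' (Sub u uD)); rewrite g'K.
Qed.

Lemma daisy_gt0 : daisy_cube G -> 0 < #|G|.
Proof.
case=> n [D [/set0Pn[d dD] _ [g [[g' _ _] _]]]].
by apply/card_gt0P; exists (g' (Sub d dD)).
Qed.

Lemma centered_hit (I : finType) (f : G -> {ffun I -> bool}) z :
  0 < #|G| -> centered f z -> exists x, f x = z.
Proof.
by case/card_gt0P => v _ fc; apply: (fc v z) => i; rewrite eqxx.
Qed.

(* In a daisy cube every vertex v has exactly d(v, 0) neighbours closer to the
   minimum 0, and no vertex of a partial cube has more than d(v, 0) of them. *)
Lemma daisy_center (I : finType) (f : G -> {ffun I -> bool}) :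
  daisy_cube G -> geodesic f ->
  exists z, forall v i, f v i != f z i -> exists w, f w = flip i (f v).
Proof.
move=> dG gf; have [n [h [z0 [hi ha hc]]]] := daisy_centered dG.
have [z hz] := centered_hit (daisy_gt0 dG) hc.
have gh := centered_geodesic hi ha hc; subst z0.
exists z => v i vi.
have ed x : ham (f x) (f z) = ham (h x) (h z).
  by rewrite -(geodesic_dist _ _ gf) -(geodesic_dist _ _ gh).
pose W := [set w | adj v w && (ham (f w) (f z) < ham (f v) (f z))].
pose A := [set flip i (f v) | i in [set i | f v i != f z i]].
have fi := geodesic_inj gf.
have cA : #|A| = ham (f v) (f z) by rewrite card_imset //; apply: flip_inj.
have sWA : f @: W \subset A.
  apply/subsetP => _ /imsetP[w + ->]; rewrite inE; case: (gf) => -> _.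
  case/andP=> /ham1P[j hj fw]; rewrite fw => lt; apply: imset_f; rewrite inE.
  by apply: contraTN lt => /eqP e; rewrite ham_flip_gt // -leqNgt leqnSn.
have cW : #|A| <= #|W|.
  rewrite cA ed -(card_imset _ hi) /ham -(card_imset _ (@flip_inj _ (h v))).
  apply: subset_leq_card; apply/subsetP => _ /imsetP[j + ->]; rewrite inE => hj.
  have [|w hw] := hc v (flip j (h v)).
    move=> l; case: (eqVneq l j) => [->|nlj]; last by rewrite flip_neq.
    by rewrite flipi; case: (h v j) hj; case: (h z j).
  apply/imsetP; exists w => //; rewrite inE ha hw ham_flip eqxx !ed hw /=.
  by rewrite [ham (h v) _](ham_flip_lt hj).
have /eqP eA : f @: W == A by rewrite eqEcard sWA card_imset.
have /imsetP[w _ ->] : flip i (f v) \in f @: W.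
  by rewrite eA; apply: imset_f; rewrite inE.
by exists w.
Qed.

End Daisy.

(** * Restrictions and contractions *)

Section Minors.
Variables (G : sgraph) (I : finType) (f : G -> {ffun I -> bool}).
Hypothesis gf : geodesic f.
Variables (a b : G) (k : I).
Hypothesis fb : f b = flip k (f a).

Lemma halfspaceE z : (z \in halfspace a b) = (f z k == f a k).
Proof.
rewrite inE !(geodesic_dist _ _ gf) fb.
case: (eqVneq (f a k) (f z k)) => [e|n]; last first.
  by rewrite [ham (f a) _](ham_flip_lt n) ltnNge leqnSn.
by rewrite ham_flip_gt // ltnSn.
Qed.

Lemma restriction_geodesic : geodesic (fun u : restriction a b => f (val u)).
Proof.
case: gf => ga gs; split=> [u v|u v nuv]; first by rewrite -ga.
have [|w [i [hi fw]]] := gs (val u) (val v); first by apply: contra nuv => /eqP/val_inj->.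
have hk z : z \in halfspace a b -> f z k = f a k by rewrite halfspaceE => /eqP.
suff wh : w \in halfspace a b by exists (Sub w wh), i.
rewrite halfspaceE fw flip_neq ?(hk _ (valP u)) //.
by apply: contraNneq hi => <-; rewrite (hk _ (valP u)) (hk _ (valP v)).
Qed.

Definition setc (c : bool) (u : {ffun I -> bool}) : {ffun I -> bool} :=
  [ffun j => if j == k then c else u j].

Lemma setc_flip c u : setc c (flip k u) = setc c u.
Proof. by apply/ffunP => j; rewrite !ffunE; case: eqP => // _; rewrite addbF. Qed.

Lemma setc_eq c u v : setc c u = setc c v -> v = u \/ v = flip k u.
Proof.
move=> /ffunP h; case: (eqVneq (u k) (v k)) => e; [left|right]; apply/ffunP => j.
  by case: (eqVneq j k) => [->//|n]; have := h j; rewrite !ffunE (negbTE n).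
case: (eqVneq j k) => [->|n]; first by rewrite flipi; case: (u k) e; case: (v k).
by have := h j; rewrite flip_neq // !ffunE (negbTE n).
Qed.

(** Passing from [a] to [b] changes the distance to a vertex by one, up or down according to its bit
    [k]. The two sums in [Theta] therefore differ exactly when the ends of the edge have different
    bits [k]. *)
Lemma class_edgeE u v : class_edge a b u v = (f v == flip k (f u)).
Proof.
rewrite /class_edge /Theta !(geodesic_dist _ _ gf) fb; case: gf => -> _.
case: ham1P => [[l hl fv]|n]; last first.
  by apply/esym/eqP => e; apply: n; exists k; rewrite // e flipi; case: (f u k).
have hk x : ham (flip k (f a)) (f x) =
    if f a k == f x k then (ham (f a) (f x)).+1 else (ham (f a) (f x)).-1.
  by case: eqVneq => [/ham_flip_gt ->|/ham_flip_lt ->].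
have pk x : f a k != f x k -> 0 < ham (f a) (f x) by move=> /ham_flip_lt ->.
have -> : (f v == flip k (f u)) = (f u k != f v k).
  rewrite fv ffunE; case: (eqVneq k l) => [->|n]; first by rewrite eqxx addbT; case: (f u l).
  by rewrite addbF eqxx; apply/eqP => /flip_inj e; rewrite e eqxx in n.
rewrite !hk; have := pk u; have := pk v.
case: (f a k); case: (f u k); case: (f v k) => //= h1 h2; apply/eqP.
all: try (have := h1 isT); try (have := h2 isT); lia.
Qed.

Lemma connect_class u v :
  connect (class_edge a b) u v = (f v == f u) || (f v == flip k (f u)).
Proof.
apply/idP/orP => [/connectP[p pp ->]|].
  elim: p u pp => [|w p IH] u /=; first by left.
  case/andP; rewrite class_edgeE => /eqP fw /IH; rewrite fw flipK.
  by case=> /eqP ->; rewrite eqxx; [right|left].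
case=> h; last by apply: connect1; rewrite class_edgeE.
by move/eqP: h => /(geodesic_inj gf) ->.
Qed.

Lemma contraction_geodesic (c : bool) : exists g : contraction a b -> {ffun I -> bool},
  [/\ geodesic g, forall C, exists u, g C = setc c (f u)
    & forall u, exists C, g C = setc c (f u)].
Proof.
pose R := connect (class_edge a b).
have eR : {in [set: G] & &, equivalence_rel R}.
  move=> x y z _ _ _; rewrite /R !connect_class eqxx; split=> // /orP[]/eqP->//.
  by rewrite flipK orbC.
pose P := equivalence_partition R [set: G].
have Pp : partition P [set: G] := equivalence_partitionP eR.
have inP (C : contraction a b) : val C \in P by apply: (valP C).
have hrep (C : contraction a b) : {u | u \in val C}.
  apply: sigW; apply/set0Pn.
  by case/and3P: Pp => _ _; apply: contra => /eqP <-.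
have blk u : pblock P u \in P by rewrite pblock_mem // (cover_partition Pp) inE.
pose B u : contraction a b := Sub (pblock P u) (blk u).
have uB u : u \in val (B u) by rewrite /= mem_pblock (cover_partition Pp) inE.
have memC (C : contraction a b) u : u \in val C -> val C = pblock P u.
  by move=> uC; apply/esym/def_pblock => //; case/and3P: Pp.
have RC (C : contraction a b) u v : u \in val C -> (v \in val C) = R u v.
  by move=> /memC ->; rewrite (pblock_equivalence_partition eR) ?inE.
pose g C := setc c (f (sval (hrep C))).
have gE (C : contraction a b) u : u \in val C -> g C = setc c (f u).
  move=> uC; have := svalP (hrep C); rewrite (RC C u) // /R connect_class /g.
  by case/orP=> /eqP->; rewrite ?setc_flip.
have gi : injective g.
  move=> C D gCD; have [u uC] := hrep C; have [v vD] := hrep D.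
  move: gCD; rewrite (gE _ _ uC) (gE _ _ vD) => /setc_eq h; apply: val_inj.
  rewrite (memC _ _ uC) (memC _ _ vD); apply/eqP.
  rewrite eq_pblock ?(cover_partition Pp) ?inE //; last by case/and3P: Pp.
  rewrite (pblock_equivalence_partition eR) ?inE // /R connect_class.
  by case: h => ->; rewrite eqxx ?orbT.
have setc1 x i : i != k -> setc c (flip i x) = flip i (setc c x).
  move=> nik; apply/ffunP => j; rewrite !ffunE.
  by case: (eqVneq j k) => [->|//]; rewrite eq_sym (negbTE nik) addbF.
(* A geodesic step from a member of [C] towards [D] in direction [k] stays inside the class [C] and
   comes closer to the target, so after finitely many of them a step in another direction occurs. *)
have step (C D : contraction a b) : C != D ->
    exists u w i, [/\ u \in val C, i != k, f w = flip i (f u) & f u i != g D i].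
  move=> nCD; have [u uC] := hrep C; have [v vD] := hrep D.
  have [n] := ubnP (ham (f u) (f v)); elim: n u uC => // n IH u uC hn.
  case: (gf) => _ gs; have [|w [i [hi fw]]] := gs u v.
    apply: contraNneq nCD => e; apply/eqP/val_inj; subst v.
    by rewrite (memC _ _ uC) (memC _ _ vD).
  case: (eqVneq i k) => [e|nik].
    apply: (IH w); last by rewrite -ltnS (leq_trans _ hn) // fw -(ham_flip_lt hi) leqnn.
    by rewrite (RC C u) // /R connect_class fw e eqxx orbT.
  by exists u, w, i; split=> //; rewrite (gE _ _ vD) ffunE (negbTE nik).
have gu (C : contraction a b) u i : u \in val C -> i != k -> g C i = f u i.
  by move=> uC nik; rewrite (gE _ _ uC) ffunE (negbTE nik).
have gw (C : contraction a b) u w i :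
    u \in val C -> i != k -> f w = flip i (f u) -> g (B w) = flip i (g C).
  by move=> uC nik fw; rewrite (gE _ _ uC) (gE _ _ (uB w)) fw setc1.
exists g; split=> [|C|u]; last 2 first.
- by exists (sval (hrep C)).
- by exists (B u); rewrite (gE _ _ (uB u)).
split=> [C D|C D /step [u [w [i [uC nik fw hi]]]]]; last first.
  by exists (B w), i; rewrite (gu _ u) // (gw C u w i).
apply/idP/idP.
  case/andP=> nCD /exists_inP[u uC /exists_inP[v vD]].
  case: (gf) => -> _ /ham1P[i _ fv].
  have nik : i != k.
    apply: contraNneq nCD => e; apply/eqP/val_inj.
    have vC : v \in val C by rewrite (RC C u) // /R connect_class fv e eqxx orbT.
    by rewrite (memC _ _ vC) (memC _ _ vD).
  by rewrite (gE _ _ vD) (gE _ _ uC) fv setc1 // ham_flip.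
move=> h1; have nCD : C != D by apply: contraTneq h1 => ->; rewrite hamxx.
have [u [w [i [uC nik fw hi]]]] := step C D nCD.
have wD : B w = D.
  apply: gi; rewrite (gw _ _ _ _ uC nik fw); apply/eqP; rewrite -ham_eq0 -eqSS.
  by rewrite -ham_flip_lt ?h1 // (gu _ u).
rewrite /adj /= nCD; apply/exists_inP; exists u => //; apply/exists_inP; exists w.
  by rewrite -wD.
by case: gf => -> _; rewrite fw ham_flip.
Qed.

End Minors.

Lemma adj_flip (G : sgraph) (I : finType) (f : G -> {ffun I -> bool}) a b :
  geodesic f -> adj a b -> exists k, f b = flip k (f a).
Proof. by case=> -> _ /ham1P[k _ ->]; exists k. Qed.

Section Isomorphism.
Variables (K H : sgraph).

Lemma geodesic_iso (I : finType) (g : K -> H) (f : H -> {ffun I -> bool}) :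
  graph_iso g -> geodesic f -> geodesic (f \o g).
Proof.
case=> gb ga [fa fs]; split=> [u v|u v nuv]; first by rewrite -ga fa.
have [|w [i [hi fw]]] := fs (g u) (g v); first by rewrite (bij_eq gb).
by case: gb => g' _ g'K; exists (g' w), i; rewrite /= g'K.
Qed.

End Isomorphism.

(** * Testing one-step minors for being daisy cubes *)

Section OneStep.
Variables (G : sgraph) (I : finType) (f : G -> {ffun I -> bool}).
Hypothesis gf : geodesic f.

Lemma not_daisy : (forall z, exists v i,
    f v i != f z i /\ forall w, f w != flip i (f v)) -> ~ daisy_cube G.
Proof.
move=> h dG; have [z hz] := daisy_center dG gf.
have [v [i [hi nw]]] := h z; have [w fw] := hz v i hi.
by have := nw w; rewrite fw eqxx.
Qed.

Variables (a b : G) (k : I).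
Hypothesis fb : f b = flip k (f a).

Lemma restriction_gt0 : 0 < #|restriction a b|.
Proof.
have ah : a \in halfspace a b by rewrite (halfspaceE gf fb).
by apply/card_gt0P; exists (Sub a ah).
Qed.

Lemma contraction_gt0 : 0 < #|contraction a b|.
Proof.
have [g [_ _ h]] := contraction_geodesic gf fb false.
by have [C _] := h a; apply/card_gt0P; exists C.
Qed.

(** Losing vertices is how a one-step minor is recognised as proper. *)
Lemma restriction_lt : #|restriction a b| < #|G|.
Proof.
have -> : #|restriction a b| = #|halfspace a b| by apply: card_sig.
apply/proper_card/properP; split; first by apply/subsetP.
by exists b; rewrite ?(halfspaceE gf fb) // fb flipi; case: (f a k).
Qed.

Lemma contraction_lt : #|contraction a b| < #|G|.
Proof.
have [g [gg gf1 _]] := contraction_geodesic gf fb false.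
rewrite -(card_imset _ (geodesic_inj gg)) -[#|G|](card_imset _ (geodesic_inj gf)).
(* Since [a] and [b] get the same frozen code, the vertices other than [b] already yield all codes
   of the contraction. *)
have s : g @: contraction a b \subset setc k false @: (f @: [set~ b]).
  apply/subsetP => _ /imsetP[C _ ->]; have [u ->] := gf1 C.
  case: (eqVneq u b) => [->|nub]; last by do 2!apply: imset_f; rewrite !inE.
  rewrite fb setc_flip; do 2!apply: imset_f; rewrite !inE.
  apply/negP => /eqP e; have := fb; rewrite -e => /ffunP/(_ k).
  by rewrite flipi; case: (f a k).
apply: leq_ltn_trans (subset_leq_card s) _; apply: leq_ltn_trans (leq_imset_card _ _) _.
rewrite !card_imset; [|exact: geodesic_inj gf..].
by rewrite cardsC1; rewrite ltn_predL; apply/card_gt0P; exists a.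
Qed.

Lemma restriction_not_daisy :
  (forall z, f z k = f a k -> exists v i,
    [/\ f v k = f a k, f v i != f z i & forall w, f w != flip i (f v)]) ->
  ~ daisy_cube (restriction a b).
Proof.
move=> h dR; have [z hz] := daisy_center dR (restriction_geodesic gf fb).
have /eqP zk : f (val z) k == f a k by rewrite -(halfspaceE gf fb) (valP z).
have [v [i [vk hi nw]]] := h _ zk.
have vh : v \in halfspace a b by rewrite (halfspaceE gf fb) vk.
have [w fw] := hz (Sub v vh) i hi.
by have := nw (val w); rewrite fw eqxx.
Qed.

Lemma contraction_not_daisy :
  (forall z, exists v i, setc k false (f v) i != setc k false (f z) i /\
    forall w, setc k false (f w) != flip i (setc k false (f v))) ->
  ~ daisy_cube (contraction a b).
Proof.
have [g [gg g1 g2]] := contraction_geodesic gf fb false.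
move=> h dC; have [Z hZ] := daisy_center dC gg.
have [z gZ] := g1 Z; have [v [i [hi nw]]] := h z; have [V gV] := g2 v.
have [|W gW] := hZ V i; first by rewrite gV gZ.
by have [w e] := g1 W; have := nw w; rewrite -e gW gV eqxx.
Qed.

Lemma restriction_daisy (z : {ffun I -> bool}) : z k = f a k ->
  (forall v (u : {ffun I -> bool}), f v k = f a k ->
    (forall i, u i != z i -> u i = f v i) -> exists w, f w = u) ->
  daisy_cube (restriction a b).
Proof.
move=> zk h; have gr := restriction_geodesic gf fb.
apply: (centered_daisy restriction_gt0 (geodesic_inj gr) gr.1 (z := z)) => v u hu.
have /eqP vk : f (val v) k == f a k by rewrite -(halfspaceE gf fb) (valP v).
have [w fw] := h _ _ vk hu.
have wh : w \in halfspace a b.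
  rewrite (halfspaceE gf fb) fw -zk; case: (eqVneq (u k) (z k)) => // n.
  by have := n; rewrite (hu k n) vk zk eqxx.
by exists (Sub w wh).
Qed.

Lemma contraction_daisy c (z : {ffun I -> bool}) :
  (forall v (u : {ffun I -> bool}), (forall i, u i != z i -> u i = setc k c (f v) i) ->
    exists w, setc k c (f w) = u) ->
  daisy_cube (contraction a b).
Proof.
have [g [gg g1 g2]] := contraction_geodesic gf fb c; move=> h.
apply: (centered_daisy contraction_gt0 (geodesic_inj gg) gg.1 (z := z)) => V u hu.
have [v gV] := g1 V; have [w <-] : exists w, setc k c (f w) = u.
  by apply: (h v) => i /hu; rewrite gV.
by have [W gW] := g2 w; exists W.
Qed.

End OneStep.

Lemma daisy_minor (G : sgraph) (a b : G) : daisy_cube G -> adj a b ->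
  daisy_cube (restriction a b) /\ daisy_cube (contraction a b).
Proof.
move=> dG; have [n [f [z [fi fa fc]]]] := daisy_centered dG.
have gf := centered_geodesic fi fa fc.
case/(adj_flip gf) => k fb; split.
  apply: (restriction_daisy gf fb (z := setc k (f a k) z)); first by rewrite ffunE eqxx.
  move=> v u vk hu; apply: (fc v) => i hi; case: (eqVneq i k) => [e|nik].
    subst i; case: (eqVneq (u k) (f a k)) => [->//|nuk]; apply: hu.
    by rewrite ffunE eqxx.
  by apply: hu; rewrite ffunE (negbTE nik).
apply: (contraction_daisy gf fb (c := z k) (z := z)) => v u hu.
have uk : u k = z k.
  by case: (eqVneq (u k) (z k)) => // /hu; rewrite ffunE eqxx.
have [|w fw] := fc v u.
  move=> i ui; rewrite (hu _ ui) ffunE; case: eqP => // e.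
  by rewrite e uk eqxx in ui.
exists w; apply/ffunP => i; rewrite !ffunE fw.
by case: eqP => // ->.
Qed.

(** Along a sequence of minors every graph is a copy of [H] or already a daisy cube, and
    [daisy_minor] preserves the latter. All copies of [H] enter the hypothesis because properness is
    defined up to isomorphism. *)
Lemma minors_daisy (H : sgraph) :
  (forall (K : sgraph) (a b : K), isomorphic K H -> adj a b ->
    daisy_cube (restriction a b) /\ daisy_cube (contraction a b)) ->
  forall K, pc_minor H K -> ~ isomorphic K H -> daisy_cube K.
Proof.
move=> h K m; suff [] : isomorphic K H \/ daisy_cube K by [].
elim: m => {K} [|K a b _ IH ab|K a b _ IH ab].
- by left; exists id; split=> //; exists id.
- by right; case: IH => [/h/(_ ab)[]|/daisy_minor/(_ ab)[]].
- by right; case: IH => [/h/(_ ab)[]|/daisy_minor/(_ ab)[]].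
Qed.

Lemma isomorphic_card (K H : sgraph) : isomorphic K H -> #|K| = #|H|.
Proof. by case=> g [gb _]; apply: (bij_eq_card gb). Qed.

Section NotOD.
Variables (G : sgraph) (I : finType) (f : G -> {ffun I -> bool}).
Hypothesis gf : geodesic f.
Variables (a b : G) (k : I).
Hypothesis fb : f b = flip k (f a).

Let ab : adj a b. Proof. by case: gf => -> _; rewrite fb ham_flip. Qed.

Lemma restriction_not_OD : ~ daisy_cube (restriction a b) -> ~ in_OD G.
Proof.
move=> nd [_ _ h]; apply/nd/h.
  exact: pc_minor_restriction (pc_minor_refl _) ab.
by move/isomorphic_card => e; have := restriction_lt gf fb; rewrite e ltnn.
Qed.

Lemma contraction_not_OD : ~ daisy_cube (contraction a b) -> ~ in_OD G.
Proof.
move=> nd [_ _ h]; apply/nd/h.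
  exact: pc_minor_contraction (pc_minor_refl _) ab.
by move/isomorphic_card => e; have := contraction_lt gf fb; rewrite e ltnn.
Qed.

End NotOD.

(** A connected graph with at most three vertices has a vertex adjacent to all others, and such a
    vertex is a center: between its code and that of a neighbour there is no third point. This
    settles the one-vertex deletion in [B_{1,0}] and the minors of the four-vertex path. *)
Lemma geodesic_small_daisy (G : sgraph) (I : finType) (f : G -> {ffun I -> bool}) :
  geodesic f -> 0 < #|G| <= 3 -> daisy_cube G.
Proof.
move=> gf /andP[G0 G3]; have [fa fs] := gf.
have neq (u v : G) : adj u v -> u != v.
  by apply: contraTneq => ->; rewrite adj_irr.
suff [z hz] : exists z : G, forall v, v != z -> adj z v.
  apply: (centered_daisy G0 (geodesic_inj gf) fa (z := f z)) => v u hu.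
  case: (eqVneq u (f z)) => [->|n]; first by exists z.
  have [e|nvz] := eqVneq v z.
    exfalso; move/negP: n; apply; apply/eqP/ffunP => i.
    by case: (eqVneq (u i) (f z i)) => // /hu ->; rewrite e.
  have := hz v nvz; rewrite fa => /ham1P[k hk fv]; exists v.
  have [i hi] : exists i, u i != f z i.
    apply/existsP; apply: contraR n; rewrite negb_exists => /forallP e.
    by apply/eqP/ffunP => i; have := e i; move/negPn/eqP.
  have ik : i = k.
    have := hu _ hi; move/eqP: hi; rewrite fv ffunE; case: eqP => // _.
    by rewrite addbF.
  subst i; apply/ffunP => j; have [->|nj] := eqVneq j k; first by rewrite hu.
  by rewrite fv flip_neq //; apply/esym/eqP/negPn/negP => m; have := hu j m;
     rewrite fv flip_neq // => e; rewrite e eqxx in m.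
have [/existsP[z /existsP[u /existsP[v /and3P[zu zv nuv]]]]|no] :=
    boolP [exists z : G, exists u : G, exists v : G, [&& adj z u, adj z v & u != v]].
  exists z => w nwz; apply/negPn/negP => nzw.
  suff : 3 < #|G| by rewrite ltnNge G3.
  have : uniq [:: z; u; v; w].
    rewrite /= !inE !negb_or (neq _ _ zu) (neq _ _ zv) nuv eq_sym nwz /= andbT.
    by apply/andP; split; apply: contraNneq nzw => <-.
  by move/card_uniqP => /= <-; apply: max_card.
case/card_gt0P: G0 => z _; exists z => v nvz; rewrite eq_sym in nvz.
have [w [i [hi fw]]] := fs z v nvz.
have zw : adj z w by rewrite fa fw ham_flip.
have [<-//|nwv] := eqVneq w v.
have [t [j [hj ft]]] := fs w v nwv.
case/negP: no; apply/existsP; exists w; apply/existsP; exists z; apply/existsP; exists t.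
rewrite adj_sym zw fa ft ham_flip eqxx /=; apply/eqP => e.
have := ham_flip_lt hi; rewrite -fw (ham_flip_lt hj) -ft -e; lia.
Qed.

(** * Coordinates of B_{r,s} *)

Section Coordinates.
Variables r s : nat.
Implicit Types (x y u v w : bvert r s) (k j : 'I_(r + s)).

(* Uniform coordinates: index k < r is a P_3-coordinate with values 0, 1, 2 and
   index k >= r a binary one with values 0, 1. *)
Definition cap (k : nat) : nat := if k < r then 2 else 1.

Definition vl x k : nat :=
  match split k with inl i => x.1 i | inr j => x.2 j end.

Definition mk (h : 'I_(r + s) -> nat) : bvert r s :=
  ([ffun i => inord (h (lshift s i))], [ffun i => h (rshift r i) == 1]).

Definition upd x k t := mk (fun j => if j == k then t else vl x j).

Lemma vl_lshift x i : vl x (lshift s i) = x.1 i.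
Proof. by rewrite /vl -[lshift s i]/(unsplit (inl i)) unsplitK. Qed.

Lemma vl_rshift x (j : 'I_s) : vl x (rshift r j) = x.2 j.
Proof. by rewrite /vl -[rshift r j]/(unsplit (inr j)) unsplitK. Qed.

Lemma cap_lshift (i : 'I_r) : cap (lshift s i) = 2.
Proof. by rewrite /cap /= ltn_ord. Qed.

Lemma cap_rshift (j : 'I_s) : cap (rshift r j) = 1.
Proof. by rewrite /cap /= ltnNge leq_addr. Qed.

Lemma coordP (P : 'I_(r + s) -> Prop) :
  (forall i, P (lshift s i)) -> (forall i, P (rshift r i)) -> forall k, P k.
Proof. by move=> hl hr k; rewrite -[k]splitK; case: (split k) => i /=. Qed.

Lemma vl_cap x k : vl x k <= cap k.
Proof.
move: k; apply: coordP => i.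
  by rewrite vl_lshift cap_lshift -ltnS ltn_ord.
by rewrite vl_rshift cap_rshift; case: (x.2 i).
Qed.

Lemma cap_le2 k : cap k <= 2.
Proof. by rewrite /cap; case: ifP. Qed.

Lemma cap_gt0 k : 0 < cap k.
Proof. by rewrite /cap; case: ifP. Qed.

Lemma vl_le2 x k : vl x k <= 2.
Proof. exact: leq_trans (vl_cap x k) (cap_le2 k). Qed.

Lemma vl_mk h k : (forall j, h j <= cap j) -> vl (mk h) k = h k.
Proof.
move=> hc; move: k; apply: coordP => i.
  by rewrite vl_lshift ffunE inordK // ltnS -(cap_lshift i).
rewrite vl_rshift ffunE; have := hc (rshift r i); rewrite cap_rshift.
by case: (h _) => [|[|]].
Qed.

Lemma vl_inj x y : (forall k, vl x k = vl y k) -> x = y.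
Proof.
move=> h; case: x h => x1 x2; case: y => y1 y2 h; congr pair; apply/ffunP => i.
  by apply: val_inj; have := h (lshift s i); rewrite !vl_lshift.
have := h (rshift r i); rewrite !vl_rshift /=.
by case: (x2 i); case: (y2 i).
Qed.

Lemma vl_upd x k t j : t <= cap k -> vl (upd x k t) j = if j == k then t else vl x j.
Proof.
move=> tc; rewrite vl_mk // => i; case: eqP => [->//|_]; exact: vl_cap.
Qed.

Lemma vl_neq x y : x != y -> exists k, vl x k != vl y k.
Proof.
move=> nxy; apply/existsP; apply: contraR nxy; rewrite negb_exists => /forallP h.
by apply/eqP/vl_inj => k; have := h k; move/negPn/eqP.
Qed.

(** Unary code: the values 0, 1, 2 become 00, 10, 11, the Boolean index being read as the threshold
    0 or 1. A binary coordinate also receives two bits, the second of them constantly false. *)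
Definition code x : {ffun 'I_(r + s) * bool -> bool} :=
  [ffun c : 'I_(r + s) * bool => c.2 < vl x c.1].

Lemma codeE x k b : code x (k, b) = (b < vl x k).
Proof. by rewrite ffunE. Qed.

Lemma code_eq x y k : (forall b, code x (k, b) = code y (k, b)) -> vl x k = vl y k.
Proof.
move=> h; have := h false; have := h true; rewrite !codeE.
have := vl_le2 x k; have := vl_le2 y k.
by case: (vl x k) => [|[|[|]]]; case: (vl y k) => [|[|[|]]].
Qed.

Lemma code_inj : injective code.
Proof. by move=> x y e; apply: vl_inj => k; apply: code_eq => b; rewrite e. Qed.

Lemma code_flip x y k (b : bool) : (forall j, j != k -> vl x j = vl y j) ->
  (vl x k = b /\ vl y k = b.+1) \/ (vl x k = b.+1 /\ vl y k = b) ->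
  code y = flip (k, b) (code x).
Proof.
move=> he hk; apply/ffunP => -[j c]; rewrite [RHS]ffunE !codeE xpair_eqE.
case: (eqVneq j k) => [->|nj] /=; last by rewrite addbF he.
by case: hk => [] [-> ->]; case: b; case: c.
Qed.

Lemma step_bit (m n : nat) : n <= 2 -> n = m.+1 -> exists b : bool, m = b /\ n = b.+1.
Proof. by case: m n => [|[|m]] n hn e; [exists false|exists true|lia]. Qed.

Lemma card_split_ord (P : pred 'I_(r + s)) :
  #|[set k | P k]| = #|[set i | P (lshift s i)]| + #|[set i | P (rshift r i)]|.
Proof.
rewrite -!sum1_card big_mkcond big_split_ord /=; congr addn.
all: by rewrite [RHS]big_mkcond; apply: eq_bigr => i _; rewrite !inE.
Qed.

Definition step_at x y k : Prop :=
  (forall j, j != k -> vl x j = vl y j) /\ (vl x k = (vl y k).+1 \/ vl y k = (vl x k).+1).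

Lemma adjP x y : reflect (exists k, step_at x y k) (@adj (bgraph r s) x y).
Proof.
have -> : @adj (bgraph r s) x y = (#|[set k | vl x k != vl y k]| == 1) &&
    [forall k, (vl x k != vl y k) ==> ((vl x k == (vl y k).+1) || (vl y k == (vl x k).+1))].
  rewrite card_split_ord /=; congr (_ && _).
    congr (_ + _ == _); apply: eq_card => i.
      by rewrite !inE !vl_lshift.
    by rewrite !inE !vl_rshift; case: (x.2 i); case: (y.2 i).
  apply/forallP/forallP => h.
    apply: coordP => i; first by have := h i; rewrite !vl_lshift.
    by rewrite !vl_rshift; case: (x.2 i); case: (y.2 i).
  by move=> i; have := h (lshift s i); rewrite !vl_lshift.
apply: (iffP andP) => [[/cards1P[k /setP hk] /forallP hs]|[k [he hk]]].
  have hk' j : (vl x j != vl y j) = (j == k) by have := hk j; rewrite !inE.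
  exists k; split=> [j|]; first by rewrite -hk' negbK => /eqP.
  by have := hs k; rewrite hk' eqxx => /orP[]/eqP; [left|right].
have hn j : (vl x j != vl y j) = (j == k).
  by case: (eqVneq j k) => [->|/he->]; rewrite ?eqxx //; apply/eqP; lia.
split; first by apply/cards1P; exists k; apply/setP => j; rewrite !inE.
apply/forallP => j; rewrite hn; apply/implyP => /eqP ->.
by case: hk => ->; rewrite eqxx ?orbT.
Qed.

Lemma adj_code x y : @adj (bgraph r s) x y = (ham (code x) (code y) == 1).
Proof.
apply/adjP/idP => [[k [he hk]]|/ham1P[[k b] hb e]].
  have [b hb] : exists b : bool, (vl x k = b /\ vl y k = b.+1) \/ (vl x k = b.+1 /\ vl y k = b).
    case: hk => /step_bit[|b [-> ->]]; rewrite ?vl_le2 //; exists b; [by right|by left].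
  by rewrite (code_flip he hb) ham_flip.
exists k; split=> [j nj|].
  by apply: code_eq => c; rewrite e [RHS]ffunE xpair_eqE (negbTE nj) addbF.
have h0 : code y (k, b) = ~~ code x (k, b) by rewrite e flipi.
have h1 : code y (k, ~~ b) = code x (k, ~~ b).
  by rewrite e flip_neq // xpair_eqE eqxx; case: b {h0 e hb}.
move: h0 h1; rewrite !codeE; have := vl_le2 x k; have := vl_le2 y k.
by case: b {e hb} => /=; lia.
Qed.

Definition toward u v k :=
  upd u k (if vl u k < vl v k then (vl u k).+1 else (vl u k).-1).

Lemma vl_toward u v k j : vl (toward u v k) j =
  if j == k then if vl u k < vl v k then (vl u k).+1 else (vl u k).-1 else vl u j.
Proof.
by rewrite vl_upd //; have := vl_cap u k; have := vl_cap v k; case: ifP; lia.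
Qed.

Lemma code_toward u v k : vl u k != vl v k -> exists b,
  code u (k, b) != code v (k, b) /\ code (toward u v k) = flip (k, b) (code u).
Proof.
move=> nk; have hu := vl_le2 u k; have hv := vl_le2 v k.
have vt := vl_toward u v k k; rewrite eqxx in vt.
have he j : j != k -> vl u j = vl (toward u v k) j by rewrite vl_toward => /negbTE ->.
case: ltnP vt => lt vt.
  have [b [ub wb]] := step_bit (vl_le2 _ _) vt; exists b.
  split; last by apply: code_flip => //; left.
  by rewrite !codeE; apply/eqP; lia.
have [|b [wb ub]] := @step_bit (vl (toward u v k) k) (vl u k) hu; first by lia.
exists b; split; last by apply: code_flip => //; right.
by rewrite !codeE; apply/eqP; lia.
Qed.

Lemma geodesic_bgraph : geodesic (code : bgraph r s -> _).
Proof.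
split=> [|u v]; first exact: adj_code.
by case/vl_neq => k /code_toward[b hb]; exists (toward u v k), (k, b).
Qed.

Lemma geodesic_induced (A : {set bgraph r s}) :
  {in A &, forall u v, u != v -> exists2 k, vl u k != vl v k & toward u v k \in A} ->
  geodesic (fun u : induced A => code (val u)).
Proof.
move=> h; split=> [u v|u v nuv]; first exact: adj_code.
have [k /code_toward[b hb] wA] := h _ _ (valP u) (valP v) nuv.
by exists (Sub (toward (val u) (val v) k) wA), (k, b).
Qed.

Lemma cornerP x : reflect (forall k, vl x k = 0 \/ vl x k = cap k) (corner x).
Proof.
apply: (iffP forallP) => [h|h i].
  apply: coordP => i; first by rewrite vl_lshift cap_lshift; case/orP: (h i) => /eqP; auto.
  by rewrite vl_rshift cap_rshift; case: (x.2 i); auto.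
by case: (h (lshift s i)); rewrite vl_lshift ?cap_lshift => ->; rewrite ?orbT.
Qed.

Lemma qnumE x y : qnum x y = #|[set k : 'I_(r + s) | (r <= k) && (vl x k != vl y k)]|.
Proof.
rewrite card_split_ord /= [X in _ = X + _](_ : _ = 0).
  apply: eq_card => j; rewrite !inE !vl_rshift leq_addr.
  by case: (x.2 j); case: (y.2 j).
by apply/eqP; rewrite cards_eq0; apply/eqP/setP => i; rewrite !inE leqNgt ltn_ord.
Qed.

Lemma pnumE x y : pnum x y =
  #|[set k | (vl x k == 0) && (vl y k == 2) || (vl x k == 2) && (vl y k == 0)]|.
Proof.
rewrite card_split_ord /= [X in _ = _ + X](_ : _ = 0) ?addn0.
  by apply: eq_card => i; rewrite !inE !vl_lshift.
apply/eqP; rewrite cards_eq0; apply/eqP/setP => i; rewrite !inE !vl_rshift.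
by case: (x.2 i); case: (y.2 i).
Qed.

Definition corner_edge x y k : Prop :=
  [/\ k < r, corner x, vl y k = 1 & forall j, j != k -> vl x j = vl y j].

Lemma boundary_P3_edgeP x y :
  boundary_P3_edge x y <-> exists k, corner_edge x y k \/ corner_edge y x k.
Proof.
split=> [[/adjP[k [he hk]] [i ni] c]|].
  have ki : k = lshift s i.
    apply/eqP; apply: contraR ni => nk; apply/eqP/val_inj.
    by rewrite /= -!vl_lshift he // eq_sym.
  have kr : k < r by rewrite ki /= ltn_ord.
  have ck : cap k = 2 by rewrite /cap kr.
  exists k; case/orP: c => c; [left|right]; split=> //; move/cornerP/(_ k): (c); rewrite ck.
  - by have := vl_le2 x k; have := vl_le2 y k; lia.
  - by have := vl_le2 x k; have := vl_le2 y k; lia.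
  - by move=> _ j /he.
case=> k h; have kr : k < r by case: h => -[].
have ck : cap k = 2 by rewrite /cap kr.
have st : step_at x y k.
  by case: h => -[_ /cornerP/(_ k) c v1 he]; split=> [j /he//|]; rewrite v1 ck in c *; lia.
split; [by apply/adjP; exists k| |by case: h => -[_ -> _ _]; rewrite ?orbT].
have [i ki] : exists i, k = lshift s i by exists (Ordinal kr); apply: val_inj.
exists i; case: st => _; rewrite ki !vl_lshift => st; apply/eqP => e.
by move: st; rewrite e; lia.
Qed.

Lemma restP x y u : (u \in rest x y) = (u != x) && (u != y).
Proof. by rewrite !inE negb_or. Qed.

Lemma restC x y : rest x y = rest y x.
Proof. by rewrite /rest setUC. Qed.

Lemma bdelC x y : bdel x y = bdel y x.
Proof. by rewrite /bdel restC. Qed.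

End Coordinates.

(** * Isometric deletions *)

Section TwoVertices.
Variables r s : nat.
Implicit Types (x y u v w : bvert r s) (k j : 'I_(r + s)).

Lemma cap1 k : cap r k = 1 -> r <= k.
Proof. by rewrite /cap; case: ltnP. Qed.

Lemma step_irr (n : nat) : ~ (n = n.+1 \/ n = n.+1).
Proof. by lia. Qed.

Lemma corner_step x y k : corner x -> corner y ->
  vl x k = (vl y k).+1 \/ vl y k = (vl x k).+1 -> r <= k.
Proof.
move=> /cornerP/(_ k) cx /cornerP/(_ k) cy h; apply: cap1.
by have := cap_le2 k; have := cap_gt0 k; lia.
Qed.

Lemma pq_differ2 x y k1 k2 : k1 != k2 -> r <= k1 -> r <= k2 ->
  (forall j, (vl x j != vl y j) = (j == k1) || (j == k2)) -> (pnum x y, qnum x y) = (0, 2).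
Proof.
move=> n12 h1 h2 h; rewrite pnumE qnumE; congr pair.
  apply/eqP; rewrite cards_eq0; apply/eqP/setP => j; rewrite !inE; apply/negbTE/negP => e.
  have rj : r <= j.
    have : vl x j != vl y j by apply: contraTneq e => ->; case: (vl y j) => [|[|[|]]].
    by rewrite h => /orP[]/eqP ->.
  have := vl_cap x j; have := vl_cap y j; rewrite /cap ltnNge rj /=.
  by case/orP: e => /andP[/eqP -> /eqP ->].
have -> : 2 = #|[set k1; k2]| by rewrite cards2 n12.
apply: eq_card => j; rewrite !inE h; apply: andb_idl.
by case/orP => /eqP ->.
Qed.

Lemma pq_differ1 x y k : r <= k -> vl x k != vl y k ->
  (forall j, j != k -> vl x j = vl y j) -> (pnum x y, qnum x y) = (0, 1).
Proof.
move=> hk nk h; have hn j : (vl x j != vl y j) = (j == k).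
  by case: (eqVneq j k) => [->//|/h ->]; rewrite eqxx.
rewrite pnumE qnumE; congr pair.
  apply/eqP; rewrite cards_eq0; apply/eqP/setP => j; rewrite !inE; apply/negbTE/negP => e.
  have jk : j = k.
    by apply/eqP; rewrite -hn; apply: contraTneq e => ->; case: (vl y j) => [|[|[|]]].
  have := vl_cap x j; have := vl_cap y j; rewrite /cap jk ltnNge hk /= -jk.
  by case/orP: e => /andP[/eqP -> /eqP ->].
rewrite -(cards1 k); apply: eq_card => j; rewrite !inE hn; apply: andb_idl.
by move/eqP => ->.
Qed.

Lemma pnum0_eq x y k : corner x -> corner y -> pnum x y = 0 -> k < r -> vl x k = vl y k.
Proof.
move=> /cornerP/(_ k) cx /cornerP/(_ k) cy; rewrite pnumE => /eqP.
rewrite cards_eq0 => /eqP/setP/(_ k); rewrite !inE => h kr; move: h cx cy.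
by rewrite /cap kr => h [] e1 [] e2; rewrite e1 e2 in h *.
Qed.

Lemma corners_differ2 x y : corner x -> corner y -> (pnum x y, qnum x y) = (0, 2) ->
  exists k1 k2, [/\ k1 != k2, r <= k1, r <= k2 &
    forall j, (vl x j != vl y j) = (j == k1) || (j == k2)].
Proof.
move=> cx cy [p0 /eqP]; rewrite qnumE => /cards2P[k1 [k2 [n12 /setP e]]].
have h j : (r <= j) && (vl x j != vl y j) = (j == k1) || (j == k2).
  by have := e j; rewrite !inE.
exists k1, k2; split=> //.
- by have := h k1; rewrite eqxx => /andP[].
- by have := h k2; rewrite eqxx orbT => /andP[].
- move=> j; rewrite -h; case: leqP => // jr.
  by rewrite (pnum0_eq cx cy p0 jr) eqxx.
Qed.

Lemma qnum_gt0 x y : qnum x y <> 0 -> exists2 k : 'I_(r + s), r <= k & vl x k != vl y k.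
Proof.
rewrite qnumE => /eqP; rewrite cards_eq0 => /set0Pn[k].
by rewrite inE => /andP[]; exists k.
Qed.

Lemma qnum0_eq x y k : qnum x y = 0 -> r <= k -> vl x k = vl y k.
Proof.
rewrite qnumE => /eqP; rewrite cards_eq0 => /eqP/setP/(_ k).
by rewrite !inE => + h; rewrite h => /negbT/negPn/eqP.
Qed.

Lemma rest_or x y w : w \notin rest x y -> w = x \/ w = y.
Proof. by rewrite restP negb_and !negbK => /orP[]/eqP; [left|right]. Qed.

Lemma rest_neq x y w t : w \in rest x y -> t = x \/ t = y -> w <> t.
Proof. by rewrite restP => /andP[/eqP nx /eqP ny] [->|->]. Qed.

(** Steps in different directions reach different vertices. So if [u] and [v] differ in two
    directions, the two blocked steps use up both deleted vertices; if they differ in one only, the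
    blocked vertex is not [v] and must be the middle of a [P_3]-fibre. *)
Lemma blocked_step x y u v : u \in rest x y -> v \in rest x y -> u != v ->
  (forall k, vl u k != vl v k -> toward u v k \notin rest x y) ->
  (exists k1 k2 w1 w2, [/\ k1 != k2, (w1 = x /\ w2 = y) \/ (w1 = y /\ w2 = x),
     step_at u w1 k1 & step_at u w2 k2]) \/
  (exists k w, [/\ w = x \/ w = y, vl w k = 1,
     forall j, j != k -> vl u j = vl w j /\ vl v j = vl w j &
     (vl u k = 0 /\ vl v k = 2) \/ (vl u k = 2 /\ vl v k = 0)]).
Proof.
move=> uA vA nuv h; have [k nk] := vl_neq nuv.
have st j : vl u j != vl v j -> step_at u (toward u v j) j.
  move=> nj; split=> [i ni|]; rewrite vl_toward ?(negbTE ni) // eqxx.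
  by case: ifP; lia.
have [j /andP[njk nj]|one] := pickP (fun j => (j != k) && (vl u j != vl v j)).
  left; exists k, j, (toward u v k), (toward u v j).
  rewrite eq_sym; split; rewrite ?njk //; last 2 first.
  - exact: st.
  - exact: st.
  have nkj : toward u v k <> toward u v j.
    have [_ s1] := st k nk; have [s2 _] := st j nj; move=> e.
    by rewrite e -s2 1?eq_sym // in s1; lia.
  have [e1|e1] := rest_or (h k nk); have [e2|e2] := rest_or (h j nj); auto.
    by case: nkj; rewrite e1 e2.
  by case: nkj; rewrite e1 e2.
right; exists k, (toward u v k).
have eq j : j != k -> vl u j = vl v j.
  by move=> nj; have := one j; rewrite nj => /negbT/negPn/eqP.
have nv : toward u v k <> v.
  by move=> e; have := h k nk; rewrite e vA.
have hd : ~ ((vl u k).+1 = vl v k \/ (vl v k).+1 = vl u k).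
  move=> hd; apply: nv; apply: vl_inj => j; rewrite vl_toward.
  by case: (eqVneq j k) => [->|/eq //]; case: ifP; lia.
have hu := vl_le2 u k; have hv := vl_le2 v k; split; first exact: rest_or (h k nk).
- by rewrite vl_toward eqxx; case: ifP; lia.
- by move=> j nj; rewrite vl_toward (negbTE nj) (eq j nj).
- by lia.
Qed.

Lemma geodesic_bdel x y :
  (forall u v, u \in rest x y -> v \in rest x y -> u != v ->
    ~ (forall k, vl u k != vl v k -> toward u v k \notin rest x y)) ->
  geodesic (fun u : bdel x y => code (val u)).
Proof.
move=> h; apply: geodesic_induced => u v uA vA nuv.
have [k /andP[nk wA]|no] := pickP (fun k => (vl u k != vl v k) && (toward u v k \in rest x y)).
  by exists k.
case: (h u v uA vA nuv) => k nk; have := no k; rewrite nk /= => -> //.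
Qed.

(** A corner is never the middle of a fibre. If both corners are neighbours of [u], they differ by
    one unit in exactly two coordinates, which are therefore binary, and this is the excluded
    case. *)
Lemma corners_geodesic x y : corner x -> corner y -> (pnum x y, qnum x y) <> (0, 2) ->
  geodesic (fun u : bdel x y => code (val u)).
Proof.
move=> cx cy n02; apply: geodesic_bdel => u v uA vA nuv hb.
case: (blocked_step uA vA nuv hb) => [[k1 [k2 [w1 [w2 [n12 e [s1 t1] [s2 t2]]]]]]|]; last first.
  case=> k [w [hw w1 _ uv]]; have cw : corner w by case: hw => ->.
  have := cornerP _ cw k; have := vl_cap u k; have := vl_cap v k; lia.
have c1 : corner w1 by case: e => [] [-> _].
have c2 : corner w2 by case: e => [] [_ ->].
have bin k w w' : corner w -> corner w' -> vl u k = vl w' k ->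
    vl u k = (vl w k).+1 \/ vl w k = (vl u k).+1 -> r <= k.
  by move=> cw cw' ->; apply: corner_step.
have d j : (vl w1 j != vl w2 j) = (j == k1) || (j == k2).
  case: (eqVneq j k1) => [->|n1].
    have nw : vl w1 k1 != vl w2 k1.
      by apply/eqP => e0; move: t1; rewrite e0 -s2 // => /step_irr.
    by rewrite nw.
  case: (eqVneq j k2) => [->|n2].
    have nw : vl w1 k2 != vl w2 k2.
      by apply/eqP => e0; move: t2; rewrite -e0 -s1 1?eq_sym // => /step_irr.
    by rewrite nw.
  by rewrite -s1 // -s2 // eqxx.
apply: n02; apply: (pq_differ2 n12).
- by apply: (bin _ w1 w2) => //; apply: s2.
- by apply: (bin _ w2 w1) => //; apply: s1; rewrite eq_sym.
- by move=> j; case: e => [] [<- <-]; rewrite // eq_sym d.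
Qed.

(** The only [P_3]-fibre that loses its middle is the one through [y] in direction [k], and its end
    [x] is deleted too, so no pair of surviving ends is separated. *)
Lemma corner_edge_geodesic x y k : corner_edge x y k ->
  geodesic (fun u : bdel x y => code (val u)).
Proof.
case=> kr cx yk xy; apply: geodesic_bdel => u v uA vA nuv hb.
case: (blocked_step uA vA nuv hb) => [[k1 [k2 [w1 [w2 [n12 e [s1 t1] [s2 t2]]]]]]|].
  have d1 : vl w1 k1 <> vl w2 k1 by have := s2 k1 n12; lia.
  have d2 : vl w1 k2 <> vl w2 k2 by have := s1 k2; rewrite eq_sym => /(_ n12); lia.
  have dk j : vl w1 j <> vl w2 j -> j = k.
    by move=> d; apply/eqP/negPn/negP => /xy h; case: e => [] [e1 e2]; move: d; rewrite e1 e2 h.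
  by move: n12; rewrite (dk _ d1) (dk _ d2) eqxx.
case=> j [w [hw w1 he uv]].
have cx2 i : vl x i <> 1 \/ cap r i = 1.
  by have := cornerP _ cx i; have := cap_gt0 i; have := cap_le2 i; lia.
have cj : cap r j = 2.
  by have := vl_cap u j; have := vl_cap v j; have := cap_le2 j; lia.
have wy : w = y.
  by case: hw => // wx; have := cx2 j; move: w1; rewrite wx cj; lia.
subst w; have jk : j = k.
  by apply/eqP/negPn/negP => /xy e; have := cx2 j; rewrite e cj; lia.
subst j; have xk := cx2 k; have xl := vl_le2 x k.
have neq z : z \in rest x y -> (forall i, i != k -> vl z i = vl y i) -> vl z k <> vl x k.
  move=> zA hz zk; move: zA; rewrite restP => /andP[/eqP + _]; apply.
  by apply: vl_inj => i; case: (eqVneq i k) => [->//|ni]; rewrite hz // xy.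
have h1 := neq u uA (fun i ni => (he i ni).1); have h2 := neq v vA (fun i ni => (he i ni).2).
lia.
Qed.

End TwoVertices.

(** * Deleting two corners: centers and missing flips *)

Section DaisyDeletions.
Variables r s : nat.
Implicit Types (x y u v w z : bvert r s) (k j : 'I_(r + s)).

Lemma code_bits w k : code w (k, true) -> code w (k, false).
Proof. by rewrite !codeE; apply: ltnW. Qed.

(** Between the codes 00 and 11 lies 01, which encodes no value. The condition on [z] rules out
    exactly this: from the value 1, or from the value of [v], only codes lie in between. *)
Lemma between_code z v (u : {ffun 'I_(r + s) * bool -> bool}) :
  (forall k, k < r -> vl z k = 1 \/ vl z k = vl v k) ->
  (forall c, u c != code z c -> u c = code v c) ->
  exists2 w, code w = u & forall k, vl w k = vl z k \/ vl w k = vl v k.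
Proof.
move=> hz hu; pose w := mk (fun k => u (k, false) + u (k, true)).
have hu' k (b : bool) : u (k, b) = (b < vl z k) \/ u (k, b) = (b < vl v k).
  rewrite -!codeE; case: (eqVneq (u (k, b)) (code z (k, b))) => [|/hu]; auto.
have key k : [/\ u (k, true) -> u (k, false), u (k, false) + u (k, true) <= cap r k
    & u (k, false) + u (k, true) = vl z k \/ u (k, false) + u (k, true) = vl v k].
  have := hu' k false; have := hu' k true; have := hz k.
  have := vl_cap z k; have := vl_cap v k; rewrite /cap.
  case: (k < r) => [zc vc /(_ isT)|zc vc _].
    move: zc vc; case: (vl z k) => [|[|[|]]] //; case: (vl v k) => [|[|[|]]] // _ _;
    case: (u _); case: (u _) => //= h1 h2 h3; split=> //; lia.
  move: zc vc; case: (vl z k) => [|[|]] //; case: (vl v k) => [|[|]] // _ _;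
  case: (u _); case: (u _) => //= h1 h2; split=> //; lia.
have vw k : vl w k = u (k, false) + u (k, true).
  by rewrite vl_mk // => j; case: (key j).
exists w => [|k]; last by rewrite vw; case: (key k).
apply/ffunP => -[k b]; rewrite codeE vw; case: (key k) => + _ _.
by case: b; case: (u (k, true)); case: (u (k, false)) => // ->.
Qed.

(* Seen from anti x as minimum, the corner x is a maximal vertex. *)
Definition anti x := mk (fun k => if k < r then 1 else 1 - vl x k).

Lemma vl_anti x k : vl (anti x) k = if k < r then 1 else 1 - vl x k.
Proof. by rewrite vl_mk // => j; rewrite /cap; case: ifP => // _; exact: leq_subr. Qed.

Lemma anti_neq x k : corner x -> vl (anti x) k <> vl x k.
Proof.
move/cornerP/(_ k); rewrite vl_anti /cap; case: ifP => _; lia.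
Qed.

Lemma vl_binary x j : r <= j -> vl x j <= 1.
Proof. by move=> rj; have := vl_cap x j; rewrite /cap ltnNge rj. Qed.

Lemma binary_values x y w j : r <= j -> vl x j != vl y j ->
  vl w j = vl x j \/ vl w j = vl y j.
Proof.
move=> rj; have := vl_binary x rj; have := vl_binary y rj; have := vl_binary w rj; lia.
Qed.

(** With [anti x] as minimum, [x] is maximal. For [q = 0] so is [y], because it has the binary
    coordinates of [x]; for [(p, q) = (0, 1)] the only vertex above [y] is [x]. In both cases an
    up-closed set is deleted. *)
Lemma corners_daisy x y : x != y -> corner x -> corner y -> 0 < #|bdel x y| ->
  qnum x y = 0 \/ (pnum x y, qnum x y) = (0, 1) -> daisy_cube (bdel x y).
Proof.
move=> nxy cx cy H0 q01.
have gf : geodesic (fun u : bdel x y => code (val u)).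
  by apply: corners_geodesic => // -[p q]; case: q01 => [|[]]; rewrite q.
apply: (centered_daisy H0 (geodesic_inj gf) gf.1 (z := code (anti x))) => v u hu.
have [|w wu hw] := @between_code (anti x) (val v) u _ hu.
  by move=> k kr; rewrite vl_anti kr; left.
suff wA : w \in rest x y by exists (Sub w wA).
have := valP v; rewrite !restP => /andP[/eqP vx /eqP vy]; apply/andP; split; apply/eqP => e.
  apply: vx; apply: vl_inj => k; case: (hw k); rewrite e // => e'.
  by case: (anti_neq (k := k) cx).
have vk k : vl y k = vl x k -> vl (val v) k = vl y k.
  move=> yx; case: (hw k); rewrite e // => e'.
  by case: (anti_neq (k := k) cx); rewrite -e'.
have vr k : k < r -> vl (val v) k = vl y k.
  move=> kr; case: (hw k); rewrite e // vl_anti kr => e'.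
  by have := cornerP _ cy k; rewrite e' /cap kr; lia.
case: q01 => [q0|[p0 q1]].
  apply: vy; apply: vl_inj => k; case: (ltnP k r) => [/vr //|rk].
  by apply: vk; rewrite (qnum0_eq q0).
move/eqP: q1; rewrite qnumE => /cards1P[j /setP hj].
have eqj k : k != j -> vl x k = vl y k.
  move=> nk; case: (ltnP k r) => [/(pnum0_eq cx cy p0) //|rk].
  by have := hj k; rewrite !inE rk (negbTE nk) => /negbFE/eqP.
have [rj nj] : r <= j /\ vl x j != vl y j.
  by apply/andP; have := hj j; rewrite !inE eqxx.
have vj : vl (val v) j = vl x j \/ vl (val v) j = vl y j.
  exact: binary_values.
case: vj => vj; [apply: vx|apply: vy]; apply: vl_inj => k;
  by case: (eqVneq k j) => [->//|nk]; rewrite vk ?eqj.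
Qed.

Lemma boundary_P2_daisy x y k : r + s = 1 -> corner_edge x y k -> 0 < #|bdel x y| ->
  daisy_cube (bdel x y).
Proof.
move=> rs1 ce H0; apply: (geodesic_small_daisy (corner_edge_geodesic ce)).
have all_k j : j = k.
  by apply/ord_inj; have := ltn_ord j; have := ltn_ord k; lia.
rewrite H0 -(card_in_imset (f := fun u : bdel x y => inord (vl (val u) k) : 'I_3)).
  by apply: leq_trans (max_card _) _; rewrite card_ord.
move=> u v _ _ e; apply/val_inj/vl_inj => j; rewrite (all_k j).
by have := congr1 val e; rewrite /= !inordK // ltnS vl_le2.
Qed.

(* Flipping the binary coordinate j in whichever of x, y agrees there with z gives
   a vertex v whose neighbour towards z in direction j is deleted. *)
Lemma corners_missing x y j i z : r <= j -> vl x j != vl y j -> i != j -> vl x i != vl y i ->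
  exists t v, [/\ t = x \/ t = y, v \in rest x y, forall k, k != j -> vl v k = vl t k,
    code v (j, false) != code z (j, false) & code t = flip (j, false) (code v)].
Proof.
move=> rj nj nij ni.
have bin w := vl_binary w rj.
have [t [tt tz]] : exists t, (t = x \/ t = y) /\ vl t j = vl z j.
  have := bin x; have := bin y; have := bin z => hz hy hx.
  have [e|n] := eqVneq (vl x j) (vl z j); first by exists x; auto.
  by exists y; split; [right|lia].
pose v := upd t j (1 - vl t j).
have vj k : vl v k = if k == j then 1 - vl t j else vl t k.
  by rewrite vl_upd // /cap; case: ifP; have := bin t; lia.
have vnt k : k != j -> vl v k = vl t k by rewrite vj => /negbTE ->.
have hv : vl v j = 1 - vl t j by rewrite vj eqxx.
exists t, v; split=> //.
- rewrite restP; apply/andP; split; apply/eqP => e; have := vnt i nij;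
  rewrite e in hv *; have := bin t; have := bin x; have := bin y; case: tt => tt;
  rewrite tt in hv *; lia.
- by rewrite !codeE hv -tz; have := bin t; case: (vl t j) => [|[]].
- apply: code_flip => [k /vnt //|]; rewrite hv.
  by have := bin t; case: (vl t j) => [|[|]] //= _; [right|left].
Qed.

Lemma corners_not_daisy x y j i :
  geodesic (fun u : bdel x y => code (val u)) ->
  r <= j -> vl x j != vl y j -> i != j -> vl x i != vl y i -> ~ daisy_cube (bdel x y).
Proof.
move=> gf rj nj nij ni; apply: (not_daisy gf) => z.
have [t [v [tt vA _ hv hf]]] := corners_missing (val z) rj nj nij ni.
exists (Sub v vA), (j, false); split=> //= w; rewrite -hf.
by apply/eqP => /code_inj; apply: rest_neq (valP w) tt.
Qed.

(** A Theta-class in direction [k] has both deleted vertices on one side. The restriction to that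
    side keeps the vertices of [corners_missing], so it still has no center. *)
Lemma corners_not_OD x y j i k :
  geodesic (fun u : bdel x y => code (val u)) -> corner x -> corner y ->
  r <= j -> vl x j != vl y j -> i != j -> vl x i != vl y i -> vl x k = vl y k ->
  ~ in_OD (bdel x y).
Proof.
move=> gf cx cy rj nj nij ni xyk.
have njk : k != j by apply: contraNneq nj => <-; apply/eqP.
suff [a [b [c [aA bA fb ca cj]]]] : exists a b c, [/\ a \in rest x y, b \in rest x y,
    code b = flip (k, c) (code a), code a (k, c) = code x (k, c) & true].
  have fb' : code (val (Sub b bA : bdel x y)) =
    flip (k, c) (code (val (Sub a aA : bdel x y))) by [].
  apply: (restriction_not_OD gf fb'); apply: (restriction_not_daisy gf fb') => z _.
  have [t [v [tt vA vt hv hf]]] := corners_missing (val z) rj nj nij ni.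
  exists (Sub v vA), (j, false); split=> //=.
    by rewrite ca !codeE vt //; case: tt => -> //; rewrite xyk.
  by move=> w; rewrite -hf; apply/eqP => /code_inj; apply: rest_neq (valP w) tt.
have out b : vl b k <> vl x k -> b \in rest x y.
  by move=> h; rewrite restP; apply/andP; split; apply: contra_not_neq h => ->.
have [kr|rk] := ltnP k r.
  have ck : cap r k = 2 by rewrite /cap kr.
  have xk : vl x k = 0 \/ vl x k = 2 by rewrite -ck; apply/cornerP.
  (* The edge is the half of the fibre through [x] that avoids [x]: from 1 to 2 if [x] has value 0,
     which is bit [true], and from 1 to 0 otherwise. *)
  pose a := upd x k 1; pose b := upd x k (2 - vl x k).
  have va l : vl a l = if l == k then 1 else vl x l by rewrite vl_upd ?ck.
  have vb l : vl b l = if l == k then 2 - vl x k else vl x l.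
    by rewrite vl_upd ?ck ?leq_subr.
  have ak := va k; have bk := vb k; rewrite !eqxx in ak bk.
  exists a, b, (vl x k == 0); split=> //; try (apply: out; lia).
    apply: code_flip => [l /negbTE nl|]; first by rewrite va vb nl.
    by rewrite ak bk; case: xk => -> /=; auto.
  by rewrite !codeE ak; case: xk => ->.
have [t [v [tt vA vt _ _]]] := corners_missing x rj nj nij ni.
have vk : vl v k = vl x k by rewrite vt //; case: tt => ->.
have bin w := vl_binary w rk.
pose b := upd v k (1 - vl v k).
have vb l : vl b l = if l == k then 1 - vl v k else vl v l.
  by rewrite vl_upd // /cap; case: ifP; have := bin v; lia.
have bk := vb k; rewrite eqxx in bk.
exists v, b, false; split=> //; last by rewrite !codeE vk.
  by apply: out; have := bin v; lia.
apply: code_flip => [l /negbTE nl|]; first by rewrite vb nl.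
by rewrite bk; have := bin v; case: (vl v k) => [|[|]]; auto.
Qed.

End DaisyDeletions.

(** * Deleting a boundary edge: missing flips *)

Section BoundaryEdge.
Variables r s : nat.
Implicit Types (x y u v w z : bvert r s) (k j : 'I_(r + s)).

Lemma corner_P3 x k : k < r -> corner x -> vl x k = 0 \/ vl x k = 2.
Proof. by move=> kr /cornerP/(_ k); rewrite /cap kr. Qed.

(** Two obstructions share the bit [(k, vl x k == 0)]. If [z] sits at the end of the fibre opposite
    to [x], flipping this bit of [v'] gives the non-code 01. Otherwise flipping it at the opposite
    end [o] of the deleted fibre gives the code of [y]. *)
Lemma edge_missing x y k z v' : corner_edge x y k -> v' != x -> vl v' k = vl x k ->
  exists v c, [/\ v \in rest x y,
    v = v' \/ (forall j, j != k -> vl v j = vl x j), code v c != code z c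
    & forall w, w \in rest x y -> code w != flip c (code v)].
Proof.
case=> kr cx yk xy v'x v'k; have xk := corner_P3 kr cx.
have ck : cap r k = 2 by rewrite /cap kr.
have [o vo] : exists o, forall j, vl o j = if j == k then 2 - vl x k else vl x j.
  by exists (upd x k (2 - vl x k)) => j; rewrite vl_upd // ck leq_subr.
have ok := vo k; rewrite eqxx in ok.
have on j : j != k -> vl o j = vl x j by rewrite vo => /negbTE ->.
have zk := vl_le2 z k.
have [ez|nz] := eqVneq (vl z k) (2 - vl x k).
  exists v', (k, vl x k == 0); split; first last.
  - move=> w _; apply/eqP => /ffunP e; have := code_bits (w := w) (k := k).
    rewrite !e ![flip _ _ _]ffunE !codeE !xpair_eqE eqxx v'k.
    by case: xk => -> /=; move/(_ isT).
  - by rewrite !codeE v'k ez; case: xk => ->.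
  - by left.
  - rewrite restP v'x; apply: contra_eq_neq v'k => ->; rewrite yk.
    by case: xk => ->.
exists o, (k, vl x k == 0); split; first last.
- move=> w wA; apply/eqP => e; apply: (rest_neq wA (or_intror erefl)).
  apply: code_inj; rewrite e; apply/esym/code_flip => [j nj|]; first by rewrite on ?xy.
  by rewrite ok yk; case: xk => -> /=; auto.
- rewrite !codeE ok; move: nz zk; case: xk => -> /=; case: (vl z k) => [|[|[|]]] //.
- by right.
- rewrite restP; apply/andP; split; apply/eqP => e; move: ok; rewrite e ?yk; case: xk; lia.
Qed.

Lemma nudge x k : corner x ->
  exists v, [/\ v != x, forall j, j != k -> vl v j = vl x j & k < r -> vl v k = 1].
Proof.
move=> /cornerP cx; pose t := if vl x k == 0 then 1 else (vl x k).-1.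
have tc : t <= cap r k.
  by have := vl_cap x k; have := cap_gt0 k; rewrite /t; case: eqP; lia.
exists (upd x k t); split.
- apply/eqP => /(congr1 (fun w => vl w k)); rewrite vl_upd // eqxx /t; case: eqP; lia.
- by move=> j /negbTE nj; rewrite vl_upd // nj.
- by move=> kr; rewrite vl_upd // eqxx /t; have := cx k; rewrite /cap kr; case: eqP; lia.
Qed.

Lemma boundary_not_daisy x y k k2 : corner_edge x y k -> k2 != k -> ~ daisy_cube (bdel x y).
Proof.
move=> ce nk; apply: (not_daisy (corner_edge_geodesic ce)) => z.
case: (ce) => kr cx _ _; have [v' [v'x v'j _]] := nudge k2 cx.
have [|v [c [vA _ hc hw]]] := edge_missing (val z) ce v'x; first by rewrite v'j // eq_sym.
by exists (Sub v vA), c; split=> // w; apply/hw/(valP w).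
Qed.

(** The restriction in direction [k2] must keep some [v'] as in [edge_missing]. If [k2] is a
    [P_3]-coordinate, [x] moved to 1 there stays on its side; if [k2] is binary, [v'] must leave [x]
    in a third coordinate. *)
Lemma boundary_not_OD x y k k2 : corner_edge x y k -> k2 != k -> 2 < r + s \/ k2 < r ->
  ~ in_OD (bdel x y).
Proof.
move=> ce nk h; have gf := corner_edge_geodesic ce.
case: (ce) => kr cx yk xy.
have xk := corner_P3 kr cx; have ck : cap r k = 2 by rewrite /cap kr.
have [o vo] : exists o, forall j, vl o j = if j == k then 2 - vl x k else vl x j.
  by exists (upd x k (2 - vl x k)) => j; rewrite vl_upd // ck leq_subr.
have out w : vl w k = 2 - vl x k -> w \in rest x y.
  by rewrite restP => wk; apply/andP; split; apply/eqP => e; move: wk; rewrite e ?yk; case: xk; lia.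
have [v' [v'x v'k [a [b [c [ak bk fb ca cv]]]]]] : exists v', [/\ v' != x, vl v' k = vl x k &
    exists a b c, [/\ vl a k = 2 - vl x k, vl b k = 2 - vl x k,
    code b = flip (k2, c) (code a), code a (k2, c) = code x (k2, c)
    & code v' (k2, c) = code x (k2, c)]].
  have [k2r|rk2] := ltnP k2 r.
    have [v' [v'x v'j v'1]] := nudge k2 cx; have xk2 := corner_P3 k2r cx.
    have ck2 : cap r k2 = 2 by rewrite /cap k2r.
    exists v'; split=> //; first by rewrite v'j // eq_sym.
    exists (upd o k2 1), (upd o k2 (2 - vl x k2)), (vl x k2 == 0); rewrite eq_sym in nk.
    rewrite !codeE (v'1 k2r) !vl_upd ?ck2 ?leq_subr // ?eqxx ?(negbTE nk) ?vo ?eqxx.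
    split=> //; try by case: xk2 => ->.
    apply: code_flip => [j /negbTE nj|]; rewrite !vl_upd ?ck2 ?leq_subr // ?nj // ?eqxx.
    by case: xk2 => -> /=; auto.
  have [k3 /andP[n3 n32]] : exists k3, (k3 != k) && (k3 != k2).
    have : 0 < #|~: [set k; k2]|.
      have := cardsC [set k; k2]; rewrite cards2 eq_sym nk card_ord.
      by case: h; lia.
    by case/card_gt0P => k3; rewrite !inE negb_or; exists k3.
  have [v' [v'x v'j _]] := nudge k3 cx; exists v'; split=> //; first by rewrite v'j // eq_sym.
  have tc : 1 - vl x k2 <= cap r k2 by apply: leq_trans (leq_subr _ _) (cap_gt0 _).
  exists o, (upd o k2 (1 - vl x k2)), false; rewrite eq_sym in nk.
  rewrite !codeE v'j 1?eq_sym // vl_upd // (negbTE nk) !vo eqxx [k2 == k]eq_sym (negbTE nk).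
  split=> //; apply: code_flip => [j /negbTE nj|]; rewrite vl_upd // ?nj // ?eqxx.
  rewrite vo [k2 == k]eq_sym (negbTE nk).
  by have := vl_binary x rk2; case: (vl x k2) => [|[|]]; auto.
have fb' : code (val (Sub b (out b bk) : bdel x y)) =
    flip (k2, c) (code (val (Sub a (out a ak) : bdel x y))) by [].
apply: (restriction_not_OD gf fb'); apply: (restriction_not_daisy gf fb') => z _.
have [v [d [vA hv hd hw]]] := edge_missing (val z) ce v'x v'k.
exists (Sub v vA), d; split=> //= [|w]; last exact/hw/(valP w).
by rewrite ca; case: hv => [->//|vx]; rewrite !codeE vx.
Qed.

End BoundaryEdge.

(** * Opposite corners: all one-step minors are daisy cubes *)

Section Opposite.
Variables r s : nat.
Implicit Types (x y u v w z : bvert r s) (k j : 'I_(r + s)).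

Lemma not_opposite x y : corner x -> corner y -> (pnum x y, qnum x y) <> (r, s) ->
  exists k, vl x k = vl y k.
Proof.
move=> /cornerP cx /cornerP cy npq.
have [k /eqP e|no] := pickP (fun k => vl x k == vl y k); first by exists k.
case: npq; congr pair; rewrite -[RHS]card_ord.
  apply: eq_card => i; rewrite inE -!vl_lshift.
  have := cx (lshift s i); have := cy (lshift s i); have := no (lshift s i).
  by rewrite cap_lshift => n [] e1 [] e2; rewrite e1 e2 in n *.
apply: eq_card => i; rewrite inE; have := no (rshift r i).
by rewrite !vl_rshift; case: (x.2 i); case: (y.2 i).
Qed.

Lemma opposite_neq x y k : opposite_corners x y -> vl x k <> vl y k.
Proof.
case=> cx cy px qx; move: k; apply: coordP => i.
  have : i \in [set i | ((x.1 i == 0 :> nat) && (y.1 i == 2 :> nat))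
          || ((x.1 i == 2 :> nat) && (y.1 i == 0 :> nat))].
    rewrite [[set _ | _]](_ : _ = [set: 'I_r]) ?inE //.
    by apply/eqP; rewrite eqEcard subsetT cardsT card_ord -[X in X <= _]px leqnn.
  by rewrite inE !vl_lshift => /orP[] /andP[/eqP -> /eqP ->].
have : i \in [set i | x.2 i != y.2 i].
  rewrite [[set _ | _]](_ : _ = [set: 'I_s]) ?inE //.
  by apply/eqP; rewrite eqEcard subsetT cardsT card_ord -[X in X <= _]qx leqnn.
by rewrite inE !vl_rshift; case: (x.2 i); case: (y.2 i).
Qed.

Variables (x y : bvert r s).
Hypotheses (cx : corner x) (cy : corner y) (nxy : forall k, vl x k <> vl y k).
Hypotheses (rs2 : 2 <= r + s) (npq : (pnum x y, qnum x y) <> (0, 2)).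

Lemma code_opposite k c : k < r \/ c = false -> code x (k, c) != code y (k, c).
Proof.
have := cornerP _ cx k; have := cornerP _ cy k; have := @nxy k.
rewrite !codeE /cap; case: (ltnP k r) => [_ n h1 h2 _|_ n h1 h2 [//|->]].
  by case: h1 h2 n => -> [] -> //; case: c.
by case: h1 h2 n => -> [] ->.
Qed.

Lemma opposite_pick k c (d : bool) : k < r \/ c = false ->
  exists w w', [/\ (w = x /\ w' = y) \/ (w = y /\ w' = x), corner w,
    code w (k, c) = d & code w' (k, c) != d].
Proof.
move=> /code_opposite n; case: (eqVneq (code x (k, c)) d) => [e|nd].
  by exists x, y; split; auto; rewrite -e eq_sym.
by exists y, x; split; auto; case: (code x _) (code y _) d n nd => [] [] [].
Qed.

(** Only [w] is missing on this side, so [anti w] serves as center. If it falls on the wrong side,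
    it is moved to [vl w k]; this is harmless since every vertex of the side then has that value at
    [k]. The condition [act] excludes the constant bits of binary coordinates. *)
Lemma opposite_restriction k c w w' (V : bvert r s) (u : {ffun 'I_(r + s) * bool -> bool}) :
  k < r \/ c = false ->
  (w = x /\ w' = y) \/ (w = y /\ w' = x) -> corner w -> code w' (k, c) != code w (k, c) ->
  V \in rest x y -> code V (k, c) = code w (k, c) ->
  let z := if code (anti w) (k, c) == code w (k, c) then anti w else upd (anti w) k (vl w k) in
  (forall d, u d != code z d -> u d = code V d) ->
  exists2 W, W \in rest x y & code W = u.
Proof.
move=> act ww' cw nw' VA Vk z hu.
have antik : vl (anti w) k = if k < r then 1 else 1 - vl w k := vl_anti w k.
have wk := cornerP _ cw k; rewrite /cap in wk.
have differ : code (anti w) (k, c) != code w (k, c) -> vl V k = vl w k.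
  move: Vk; rewrite !codeE antik; have := vl_cap V k; rewrite /cap.
  move: wk act {antik z hu nw'}; case: (k < r).
    by case=> -> _; case: c; case: (vl V k) => [|[|[|]]].
  by case=> -> [//|->]; case: (vl V k) => [|[|[|]]].
have zE j : vl z j = vl (anti w) j \/ [/\ j = k, vl z j = vl w j & vl V j = vl w j].
  rewrite /z; case: eqVneq => [_|/differ e]; first by left.
  rewrite vl_upd ?vl_cap //; case: (eqVneq j k) => [->|_]; [by right|by left].
have zk : code z (k, c) = code w (k, c).
  by rewrite /z; case: eqVneq => // _; rewrite !codeE vl_upd ?vl_cap // eqxx.
have [|W Wu hW] := @between_code _ _ z V u _ hu.
  by move=> j jr; case: (zE j) => [->|[_ -> ->]]; [left; rewrite vl_anti jr|right].
exists W => //; have Wk : code W (k, c) = code w (k, c).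
  rewrite Wu; case: (eqVneq (u (k, c)) (code z (k, c))) => [->//|/hu ->]; exact: Vk.
have Ww : W <> w.
  move=> e; have := VA; suff -> : V = w by rewrite restP; case: ww' => [] [-> _]; rewrite eqxx ?andbF.
  apply: vl_inj => j; case: (zE j) => [zj|[//]]; case: (hW j); rewrite e ?zj // => e'.
  by case: (anti_neq (k := j) cw).
have Ww' : W <> w' by move=> e; move: nw'; rewrite -e Wk eqxx.
by rewrite restP; apply/andP; split; apply/eqP; case: ww' => [] [e1 e2]; rewrite -?e1 -?e2.
Qed.

Lemma step_bits (b c : bool) n : n <= 2 -> (c < n) != (c < 1) ->
  (b < 1) = if b == c then c < 1 else b < n.
Proof. by case: b; case: c; case: n => [|[|[|]]]. Qed.

(** For a [P_3]-coordinate [w'] is an end of a contracted edge and is absorbed by its neighbour,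
    while [w] is not, so one corner stays missing and [anti w] is a center. For a binary coordinate
    both deleted corners are absorbed. *)
Lemma opposite_contraction k c w w' (V : bvert r s) (u : {ffun 'I_(r + s) * bool -> bool}) :
  k < r \/ c = false ->
  (w = x /\ w' = y) \/ (w = y /\ w' = x) -> corner w ->
  (k < r -> code w (k, c) = code (anti w) (k, c)) ->
  (k < r -> code w' (k, c) != code (anti w) (k, c)) ->
  V \in rest x y ->
  (forall d, u d != code (anti w) d -> u d = setc (k, c) (code (anti w) (k, c)) (code V) d) ->
  exists2 W, W \in rest x y & setc (k, c) (code (anti w) (k, c)) (code W) = u.
Proof.
set cc := code (anti w) (k, c) => act ww' cw hw hw' VA hu.
have antik : vl (anti w) k = if k < r then 1 else 1 - vl w k := vl_anti w k.
have wk := cornerP _ cw k; rewrite /cap in wk.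
have setcK (X : bvert r s) : code X (k, c) = cc -> setc (k, c) cc (code X) = code X.
  by move=> e; apply/ffunP => d; rewrite ffunE; case: eqP => // ->.
pose V2 := if code V (k, c) == cc then V else upd V k (vl (anti w) k).
have V2c : code V2 = setc (k, c) cc (code V).
  rewrite /V2; case: eqVneq => [/setcK//|n]; apply/ffunP => -[j b].
  rewrite [RHS]ffunE !codeE xpair_eqE vl_upd ?vl_cap //; case: (eqVneq j k) => //= ->.
  move: n; rewrite /cc !codeE; case: (ltnP k r) => [kr|rk].
    by rewrite antik kr => n; apply: step_bits; rewrite ?vl_le2.
  have c0 : c = false by case: act => //; rewrite ltnNge rk.
  by rewrite c0; have := vl_binary (anti w) rk; have := vl_binary V rk; case: b;
    case: (vl V k) => [|[|]] //; case: (vl (anti w) k) => [|[|]].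
rewrite -V2c in hu.
have [|W Wu hW] := @between_code _ _ (anti w) V2 u _ hu.
  by move=> j jr; left; rewrite vl_anti jr.
have uk : u (k, c) = cc.
  by case: (eqVneq (u (k, c)) cc) => // /hu; rewrite V2c ffunE eqxx.
case: (boolP (W \in rest x y)) => [WA|/rest_or Wxy].
  by exists W => //; rewrite setcK ?Wu.
have [kr|rk] := ltnP k r.
  have WW : W = w.
    have nW : W <> w' by move=> e; move: (hw' kr); rewrite -e Wu uk eqxx.
    by case: ww' => [] [e1 e2]; case: Wxy => e; rewrite e ?e1 //; case: nW; rewrite e e2.
  have V2w : V2 = w.
    apply: vl_inj => j; case: (hW j); rewrite WW // => e.
    by case: (anti_neq (k := j) cw).
  move: V2w; rewrite /V2; case: ifP => [_ Vw|_ /(congr1 (fun X => vl X k))].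
    by move: VA; rewrite Vw restP; case: ww' => [] [-> _]; rewrite eqxx ?andbF.
  by rewrite vl_upd ?vl_cap // eqxx => /(anti_neq cw).
have c0 : c = false by case: act => //; rewrite ltnNge rk.
have bin := vl_binary _ rk.
have tc : 1 - vl W k <= cap r k by apply: leq_trans (leq_subr _ _) (cap_gt0 _).
(* The deleted [W] is replaced by its neighbour across the contracted edge. This survives because
   [x] and [y] also differ in some coordinate other than [k], which is where [rs2] enters. *)
exists (upd W k (1 - vl W k)).
  have [j nj] : exists j, j != k.
    have : 0 < #|[set~ k]|.
      by rewrite cardsC1 card_ord; move: rs2; case: (r + s) => [|[]].
    by case/card_gt0P => j; rewrite !inE; exists j.
  have ne := @nxy j; have flip1 w0 : 1 - vl w0 k <> vl w0 k by case: (vl w0 k).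
  rewrite restP; apply/andP; split; apply/eqP => e.
    have := congr1 (fun X => vl X k) e; have := congr1 (fun X => vl X j) e.
    by rewrite !vl_upd // eqxx (negbTE nj); case: Wxy => ->; [move=> _ /flip1|move=> /esym].
  have := congr1 (fun X => vl X k) e; have := congr1 (fun X => vl X j) e.
  by rewrite !vl_upd // eqxx (negbTE nj); case: Wxy => ->; [|move=> _ /flip1].
rewrite (@code_flip _ _ W _ k c) ?setc_flip ?setcK ?Wu // => [j /negbTE nj|].
  by rewrite vl_upd // nj.
by rewrite vl_upd // eqxx c0; have := bin W; case: (vl W k) => [|[|]]; auto.
Qed.

Lemma opposite_minors (K : sgraph) (a b : K) : isomorphic K (bdel x y) -> adj a b ->
  daisy_cube (restriction a b) /\ daisy_cube (contraction a b).
Proof.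
case=> g gi ab; pose f := fun u : bdel x y => code (val u).
have gf : geodesic f by apply: corners_geodesic.
have gh := geodesic_iso gi gf; pose h := f \o g.
have onto W : W \in rest x y -> exists t, h t = code W.
  by move=> WA; case: gi => [[g' _ gK] _]; exists (g' (Sub W WA)); rewrite /h /f /= gK.
have [[k c] fb] := adj_flip gh ab.
have act : k < r \/ c = false.
  have := congr1 (fun X : {ffun _ -> _} => X (k, c)) fb; rewrite flipi /= /f !codeE.
  case: (ltnP k r) => [|rk]; auto; case: c {fb}; auto.
  have bin := vl_binary _ rk; have := bin (val (g a)); have := bin (val (g b)).
  by case: (vl _ k) => [|[|]] //; case: (vl _ k) => [|[|]].
split.
  have [w [w' [ww' cw wk w'k]]] := opposite_pick (h a (k, c)) act.
  apply: (restriction_daisy gh fb (z := code (if code (anti w) (k, c) == code w (k, c)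
    then anti w else upd (anti w) k (vl w k)))).
    by case: eqVneq => [->//|_]; rewrite -[RHS]wk !codeE vl_upd ?vl_cap // eqxx.
  move=> v u vk hu.
  have [||W WA <-] := opposite_restriction act ww' cw _ (valP (g v)) _ hu.
  - by rewrite wk.
  - by rewrite wk.
  - exact: onto.
(* In a [P_3]-coordinate [anti w] has value 1, whose bit at threshold [c] is [~~ c]; the corner
   sharing that bit is taken as [w]. For a binary coordinate either corner would do. *)
pose d := if k < r then ~~ c else code x (k, c).
have [w [w' [ww' cw wk w'k]]] := opposite_pick d act.
have ad : k < r -> code (anti w) (k, c) = d.
  by rewrite /d codeE vl_anti => ->; case: c {d wk w'k fb act}.
apply: (contraction_daisy gh fb (c := code (anti w) (k, c)) (z := code (anti w))) => v u hu.
have [||W WA <-] := opposite_contraction act ww' cw _ _ (valP (g v)) hu.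
- by move/ad ->.
- by move/ad ->.
- by have [t ht] := onto W WA; exists t; rewrite -ht.
Qed.

End Opposite.

(** * Obstructions to being a partial cube *)

Section Parallel.
Variables (G : sgraph) (I : finType) (f : G -> {ffun I -> bool}).
Hypothesis gf : geodesic f.
Implicit Types a b c d u v w : G.

Definition parallel a b c d := forall i, f a i (+) f b i = f c i (+) f d i.

Lemma adj_dir a b : adj a b -> exists k, forall i, f b i = f a i (+) (i == k).
Proof. by case/(adj_flip gf) => k ->; exists k => i; rewrite ffunE. Qed.

Lemma square_parallel a b c d : adj a b -> adj b c -> adj c d -> adj d a ->
  a != c -> b != d -> parallel a b d c.
Proof.
move=> /adj_dir[i hi] /adj_dir[j hj] /adj_dir[k hk] /adj_dir[l hl] nac nbd.
have fi := geodesic_inj gf.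
have nij : i != j.
  apply: contraNneq nac => e; apply/eqP/fi/ffunP => t.
  by rewrite hj hi e -addbA addbb addbF.
have njk : j != k.
  apply: contraNneq nbd => e; apply/eqP/fi/ffunP => t.
  by rewrite hk hj e -addbA addbb addbF.
have sum t : (t == i) (+) (t == j) (+) (t == k) (+) (t == l) = false.
  by have := hl t; rewrite hk hj hi; case: (f a t); case: (t == i); case: (t == j);
     case: (t == k); case: (t == l).
have jl : j = l.
  have := sum j; rewrite eqxx eq_sym (negbTE nij) (negbTE njk) /=.
  by case: eqP.
have ik : i = k.
  have := sum i; rewrite eqxx (negbTE nij) -jl (negbTE nij) /=.
  by case: eqP.
move=> t; rewrite hk hj hi ik.
by case: (f a t); case: (t == j); case: (t == k).
Qed.

Lemma common_neighbor u v : ham (f u) (f v) <= 2 ->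
  [\/ u = v, adj u v | exists2 w, adj u w & adj w v].
Proof.
case: gf => fa fs; case: (eqVneq u v) => [->|nuv]; first by constructor 1.
have [w [i [hi fw]]] := fs u v nuv; rewrite (ham_flip_lt hi) -fw ltnS => h.
have uw : adj u w by rewrite fa fw ham_flip.
have [e|n] := eqVneq w v; first by rewrite e in uw; constructor 2.
constructor 3; exists w; rewrite // fa eqn_leq h lt0n ham_eq0.
by apply: contra n => /eqP/(geodesic_inj gf) ->.
Qed.

Lemma parallel_ham a b c d : parallel a b c d -> ham (f a) (f c) = ham (f b) (f d).
Proof.
move=> h; apply: eq_card => i; rewrite !inE; have := h i.
by case: (f a i); case: (f b i); case: (f c i); case: (f d i).
Qed.

Lemma path3_ham a b c : adj a b -> adj b c -> ham (f a) (f c) <= 2.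
Proof.
case: gf => fa _; rewrite !fa => /eqP h1 /eqP h2.
by apply: leq_trans (ham_triangle _ (f b) _) _; rewrite h1 h2.
Qed.

(** Two equal directions would cancel, leaving a single flip between [a] and [d]. *)
Lemma triple_dirs a b c d i j k : ~~ adj a d ->
  (forall t, f b t = f a t (+) (t == i)) -> (forall t, f c t = f b t (+) (t == j)) ->
  (forall t, f d t = f c t (+) (t == k)) -> [&& i != j, j != k & i != k].
Proof.
case: gf => -> _ nad hi hj hk.
have hd l : (forall t, (t == i) (+) (t == j) (+) (t == k) = (t == l)) -> False.
  move=> e; case/negP: nad; have -> : f d = flip l (f a); last by rewrite ham_flip.
  by apply/ffunP => t; rewrite ffunE hk hj hi -e !addbA.
apply/and3P; split; apply/eqP => e.
- by apply: (hd k) => t; rewrite e addbb.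
- by apply: (hd i) => t; rewrite e -addbA addbb addbF.
- by apply: (hd j) => t; rewrite e addbC addbA addbb.
Qed.

(** Each of the paths [a b c d] and [e g a b] uses three distinct directions, as its ends are not
    adjacent. Around a closed walk every direction occurs an even number of times, so that of [ab]
    must return on [de]. *)
Lemma hexagon_parallel a b c d e g :
  adj a b -> adj b c -> adj c d -> adj d e -> adj e g -> adj g a ->
  ~~ adj a d -> ~~ adj b e -> ~~ adj c g -> parallel a b e d.
Proof.
move=> /adj_dir[i1 h1] /adj_dir[i2 h2] /adj_dir[i3 h3] /adj_dir[i4 h4]
  /adj_dir[i5 h5] /adj_dir[i6 h6] nad nbe ncg.
have /and3P[n12 n23 n13] := triple_dirs nad h1 h2 h3.
rewrite adj_sym in nbe; have /and3P[n56 n61 n51] := triple_dirs nbe h5 h6 h1.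
have e14 : i1 = i4.
  have := h6 i1; rewrite h5 h4 h3 h2 h1 eqxx (negbTE n12) (negbTE n13).
  rewrite [i1 == i5]eq_sym (negbTE n51) [i1 == i6]eq_sym (negbTE n61).
  by case: (f a i1); case: (eqVneq i1 i4).
move=> t; rewrite h4 h1 e14.
by case: (f a t); case: (f d t); case: (t == i4).
Qed.

(** Distance at least 3, phrased through adjacency so that it can be tested on lists. *)
Definition far a e := [/\ a != e, ~~ adj a e & forall w, adj a w -> ~~ adj w e].

Lemma far_dirs a b c d e i j k l : far a e ->
  (forall t, f b t = f a t (+) (t == i)) -> (forall t, f c t = f b t (+) (t == j)) ->
  (forall t, f d t = f c t (+) (t == k)) -> (forall t, f e t = f d t (+) (t == l)) ->
  [&& i != j, i != k, i != l, j != l & k != l].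
Proof.
move=> [nae ne nc] hi hj hk hl.
have hd m n : (forall t, (t == i) (+) (t == j) (+) (t == k) (+) (t == l) =
    (t == m) (+) (t == n)) -> False.
  move=> h; have : ham (f a) (f e) <= 2.
    have -> : f e = flip n (flip m (f a)).
      apply/ffunP => t; rewrite !ffunE hl hk hj hi; have := h t.
      by case: (f a t); case: (t == i); case: (t == j); case: (t == k); case: (t == l);
         case: (t == m); case: (t == n).
    by apply: leq_trans (ham_triangle _ (flip m (f a)) _) _; rewrite !ham_flip.
  case/common_neighbor => [ae|ae|[w aw we]].
  - by rewrite ae eqxx in nae.
  - by rewrite ae in ne.
  - by have := nc w aw; rewrite we.
apply/and5P; split; apply/eqP => e0.
- by apply: (hd k l) => t; rewrite e0 addbb.
- by apply: (hd j l) => t; rewrite e0; case: (t == k); case: (t == j).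
- by apply: (hd j k) => t; rewrite e0; case: (t == l); case: (t == j); case: (t == k).
- by apply: (hd i k) => t; rewrite e0; case: (t == l); case: (t == i); case: (t == k).
- by apply: (hd i j) => t; rewrite e0 -addbA addbb addbF.
Qed.

(** The parity argument of the hexagon, now for the paths [a b c d e] and [g h k a b]: in each of
    them a repeated direction would bring the ends within distance 2. *)
Lemma octagon_parallel a b c d e g h k :
  adj a b -> adj b c -> adj c d -> adj d e -> adj e g -> adj g h -> adj h k -> adj k a ->
  far a e -> far g b -> parallel a b e g.
Proof.
move=> /adj_dir[i1 h1] /adj_dir[i2 h2] /adj_dir[i3 h3] /adj_dir[i4 h4]
  /adj_dir[i5 h5] /adj_dir[i6 h6] /adj_dir[i7 h7] /adj_dir[i8 h8] ae gb.
have /and5P[n12 n13 n14 _ _] := far_dirs ae h1 h2 h3 h4.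
have /and5P[_ _ n61 n71 n81] := far_dirs gb h6 h7 h8 h1.
have e15 : i1 = i5.
  have := h8 i1; rewrite h7 h6 h5 h4 h3 h2 h1 eqxx (negbTE n12) (negbTE n13) (negbTE n14).
  rewrite [i1 == i6]eq_sym (negbTE n61) [i1 == i7]eq_sym (negbTE n71).
  rewrite [i1 == i8]eq_sym (negbTE n81).
  by case: (f a i1); case: (eqVneq i1 i5).
move=> t; rewrite h5 h1 e15.
by case: (f a t); case: (f e t); case: (t == i5).
Qed.

End Parallel.

(** * A box around a path whose middle vertex is deleted *)

Section Box.
Variables (r s : nat) (x y o t : bvert r s) (ko kt k1 k2 : 'I_(r + s)) (t1 t2 : nat).
Hypotheses (so : step_at x o ko) (st : step_at x t kt).
Hypotheses (n12 : k1 != k2) (no1 : k1 != ko) (no2 : k2 != ko) (nt1 : k1 != kt) (nt2 : k2 != kt).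
Hypotheses (c1 : t1 <= cap r k1) (c2 : t2 <= cap r k2).
Hypotheses (s1 : vl x k1 = t1.+1 \/ t1 = (vl x k1).+1).
Hypotheses (s2 : vl x k2 = t2.+1 \/ t2 = (vl x k2).+1).

(* The point over w in the product of the path o - x - t with the square spanned
   by the steps x_k1 -> t1 and x_k2 -> t2. *)
Definition pt (w : bvert r s) (b c : bool) : bvert r s :=
  mk (fun j => if j == k1 then (if b then t1 else vl x k1)
     else if j == k2 then (if c then t2 else vl x k2) else vl w j).

Lemma vl_pt w b c j : vl (pt w b c) j =
  if j == k1 then (if b then t1 else vl x k1)
  else if j == k2 then (if c then t2 else vl x k2) else vl w j.
Proof.
rewrite vl_mk // => i; case: eqP => [->|_]; first by case: b; rewrite ?vl_cap.
by case: eqP => [->|_]; [case: c; rewrite ?vl_cap|exact: vl_cap].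
Qed.

Lemma adj_pt1 w b c : @adj (bgraph r s) (pt w b c) (pt w (~~ b) c).
Proof.
apply/adjP; exists k1; split=> [j /negbTE nj|]; first by rewrite !vl_pt nj.
by rewrite !vl_pt eqxx; case: b => /=; lia.
Qed.

Lemma adj_pt2 w b c : @adj (bgraph r s) (pt w b c) (pt w b (~~ c)).
Proof.
apply/adjP; exists k2; split=> [j /negbTE nj|]; first by rewrite !vl_pt nj.
by rewrite !vl_pt eqxx eq_sym (negbTE n12); case: c => /=; lia.
Qed.

Lemma adj_pt w w' k b c : step_at w w' k -> k1 != k -> k2 != k ->
  @adj (bgraph r s) (pt w b c) (pt w' b c).
Proof.
move=> [he hk] n1 n2; apply/adjP; exists k; split=> [j nj|].
  by rewrite !vl_pt he.
by rewrite !vl_pt ![k == _]eq_sym (negbTE n1) (negbTE n2).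
Qed.

Lemma adj_pt_o b c : @adj (bgraph r s) (pt o b c) (pt x b c).
Proof. by rewrite adj_sym; apply: adj_pt so _ _. Qed.

Lemma adj_pt_t b c : @adj (bgraph r s) (pt x b c) (pt t b c).
Proof. exact: adj_pt st _ _. Qed.

Lemma pt_neq1 w w' c c' : pt w false c != pt w' true c'.
Proof.
apply/eqP => /(congr1 (fun X => vl X k1)); rewrite !vl_pt eqxx; lia.
Qed.

Lemma pt_neq2 w w' b b' : pt w b false != pt w' b' true.
Proof.
apply/eqP => /(congr1 (fun X => vl X k2)); rewrite !vl_pt eqxx eq_sym (negbTE n12); lia.
Qed.

Lemma pt_neq_o b c b' c' : pt o b c != pt x b' c'.
Proof.
apply/eqP => /(congr1 (fun X => vl X ko)).
by rewrite !vl_pt ![ko == _]eq_sym (negbTE no1) (negbTE no2); case: so => _; lia.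
Qed.

Lemma pt_neq_t b c b' c' : pt t b c != pt x b' c'.
Proof.
apply/eqP => /(congr1 (fun X => vl X kt)).
by rewrite !vl_pt ![kt == _]eq_sym (negbTE nt1) (negbTE nt2); case: st => _; lia.
Qed.

Lemma pt_x : pt x false false = x.
Proof. by apply: vl_inj => j; rewrite vl_pt; case: eqP => [->//|_]; case: eqP => [->|]. Qed.

Hypotheses (not : o != t) (not_adj_ot : ~~ @adj (bgraph r s) o t).
Hypothesis sep : forall w, w \in rest x y -> @adj (bgraph r s) o w -> ~~ @adj (bgraph r s) w t.

Let mem w b c : (w = o \/ w = t \/ (w = x /\ b || c)) -> pt w b c != y -> pt w b c \in rest x y.
Proof.
move=> h ny; rewrite restP ny andbT -[in X in _ != X]pt_x.
case: h => [->|[->|[->]]]; [exact: pt_neq_o|exact: pt_neq_t|].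
by rewrite eq_sym; case: b {ny} => [_|/= ->]; [exact: pt_neq1|exact: pt_neq2].
Qed.

Lemma pt_o : pt o false false = o.
Proof.
case: so => h _; apply: vl_inj => j; rewrite vl_pt.
by case: eqP => [->|_]; [rewrite h|case: eqP => [->|//]; rewrite h].
Qed.

Lemma pt_t : pt t false false = t.
Proof.
case: st => h _; apply: vl_inj => j; rewrite vl_pt.
by case: eqP => [->|_]; [rewrite h|case: eqP => [->|//]; rewrite h].
Qed.

Lemma not_adj2 (u v : bvert r s) i j : i != j -> vl u i != vl v i -> vl u j != vl v j ->
  ~~ @adj (bgraph r s) u v.
Proof.
move=> nij ni nj; apply/negP => /adjP[k [h _]].
case: (eqVneq i k) => [e|/h e]; last by rewrite e eqxx in ni.
by rewrite e eq_sym in nij; move: nj; rewrite h ?eqxx.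
Qed.

Lemma pt_not_adj w w' b c : ~~ @adj (bgraph r s) (pt w b c) (pt w' (~~ b) (~~ c)).
Proof.
apply: (not_adj2 n12); first by rewrite !vl_pt eqxx; case: b => /=; lia.
by rewrite !vl_pt eqxx [k2 == k1]eq_sym (negbTE n12); case: c => /=; lia.
Qed.

Lemma pt_neq_ot b c b' c' : pt t b c != pt o b' c'.
Proof.
have [j nj] := vl_neq not; case: so st => [ho _] [ht _].
have nj1 : j != k1 by apply: contraNneq nj => ->; rewrite -ho // -ht.
have nj2 : j != k2 by apply: contraNneq nj => ->; rewrite -ho // -ht.
apply: contraNneq nj => /(congr1 (fun X => vl X j)).
by rewrite !vl_pt (negbTE nj1) (negbTE nj2) => ->.
Qed.

Section Embedding.
Variables (n : nat) (f : bdel x y -> {ffun 'I_n -> bool}).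
Hypothesis gf : geodesic f.

(* A parallel class running from o to t forces d(o, t) = 2. *)
Lemma parallel_absurd (u v u' m v' : bdel x y) : val u = o -> val v = t ->
  adj u' m -> adj m v' -> parallel f u u' v v' -> False.
Proof.
move=> uo vt um mv /parallel_ham e; have := path3_ham gf um mv; rewrite -e.
case/(common_neighbor gf) => [uv|uv|[w uw wv]].
- by move: not; rewrite -uo -vt uv eqxx.
- by move: not_adj_ot; rewrite -uo -vt; case/negP.
- by have := sep (valP w); rewrite -uo -vt => /(_ uw)/negP; apply.
Qed.

End Embedding.

Let sub w b c (h : pt w b c \in rest x y) : bdel x y := Sub (pt w b c) h.

(** The edge at [o] in direction [k2] is carried round the hole at [x]: along [k1], across the path
    from [o] over [x] to [t], and back along [k1]. One unit away in direction [k2] the path is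
    intact, so [parallel_absurd] applies. *)
Lemma box_obstruction :
  (forall w b c, w = o \/ w = x \/ w = t -> pt w b c != y) -> ~ partial_cube (bdel x y).
Proof.
move=> ny /partial_cube_geodesic[n [f gf]].
have mo b c : pt o b c \in rest x y by apply: mem; [left|apply: ny; left].
have mt b c : pt t b c \in rest x y by apply: mem; [right; left|apply: ny; right; right].
have mx b c : b || c -> pt x b c \in rest x y.
  by move=> bc; apply: mem; [right; right|apply: ny; right; left].
have sq1 : parallel f (sub (mo false false)) (sub (mo false true))
    (sub (mo true false)) (sub (mo true true)).
  apply: (square_parallel gf);
    [exact: adj_pt2|exact: adj_pt1|exact: adj_pt2|exact: adj_pt1|..];
    exact: pt_neq1.
have sq2 : parallel f (sub (mo true false)) (sub (mo true true))
    (sub (@mx true false isT)) (sub (@mx true true isT)).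
  apply: (square_parallel gf);
    [exact: adj_pt2|exact: adj_pt_o| |by rewrite adj_sym; exact: adj_pt_o|..].
  - exact: adj_pt2.
  - exact: pt_neq_o.
  - exact: pt_neq_o.
have sq3 : parallel f (sub (@mx true false isT)) (sub (@mx true true isT))
    (sub (mt true false)) (sub (mt true true)).
  apply: (square_parallel gf);
    [exact: adj_pt2|exact: adj_pt_t|exact: adj_pt2|by rewrite adj_sym; exact: adj_pt_t|..].
  - by rewrite -val_eqE /= eq_sym; exact: pt_neq_t.
  - by rewrite -val_eqE /= eq_sym; exact: pt_neq_t.
have sq4 : parallel f (sub (mt true false)) (sub (mt true true))
    (sub (mt false false)) (sub (mt false true)).
  apply: (square_parallel gf);
    [exact: adj_pt2|exact: adj_pt1|exact: adj_pt2|exact: adj_pt1|..];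
    by rewrite eq_sym; exact: pt_neq1.
apply: (@parallel_absurd n f gf (sub (mo false false)) (sub (mt false false))
  (sub (mo false true)) (sub (@mx false true isT)) (sub (mt false true))).
- exact: pt_o.
- exact: pt_t.
- exact: adj_pt_o.
- exact: adj_pt_t.
- by move=> i; rewrite sq1 sq2 sq3 sq4.
Qed.

(** The cube over [o] and [x] has lost the antipodal vertices [x] and [y]. Its other six vertices
    form a hexagon, which does the work of the first two squares. *)
Lemma hexagon_obstruction : y = pt o true true -> ~ partial_cube (bdel x y).
Proof.
move=> yE /partial_cube_geodesic[n [f gf]].
have mo b c : ~~ (b && c) -> pt o b c \in rest x y.
  move=> bc; apply: mem; first by left.
  rewrite yE; case: b bc => [|_]; last exact: pt_neq1.
  by case: c => [//|_]; exact: pt_neq2.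
have mt b c : pt t b c \in rest x y.
  by apply: mem; [right; left|rewrite yE pt_neq_ot].
have mx b c : b || c -> pt x b c \in rest x y.
  move=> bc; apply: mem; first by right; right.
  by rewrite yE eq_sym pt_neq_o.
have hex : parallel f (sub (@mo false false isT)) (sub (@mo false true isT))
    (sub (@mx true false isT)) (sub (@mx true true isT)).
  apply: (hexagon_parallel (c := sub (@mx false true isT)) (g := sub (@mo true false isT)) gf).
  - exact: adj_pt2.
  - exact: adj_pt_o.
  - exact: adj_pt1.
  - exact: adj_pt2.
  - by rewrite adj_sym; exact: adj_pt_o.
  - exact: adj_pt1.
  - exact: pt_not_adj.
  - exact: pt_not_adj.
  - exact: pt_not_adj.
have sq3 : parallel f (sub (@mx true false isT)) (sub (@mx true true isT))
    (sub (mt true false)) (sub (mt true true)).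
  apply: (square_parallel gf);
    [exact: adj_pt2|exact: adj_pt_t|exact: adj_pt2|by rewrite adj_sym; exact: adj_pt_t|..].
  - by rewrite -val_eqE /= eq_sym; exact: pt_neq_t.
  - by rewrite -val_eqE /= eq_sym; exact: pt_neq_t.
have sq4 : parallel f (sub (mt true false)) (sub (mt true true))
    (sub (mt false false)) (sub (mt false true)).
  apply: (square_parallel gf);
    [exact: adj_pt2|exact: adj_pt1|exact: adj_pt2|exact: adj_pt1|..];
    by rewrite eq_sym; exact: pt_neq1.
apply: (@parallel_absurd n f gf (sub (@mo false false isT)) (sub (mt false false))
  (sub (@mo false true isT)) (sub (@mx false true isT)) (sub (mt false true))).
- exact: pt_o.
- exact: pt_t.
- exact: adj_pt_o.
- exact: adj_pt_t.
- by move=> i; rewrite hex sq3 sq4.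
Qed.

End Box.

(** * Deletions from products with at least four coordinates *)

Section Obstructions.
Variables r s : nat.
Implicit Types (x y u v w z : bvert r s) (k j : 'I_(r + s)).

Definition step_to x k t := t <= cap r k /\ (vl x k = t.+1 \/ t = (vl x k).+1).

Lemma step_to_neq x k t : step_to x k t -> t <> vl x k.
Proof. by case=> _; lia. Qed.

Lemma bit_eq (a b c : nat) : a <= 1 -> b <= 1 -> c <= 1 -> a <> b -> c <> b -> a = c.
Proof. by lia. Qed.

Lemma step_neq (a b : nat) : a = b.+1 \/ b = a.+1 -> b <> a.
Proof. by lia. Qed.

Lemma step_to_ex x k : exists t, step_to x k t.
Proof.
exists (if vl x k == 0 then 1 else (vl x k).-1); rewrite /step_to.
by have := vl_cap x k; have := cap_gt0 k; case: eqP; lia.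
Qed.

Lemma step_at_upd x k t : step_to x k t -> step_at x (upd x k t) k.
Proof.
by case=> tc h; split=> [j /negbTE nj|]; rewrite vl_upd // ?nj ?eqxx //.
Qed.

Section Middle.
Variables (x y : bvert r s) (k0 : 'I_(r + s)).
Hypotheses (kr : k0 < r) (xk0 : vl x k0 = 1).

Let c0 : cap r k0 = 2. Proof. by rewrite /cap kr. Qed.
Let o := upd x k0 0.
Let t := upd x k0 2.
Let vo j : vl o j = if j == k0 then 0 else vl x j. Proof. by rewrite vl_upd. Qed.
Let vt j : vl t j = if j == k0 then 2 else vl x j. Proof. by rewrite vl_upd ?c0. Qed.

Lemma middle_step_o : step_at x o k0.
Proof. by apply: step_at_upd; split; rewrite ?xk0; auto. Qed.

Lemma middle_step_t : step_at x t k0.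
Proof. by apply: step_at_upd; split; rewrite ?c0 ?xk0; auto. Qed.

Lemma middle_neq : o != t.
Proof.
by apply/eqP => /(congr1 (fun X => vl X k0)); rewrite vo vt eqxx.
Qed.

Lemma middle_not_adj : ~~ @adj (bgraph r s) o t.
Proof.
apply/negP => /adjP[k [h hk]]; case: (eqVneq k0 k) hk => [<-|/h].
  by rewrite vo vt eqxx; case.
by rewrite vo vt eqxx.
Qed.

Lemma middle_sep w : w \in rest x y -> @adj (bgraph r s) o w -> ~~ @adj (bgraph r s) w t.
Proof.
move=> wA /adjP[k [h hk]]; apply/negP => /adjP[k' [h' hk']].
have ko : k = k0.
  apply/eqP; rewrite eq_sym; apply/negPn/negP => n.
  have wk0 : vl w k0 = 0 by rewrite -h // vo eqxx.
  case: (eqVneq k0 k') hk' => [<-|/h']; rewrite wk0 vt eqxx //; lia.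
subst k; have k'o : k' = k0.
  apply/eqP; rewrite eq_sym; apply/negPn/negP => n.
  by have := h' k0 n; rewrite vt eqxx => e; move: hk; rewrite vo eqxx e; lia.
subst k'; move: hk hk'; rewrite vo vt eqxx => hk hk'.
case: (rest_neq wA (or_introl erefl)); apply: vl_inj => j.
have [->|nj] := eqVneq j k0; first by lia.
by rewrite -h // vo (negbTE nj).
Qed.

(** The direction [j] certifies that [y] is off the box: at [j] the box takes only the value of [x]
    and, for [k1] or [k2], the one new value. The direction [k0] cannot be used, since the box takes
    all three values there. *)
Lemma middle_box k1 k2 t1 t2 : k1 != k0 -> k2 != k0 -> k1 != k2 ->
  step_to x k1 t1 -> step_to x k2 t2 ->
  (exists2 j, j != k0 & [&& vl y j != vl x j, (j == k1) ==> (vl y j != t1)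
     & (j == k2) ==> (vl y j != t2)]) ->
  ~ partial_cube (bdel x y).
Proof.
move=> n1 n2 n12 [h1 s1] [h2 s2] [j nj hj].
apply: (box_obstruction middle_step_o middle_step_t n12 n1 n2 n1 n2 h1 h2 s1 s2
  middle_neq middle_not_adj middle_sep) => w b c hw; apply/eqP => e.
have wj : vl w j = vl x j by case: hw => [|[]] ->; rewrite ?vo ?vt ?(negbTE nj).
case/and3P: hj; rewrite -e vl_pt // wj.
case: (eqVneq j k1) => [->|_]; first by case: b {e}; rewrite ?eqxx.
by case: (eqVneq j k2) => [->|_]; [case: c {e}; rewrite ?eqxx|rewrite eqxx].
Qed.

Lemma middle_hexagon k1 k2 t1 t2 : k1 != k0 -> k2 != k0 -> k1 != k2 ->
  step_to x k1 t1 -> step_to x k2 t2 ->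
  vl y k0 != 1 -> vl y k1 = t1 -> vl y k2 = t2 ->
  (forall j, j != k0 -> j != k1 -> j != k2 -> vl y j = vl x j) ->
  ~ partial_cube (bdel x y).
Proof.
move=> n1 n2 n12 [h1 s1] [h2 s2] y0 y1 y2 hy.
have yE w : vl y k0 = vl w k0 -> y = pt x k1 k2 t1 t2 w true true \/ ~ (forall j, j != k0 -> vl w j = vl x j).
  move=> e; have [/forallP h|/forallPn[j]] := boolP [forall j, (j != k0) ==> (vl w j == vl x j)].
    left; apply: vl_inj => j; rewrite vl_pt //.
    case: (eqVneq j k1) => [->//|m1]; case: (eqVneq j k2) => [->//|m2].
    have [->//|m0] := eqVneq j k0.
    by rewrite hy //; have := h j; rewrite m0 => /eqP ->.
  by rewrite negb_imply => /andP[m0 m]; right=> /(_ j m0) e'; rewrite e' eqxx in m.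
have oE j : j != k0 -> vl o j = vl x j by rewrite vo => /negbTE ->.
have tE j : j != k0 -> vl t j = vl x j by rewrite vt => /negbTE ->.
(* [hexagon_obstruction] wants [y] over its first end, so the roles of [o] and [t] are exchanged
   when [y] has value 2. *)
have := vl_le2 y k0; case E: (vl y k0) => [|[|[|]]] // _; last 2 first.
- by rewrite E in y0.
- have [|e|//] := yE t; first by rewrite vt eqxx.
  apply: (hexagon_obstruction middle_step_t middle_step_o n12 n1 n2 n1 n2 h1 h2 s1 s2
    _ _ _ e); first by rewrite eq_sym; exact: middle_neq.
    by rewrite adj_sym; exact: middle_not_adj.
  move=> w wA tw; apply/negP => wo; rewrite adj_sym in wo.
  by have := middle_sep wA wo; rewrite adj_sym tw.
have [|e|//] := yE o; first by rewrite vo eqxx.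
exact: (hexagon_obstruction middle_step_o middle_step_t n12 n1 n2 n1 n2 h1 h2 s1 s2
  middle_neq middle_not_adj middle_sep e).
Qed.

End Middle.

(** This is where the bound [4 <= r + s] comes from: two directions are reserved and two are needed
    for the box. *)
Lemma two_others (k k' : 'I_(r + s)) : 4 <= r + s ->
  exists k1 k2, [/\ k1 != k2, k1 != k, k2 != k, k1 != k' & k2 != k'].
Proof.
move=> rs4; have : 1 < #|~: [set k; k']|.
  by have := cardsC [set k; k']; rewrite cards2 card_ord; case: eqP => _ /=; lia.
case/card_gt1P => k1 [k2 []]; rewrite !inE !negb_or => /andP[? ?] /andP[? ?] ?.
by exists k1, k2.
Qed.

Lemma not_corner x : ~~ corner x -> exists2 k : 'I_(r + s), k < r & vl x k = 1.
Proof.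
case/forallPn => i; rewrite negb_or => /andP[h0 h2]; exists (lshift s i).
  by rewrite /= ltn_ord.
by rewrite vl_lshift; case: (x.1 i) h0 h2 => [[|[|[|]]]].
Qed.

(** Wherever [x] has value 1 in a [P_3]-coordinate, [y] must agree with [x] in all other
    coordinates, for a disagreement at [c] admits a box avoiding [y]. Two such coordinates would
    give [x = y], so there is one only, and [y] is a corner next to [x]. *)
Lemma not_corner_large x y : 4 <= r + s -> x != y -> ~~ corner x ->
  partial_cube (bdel x y) -> exists k, corner_edge y x k.
Proof.
move=> rs4 nxy /not_corner[k kr xk] pc.
have eqo k0 (k0r : k0 < r) : vl x k0 = 1 -> forall c, c != k0 -> vl y c = vl x c.
  move=> xk0 c nc; apply/eqP/negPn/negP => nyc; suff: ~ partial_cube (bdel x y) by [].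
  have [k1 [k2 [n12 n1 n2 m1 m2]]] := two_others k0 c rs4.
  have [t1 h1] := step_to_ex x k1; have [t2 h2] := step_to_ex x k2.
  apply: (middle_box k0r xk0 n1 n2 n12 h1 h2); exists c => //.
  by rewrite nyc !(eq_sym c) (negbTE m1) (negbTE m2).
have nk : vl x k != vl y k.
  have [j nj] := vl_neq nxy; apply: contraNneq nj => e.
  by have [->|/(eqo k kr xk)->] := eqVneq j k; rewrite ?e.
have ck : cap r k = 2 by rewrite /cap kr.
exists k; split=> //; last by apply: eqo.
apply/cornerP => j; have [->|nj] := eqVneq j k.
  by move/eqP: nk; have := vl_le2 y k; rewrite ck xk; case: (vl y k) => [|[|[|]]]; auto.
have [jr|rj] := ltnP j r; last first.
  by rewrite /cap ltnNge rj /=; have := vl_binary y rj; lia.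
have nx1 : vl x j <> 1.
  by move/(eqo j jr)/(_ k); rewrite eq_sym => /(_ nj) e; rewrite e eqxx in nk.
by rewrite (eqo k kr xk) // /cap jr; have := vl_le2 x j; lia.
Qed.

(** [x] and [y] are opposite in a square, and [o], [t] are its other two vertices, whose only common
    neighbours are deleted. Points of the box leave [x] in at most one of [ko], [kt], so [y] is not
    among them. *)
Lemma corners_large x y : 4 <= r + s -> corner x -> corner y ->
  (pnum x y, qnum x y) = (0, 2) -> ~ partial_cube (bdel x y).
Proof.
move=> rs4 cx cy pq; have [ko [kt [not ro rt hd]]] := corners_differ2 cx cy pq.
have [k1 [k2 [n12 n1o n2o n1t n2t]]] := two_others ko kt rs4.
have [t1 [h1 s1]] := step_to_ex x k1; have [t2 [h2 s2]] := step_to_ex x k2.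
have [po so] := step_to_ex x ko; have [qt st] := step_to_ex x kt.
have xo := vl_binary x ro; have xt := vl_binary x rt.
have bo := vl_binary _ ro; have bt := vl_binary _ rt.
have yo : vl x ko != vl y ko by rewrite hd eqxx.
have yt : vl x kt != vl y kt by rewrite hd eqxx orbT.
have vo j : vl (upd x ko po) j = if j == ko then po else vl x j by rewrite vl_upd //; case: so.
have vt j : vl (upd x kt qt) j = if j == kt then qt else vl x j by rewrite vl_upd //; case: st.
have so' := step_at_upd so; have st' := step_at_upd st.
have nto : kt != ko by rewrite eq_sym.
have xe j : j != ko -> j != kt -> vl x j = vl y j.
  by move=> /negbTE n1 /negbTE n2; have := hd j; rewrite n1 n2 => /negbFE/eqP.
have oo : vl (upd x ko po) ko = po by rewrite vo eqxx.
have ott : vl (upd x ko po) kt = vl x kt by rewrite vo (negbTE nto).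
have tt : vl (upd x kt qt) kt = qt by rewrite vt eqxx.
have to : vl (upd x kt qt) ko = vl x ko by rewrite vt (negbTE not).
have pox := step_to_neq so.
have qtx := step_to_neq st.
have pob : po <= 1 by rewrite -oo bo.
have ot : upd x ko po != upd x kt qt.
  by apply/eqP => e; move: oo; rewrite e to => /esym.
apply: (box_obstruction so' st' n12 n1o n2o n1t n2t h1 h2 s1 s2 ot).
- by apply: (not_adj2 not); rewrite ?oo ?to ?ott ?tt; apply/eqP => // /esym.
- move=> w wA /adjP[k [h hk]]; apply/negP => /adjP[k' [h' hk']].
  have [kE|nk] := eqVneq k ko.
    subst k; case: (rest_neq wA (or_introl erefl)); apply: vl_inj => j.
    have [->|nj] := eqVneq j ko; last by rewrite -h // vo (negbTE nj).
    by move: hk; rewrite oo => /step_neq nw; apply: (@bit_eq _ po); rewrite ?bo //; apply/nesym.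
  have wo : vl w ko = po by rewrite -h ?oo // eq_sym.
  have [kE|nk'] := eqVneq k kt.
    subst k; case: (rest_neq wA (or_intror erefl)); apply: vl_inj => j.
    have [->|nj] := eqVneq j ko.
      by rewrite wo; apply: (@bit_eq _ (vl x ko)); rewrite ?bo //; apply/nesym/eqP.
    have [->|mj] := eqVneq j kt.
      move: hk; rewrite ott => /step_neq nw.
      by apply: (@bit_eq _ (vl x kt)); rewrite ?bt //; apply/nesym/eqP.
    by rewrite -h // vo (negbTE nj) xe.
  have wt : vl w kt = vl x kt by rewrite -h ?ott // eq_sym.
  have ko' : k' = ko.
    apply/eqP; rewrite eq_sym; apply/negPn/negP => n.
    by apply: pox; rewrite -wo h' ?to.
  by apply: qtx; rewrite -wt h' ?tt // ko'.
move=> w b c hw; apply/eqP => e.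
have eo : vl w ko = vl y ko.
  by rewrite -e vl_pt // ![ko == _]eq_sym (negbTE n1o) (negbTE n2o).
have et : vl w kt = vl y kt.
  by rewrite -e vl_pt // ![kt == _]eq_sym (negbTE n1t) (negbTE n2t).
by case: hw => [|[]] we; move: eo et yo yt; rewrite we ?oo ?ott ?to ?tt => e1 e2; rewrite ?e1 ?e2 ?eqxx.
Qed.

End Obstructions.

(** * Small cases by computation *)

(* Here a vertex is the list of its coordinates; the tests whose names end in l are
   run on all pairs of vertices with r + s <= 3. *)
Section Lists.

Fixpoint boxes (cs : seq nat) : seq (seq nat) :=
  if cs is c :: cs' then [seq v :: l | v <- iota 0 c.+1, l <- boxes cs'] else [:: [::]].

Definition verts (r s : nat) := boxes (mkseq (cap r) (r + s)).

Definition step_nat (m n : nat) := (m == n.+1) || (n == m.+1).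

Definition adjl n (l m : seq nat) := has (fun k => step_nat (nth 0 l k) (nth 0 m k) &&
  all (fun j => (j == k) || (nth 0 l j == nth 0 m j)) (iota 0 n)) (iota 0 n).

Definition cornl r n (l : seq nat) :=
  all (fun k => (nth 0 l k == 0) || (nth 0 l k == cap r k)) (iota 0 n).

Definition edgel r n (l m : seq nat) := cornl r n l && has (fun k =>
  [&& k < r, nth 0 m k == 1 & all (fun j => (j == k) || (nth 0 l j == nth 0 m j)) (iota 0 n)])
  (iota 0 n).

(* Elements (k0, ((k1, t1), (k2, t2))): a P_3-coordinate k0 with value 1 and two steps
   l_k1 -> t1, l_k2 -> t2 spanning the boxes of middle_box and middle_hexagon. *)
Definition frames r n (l : seq nat) : seq (nat * ((nat * nat) * (nat * nat))) :=
  let steps := [seq (k, t) | k <- iota 0 n, t <- iota 0 3] in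
  let frame q := let: (k0, ((k1, t1), (k2, t2))) := q in
    [&& nth 0 l k0 == 1, k1 != k0, k2 != k0, k1 != k2, t1 <= cap r k1, t2 <= cap r k2,
       step_nat (nth 0 l k1) t1 & step_nat (nth 0 l k2) t2] in
  [seq q <- [seq (k0, p) | k0 <- iota 0 r, p <- [seq (p1, p2) | p1 <- steps, p2 <- steps]]
   | frame q].

Definition boxl r n (l m : seq nat) := has (fun q => let: (k0, ((k1, t1), (k2, t2))) := q in
  has (fun j => [&& j != k0, nth 0 m j != nth 0 l j, (j == k1) ==> (nth 0 m j != t1)
    & (j == k2) ==> (nth 0 m j != t2)]) (iota 0 n)) (frames r n l).

Definition hexl r n (l m : seq nat) := has (fun q => let: (k0, ((k1, t1), (k2, t2))) := q in
  [&& nth 0 m k0 != 1, nth 0 m k1 == t1, nth 0 m k2 == t2 &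
    all (fun j => [|| j == k0, j == k1, j == k2 | nth 0 m j == nth 0 l j]) (iota 0 n)])
  (frames r n l).

(* A candidate S for a union of components: a single vertex or a layer. *)
Definition cutl r s (l m : seq nat) :=
  let K := [seq u <- verts r s | (u != l) && (u != m)] in
  has (fun S => [&& has (fun u => u \in S) K, has (fun u => u \notin S) K &
    all (fun u => (u \notin S) || all (fun v => (v \in S) || ~~ adjl (r + s) u v) K) K])
  ([seq [:: u] | u <- K] ++ [seq [seq u <- K | nth 0 u k == 0] | k <- iota 0 (r + s)]).

Definition farl n (K : seq (seq nat)) (u v : seq nat) := [&& u != v, ~~ adjl n u v &
  all (fun w => ~~ (adjl n u w && adjl n w v)) K].

(* Two octagons a b c d e g h k and a b c d e g' h k with the same opposite edge ab. *)
Definition octagonsl n (K : seq (seq nat)) (a b c d e g h k g' : seq nat) :=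
  [&& all (fun u => u \in K) [:: a; b; c; d; e; g; h; k; g'],
    all (fun q => adjl n q.1 q.2) [:: (a, b); (b, c); (c, d); (d, e); (e, g); (g, h); (h, k);
      (k, a); (e, g'); (g', h)],
    farl n K a e, farl n K g b, farl n K g' b & g != g'].

(** Meant for the middle vertices [l], [m] of two fibres that differ in both binary coordinates. The
    remaining graph consists of two squares joined by two paths of length 2; [g] and [g'] are the
    two ways through one square. [P] takes its binary coordinates from [l] and [m], which covers all
    such pairs. *)
Definition octl r s (l m : seq nat) := [&& r == 1, s == 2 &
  let P (i : nat) (b c : bool) :=
    [:: i; nth 0 (if b then m else l) 1; nth 0 (if c then m else l) 2] in
  octagonsl (r + s) [seq u <- verts r s | (u != l) && (u != m)]
    (P 0 false true) (P 0 false false) (P 0 true false) (P 1 true false) (P 2 true false)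
    (P 2 false false) (P 2 false true) (P 1 false true) (P 2 true true)].

Definition actl r (p : seq nat) (b : seq bool) (l : seq nat) := mkseq (fun k =>
  let v := nth 0 l (nth 0 p k) in if nth false b k then cap r k - v else v) (size p).

(** Orbits are needed only for two and three coordinates. *)
Definition perml n : seq (seq nat) :=
  match n with
  | 2 => [:: [:: 0; 1]; [:: 1; 0]]
  | 3 => [:: [:: 0; 1; 2]; [:: 0; 2; 1]; [:: 1; 0; 2]; [:: 1; 2; 0]; [:: 2; 0; 1]; [:: 2; 1; 0]]
  | _ => [::]
  end.

Definition autl r n : seq (seq nat * seq bool) :=
  [seq (p, map (fun i => i == 1) b) |
    p <- [seq p <- perml n | all (fun k => cap r (nth 0 p k) == cap r k) (iota 0 n)],
    b <- boxes (nseq n 1)].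

Definition samel r n (a b l m : seq nat) := has (fun q =>
  let: (a', b') := (actl r q.1 q.2 a, actl r q.1 q.2 b) in
  ((a' == l) && (b' == m)) || ((a' == m) && (b' == l))) (autl r n).

Definition sporadicl (r s : nat) : seq (seq nat * seq nat) :=
  match r, s with
  | 2, 0 => [:: ([:: 1; 1], [:: 0; 0]); ([:: 0; 1], [:: 2; 0]);
                ([:: 1; 1], [:: 1; 0]); ([:: 1; 0], [:: 1; 2])]
  | 1, 2 => [:: ([:: 1; 0; 0], [:: 0; 0; 1]); ([:: 1; 0; 0], [:: 1; 0; 1])]
  | 2, 1 => [:: ([:: 0; 1; 0], [:: 1; 0; 0]); ([:: 1; 1; 0], [:: 1; 1; 1]);
                ([:: 0; 1; 0], [:: 0; 0; 1]); ([:: 0; 1; 0], [:: 0; 1; 1])]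
  | 3, 0 => [:: ([:: 0; 0; 1], [:: 0; 1; 0])]
  | _, _ => [::]
  end.

Definition smalll r s (l m : seq nat) := let n := r + s in
  [|| l == m, cornl r n l && cornl r n m, edgel r n l m, edgel r n m l,
      boxl r n l m, boxl r n m l, hexl r n l m, hexl r n m l,
      octl r s l m, (n == 2) && cutl r s l m |
      has (fun ab => samel r n ab.1 ab.2 l m) (sporadicl r s)].

Lemma small_check : all (fun r => all (fun s => all (fun l => all (smalll r s l) (verts r s))
  (verts r s)) (iota 0 (4 - r))) (iota 0 4).
Proof. by lazy. Qed.

Lemma square_check : all (fun l => all (fun m =>
  (nth 0 l 0 != nth 0 m 0) && (nth 0 l 1 != nth 0 m 1) ==> cutl 0 2 l m) (verts 0 2)) (verts 0 2).
Proof. by lazy. Qed.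

End Lists.

(** * Soundness of the tests on coordinate lists *)

Section ListVertices.
Variables r s : nat.
Implicit Types (x y u v w : bvert r s) (k j : 'I_(r + s)) (l m : seq nat).

Lemma mem_boxes cs l : (l \in boxes cs) = all2 leq l cs.
Proof.
elim: cs l => [|c cs IH] l; first by case: l.
rewrite -/(is_true _); apply/allpairsP/idP => [[[v l'] /= [+ + ->]]|].
  by rewrite -[0 :: iota 1 c]/(iota 0 c.+1) mem_iota ltnS IH => /= -> ->.
case: l => //= a l /andP[ac lc].
by exists (a, l); split=> //=; rewrite ?IH // -[0 :: iota 1 c]/(iota 0 c.+1) mem_iota ltnS.
Qed.

Definition lst x : seq nat := [seq vl x k | k <- enum 'I_(r + s)].

Definition ofl l : bvert r s := mk (fun k => nth 0 l k).

Lemma size_lst x : size (lst x) = r + s.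
Proof. by rewrite size_map size_enum_ord. Qed.

Lemma nth_lst x k : nth 0 (lst x) k = vl x k.
Proof. by rewrite (nth_map k) ?nth_ord_enum // size_enum_ord ltn_ord. Qed.

Lemma lst_inj : injective lst.
Proof. by move=> x y e; apply: vl_inj => k; rewrite -!nth_lst e. Qed.

Lemma lstK x : ofl (lst x) = x.
Proof. by apply: vl_inj => k; rewrite vl_mk ?nth_lst // => j; rewrite /= nth_lst vl_cap. Qed.

Lemma vertsP l : reflect (size l = r + s /\ forall k, nth 0 l k <= cap r k) (l \in verts r s).
Proof.
rewrite mem_boxes all2E size_mkseq; apply: (iffP andP) => [[/eqP sl h]|[sl h]].
  split=> // k; have ks : k < size l by rewrite sl ltn_ord.
  have kz : k < size (zip l (mkseq (cap r) (r + s))) by rewrite size_zip size_mkseq sl minnn.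
  have := all_nthP (0, 0) h k kz; rewrite nth_zip ?size_mkseq //=.
  by rewrite nth_mkseq // -sl.
split; first exact/eqP.
apply/(all_nthP (0, 0)) => k; rewrite size_zip size_mkseq sl minnn => ks.
rewrite nth_zip ?size_mkseq //= nth_mkseq //; exact: (h (Ordinal ks)).
Qed.

Lemma vl_ofl l k : l \in verts r s -> vl (ofl l) k = nth 0 l k.
Proof. by case/vertsP => _ h; rewrite vl_mk. Qed.

Lemma oflK l : l \in verts r s -> lst (ofl l) = l.
Proof.
move=> lv; case/vertsP: (lv) => sl _; apply: (@eq_from_nth _ 0); first by rewrite size_lst sl.
by move=> k; rewrite size_lst => ks; rewrite -[k]/(nat_of_ord (Ordinal ks)) nth_lst vl_ofl.
Qed.

Lemma lst_verts x : lst x \in verts r s.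
Proof. by apply/vertsP; split=> [|k]; rewrite ?size_lst ?nth_lst ?vl_cap. Qed.

Lemma all_iotaP (P : pred nat) : reflect (forall k, P k) (all P (iota 0 (r + s))).
Proof.
apply: (iffP allP) => [h k|h k]; first by apply: h; rewrite mem_iota ltn_ord.
by rewrite mem_iota /= => ks; apply: (h (Ordinal ks)).
Qed.

Lemma has_iotaP (P : pred nat) : reflect (exists k, P k) (has P (iota 0 (r + s))).
Proof.
apply: (iffP hasP) => [[k + Pk]|[k Pk]]; last by exists (k : nat); rewrite // mem_iota ltn_ord.
by rewrite mem_iota /= => ks; exists (Ordinal ks).
Qed.

Lemma step_natP (m n : nat) : reflect (m = n.+1 \/ n = m.+1) (step_nat m n).
Proof. by apply: (iffP orP) => -[/eqP|/eqP]; auto. Qed.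

Lemma adjlE x y : adjl (r + s) (lst x) (lst y) = @adj (bgraph r s) x y.
Proof.
apply/has_iotaP/adjP => -[k h]; exists k.
  case/andP: h => /step_natP + /all_iotaP h; rewrite !nth_lst; split=> // j nj.
  by have := h j; rewrite (inj_eq val_inj) (negbTE nj) !nth_lst => /eqP.
case: h => h hk; rewrite !nth_lst; apply/andP; split; first exact/step_natP.
apply/all_iotaP => j; rewrite (inj_eq val_inj) !nth_lst.
by case: (eqVneq j k) => // /h ->; rewrite eqxx.
Qed.

Lemma cornlP x : reflect (corner x) (cornl r (r + s) (lst x)).
Proof.
apply: (iffP (all_iotaP _)) => [h|/cornerP h k].
  by apply/cornerP => k; have := h k; rewrite nth_lst => /orP[]/eqP; auto.
by rewrite nth_lst; case: (h k) => ->; rewrite eqxx ?orbT.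
Qed.

Lemma edgelP x y : edgel r (r + s) (lst x) (lst y) -> exists k, corner_edge x y k.
Proof.
case/andP => /cornlP cx /has_iotaP[k /and3P[kr /eqP yk /all_iotaP h]].
exists k; split=> //; first by rewrite -nth_lst.
move=> j nj; have := h j; rewrite (inj_eq val_inj) (negbTE nj) !nth_lst.
by move/eqP.
Qed.

Lemma framesP x (k0 k1 t1 k2 t2 : nat) : (k0, ((k1, t1), (k2, t2))) \in frames r (r + s) (lst x) ->
  exists j0 j1 j2 : 'I_(r + s), [/\ [/\ j0 = k0 :> nat, j1 = k1 :> nat & j2 = k2 :> nat],
    j0 < r, vl x j0 = 1, [/\ j1 != j0, j2 != j0 & j1 != j2] &
    step_to x j1 t1 /\ step_to x j2 t2].
Proof.
rewrite mem_filter => /andP[/and5P[x0 n1 n2 n12 /and4P[c1 c2 s1 s2]]].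
case/allpairsP => -[k0' p] [+ + [? ?]]; subst k0' p.
rewrite mem_iota => /andP[_ kr] /allpairsP[[p1 p2] [+ + [? ?]]]; subst p1 p2.
case/allpairsP => -[k1' t1'] [+ _ [? ?]]; subst k1' t1'; rewrite mem_iota => /andP[_ h1].
case/allpairsP => -[k2' t2'] [+ _ [? ?]]; subst k2' t2'; rewrite mem_iota => /andP[_ h2].
have h0 : k0 < r + s by apply: leq_trans kr (leq_addr _ _).
exists (Ordinal h0), (Ordinal h1), (Ordinal h2); split=> //.
  by rewrite -nth_lst; apply/eqP.
by split; split=> //; rewrite -nth_lst; apply/step_natP.
Qed.

Lemma boxlP x y : boxl r (r + s) (lst x) (lst y) -> ~ partial_cube (bdel x y).
Proof.
case/hasP => -[k0 [[k1 t1] [k2 t2]]] /framesP[j0 [j1 [j2 [[<- <- <-] jr x0 [n1 n2 n12] [s1 s2]]]]].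
case/has_iotaP => j /and4P[]; rewrite !(inj_eq val_inj) !nth_lst => nj ny h1 h2.
by apply: (middle_box jr x0 n1 n2 n12 s1 s2); exists j; rewrite ?ny ?h1.
Qed.

Lemma hexlP x y : hexl r (r + s) (lst x) (lst y) -> ~ partial_cube (bdel x y).
Proof.
case/hasP => -[k0 [[k1 t1] [k2 t2]]] /framesP[j0 [j1 [j2 [[<- <- <-] jr x0 [n1 n2 n12] [s1 s2]]]]].
rewrite !nth_lst => /and4P[y0 /eqP y1 /eqP y2 /all_iotaP h].
apply: (middle_hexagon jr x0 n1 n2 n12 s1 s2) => // j m0 m1 m2.
by have := h j; rewrite !(inj_eq val_inj) (negbTE m0) (negbTE m1) (negbTE m2) !nth_lst => /eqP.
Qed.

Let remaining x y := [seq u <- verts r s | (u != lst x) && (u != lst y)].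

Lemma mem_remaining x y u : (lst u \in remaining x y) = (u \in rest x y).
Proof. by rewrite mem_filter lst_verts andbT restP !(inj_eq lst_inj). Qed.

Lemma remaining_sub x y l : l \in remaining x y -> exists u : bdel x y, l = lst (val u).
Proof.
move=> lK; have lv : l \in verts r s by move: lK; rewrite mem_filter => /andP[].
have uA : ofl l \in rest x y by rewrite -mem_remaining oflK.
by exists (Sub (ofl l) uA); rewrite /= oflK.
Qed.

Lemma adjl_sub x y (u v : bdel x y) : adjl (r + s) (lst (val u)) (lst (val v)) = adj u v.
Proof. exact: adjlE. Qed.

Lemma farlP x y (u v : bdel x y) :
  farl (r + s) (remaining x y) (lst (val u)) (lst (val v)) -> far u v.
Proof.
case/and3P => nuv na /allP h; split.
- by apply: contraNneq nuv => ->.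
- by rewrite -adjl_sub.
- move=> w uw; have := h (lst (val w)); rewrite mem_remaining (valP w) => /(_ isT).
  by rewrite !adjl_sub uw.
Qed.

(** Both [eg] and [eg'] are parallel to [ab], which would give [g] and [g'] the same code. *)
Lemma octlP x y : octl r s (lst x) (lst y) -> ~ partial_cube (bdel x y).
Proof.
case/and3P => _ _ /and5P[/and5P[]].
move=> /remaining_sub[a ->] /remaining_sub[b ->] /remaining_sub[c ->] /remaining_sub[d ->].
case/and5P => /remaining_sub[e ->] /remaining_sub[g ->] /remaining_sub[h ->]
  /remaining_sub[k ->] /andP[/remaining_sub[g' ->] _].
rewrite /= !adjl_sub !andbT => /and5P[ab bc cd de /and5P[eg gh hk ka /andP[eg' gh']]].
move=> /farlP ae /farlP gb /andP[/farlP gb' ngg'] /partial_cube_geodesic[n [f gf]].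
have p1 := octagon_parallel gf ab bc cd de eg gh hk ka ae gb.
have p2 := octagon_parallel gf ab bc cd de eg' gh' hk ka ae gb'.
case/eqP: ngg'; congr (lst (val _)); apply: (geodesic_inj gf); apply/ffunP => i.
by have := p1 i; rewrite p2; case: (f e i); case: (f g i); case: (f g' i).
Qed.

Lemma cutlP x y : cutl r s (lst x) (lst y) -> ~ partial_cube (bdel x y).
Proof.
case/hasP => S _ /and3P[/hasP[_ /remaining_sub[u ->] uS] /hasP[_ /remaining_sub[v ->] vS] /allP cl].
case/partial_cube_geodesic => n [f gf]; have [p [pp pv _ _]] := geodesic_path u v gf.
case/negP: vS; rewrite -{}pv; elim: p u pp uS => // w p IH u /andP[uw pp] uS.
apply: (IH w pp); have := cl (lst (val u)); rewrite mem_remaining (valP u) uS => /(_ isT)/allP.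
move/(_ (lst (val w))); rewrite mem_remaining (valP w) => /(_ isT).
by rewrite adjl_sub uw orbF.
Qed.

End ListVertices.

(** * Automorphisms and orbits of deleted pairs *)

Section Automorphisms.
Variables r s : nat.
Implicit Types (x y u v w : bvert r s) (k j : 'I_(r + s)) (l m : seq nat).

Section Aut.
Variables (pi : 'I_(r + s) -> 'I_(r + s)) (b : 'I_(r + s) -> bool).
Hypotheses (pi_inj : injective pi) (pi_cap : forall k, cap r (pi k) = cap r k).

Definition aut x : bvert r s :=
  mk (fun k => let v := vl x (pi k) in if b k then cap r k - v else v).

Lemma vl_aut x k : vl (aut x) k = if b k then cap r k - vl x (pi k) else vl x (pi k).
Proof.
rewrite vl_mk // => j; case: (b j); first exact: leq_subr.
by rewrite -pi_cap vl_cap.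
Qed.

Lemma vl_aut_eq x y k : (vl (aut x) k == vl (aut y) k) = (vl x (pi k) == vl y (pi k)).
Proof.
rewrite !vl_aut; case: (b k) => //.
have := vl_cap x (pi k); have := vl_cap y (pi k); rewrite pi_cap => hy hx.
by apply/eqP/eqP; lia.
Qed.

Lemma aut_iso : @graph_iso (bgraph r s) (bgraph r s) aut.
Proof.
have [pj piK pjK] := injF_bij pi_inj; split=> [|x y].
  apply: injF_bij => x y e; apply: vl_inj => k; apply/eqP.
  by rewrite -(pjK k) -vl_aut_eq e.
have st k : vl (aut x) k = (vl (aut y) k).+1 \/ vl (aut y) k = (vl (aut x) k).+1 <->
    vl x (pi k) = (vl y (pi k)).+1 \/ vl y (pi k) = (vl x (pi k)).+1.
  rewrite !vl_aut; case: (b k) => //.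
  have := vl_cap x (pi k); have := vl_cap y (pi k); rewrite pi_cap => hy hx.
  by split; lia.
apply/adjP/adjP => -[k [h hk]].
  exists (pi k); split; last exact/st.
  move=> j nj; rewrite -(pjK j); apply/eqP; rewrite -vl_aut_eq h //.
  by apply: contraNneq nj => <-; rewrite pjK.
exists (pj k); split; last by apply/st; rewrite pjK.
move=> j nj; apply/eqP; rewrite vl_aut_eq h //.
by apply: contraNneq nj => <-; rewrite piK.
Qed.

End Aut.

Lemma actl_aut (p : seq nat) (b : seq bool) :
  perm_eq p (iota 0 (r + s)) -> (forall k, cap r (nth 0 p k) = cap r k) ->
  exists2 phi : bgraph r s -> bgraph r s, graph_iso phi &
    forall l, l \in verts r s -> phi (ofl r s l) = ofl r s (actl r p b l).
Proof.
move=> pp pc.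
have sp : size p = r + s by rewrite (perm_size pp) size_iota.
have pl (k : 'I_(r + s)) : nth 0 p k < r + s.
  have : nth 0 p k \in iota 0 (r + s) by rewrite -(perm_mem pp) mem_nth ?sp.
  by rewrite mem_iota.
pose pi k := Ordinal (pl k).
have pinj : injective pi.
  move=> j k /(congr1 val) /= /eqP; rewrite nth_uniq ?sp // ?(perm_uniq pp) ?iota_uniq //.
  by move/eqP/val_inj.
exists (aut pi (fun k => nth false b k)); first exact: aut_iso.
move=> l' lv; apply: vl_inj => k; rewrite vl_aut // vl_ofl // vl_mk.
  by rewrite nth_mkseq ?sp.
move=> j; rewrite nth_mkseq ?sp //; case: (nth false b j); first exact: leq_subr.
by rewrite -pc; have [_ /(_ (pi j))] := vertsP _ _ _ lv.
Qed.

Lemma autl_perm q : q \in autl r (r + s) ->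
  perm_eq q.1 (iota 0 (r + s)) /\ forall k, cap r (nth 0 q.1 k) = cap r k.
Proof.
case/allpairsP => -[p b] /= [+ _ ->] /=; rewrite mem_filter => /andP[/all_iotaP h pm].
split; last by move=> k; apply/eqP/h.
have := pm; rewrite /perml; case: (r + s) => [|[|[|[|n]]]] //; rewrite !inE => pm'.
  by case/orP: pm' => /eqP ->.
by do 5!case/orP: pm' => [/eqP -> //|pm']; move/eqP: pm' => ->.
Qed.

Definition same_orbit (a b x y : bvert r s) : Prop :=
  exists2 phi : bgraph r s -> bgraph r s, graph_iso phi & [set phi a; phi b] = [set x; y].

Lemma samelP a b x y : a \in verts r s -> b \in verts r s ->
  samel r (r + s) a b (lst x) (lst y) -> same_orbit (ofl r s a) (ofl r s b) x y.
Proof.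
move=> av bv /hasP[q /autl_perm[qp qc] h].
have [phi iphi hphi] := actl_aut q.2 qp qc.
exists phi => //; rewrite !hphi //.
by case/orP: h => /andP[/eqP -> /eqP ->]; rewrite !lstK // setUC.
Qed.

Lemma same_orbit_isomorphic a b x y : same_orbit a b x y -> isomorphic (bdel x y) (bdel a b).
Proof.
case=> phi [bphi aphi] e; have [psi phiK psiK] := bphi.
have mem u : (phi u \in rest x y) = (u \in rest a b).
  by rewrite ![_ \in rest _ _]inE -e !inE !(inj_eq (bij_inj bphi)).
have memg (u : bdel x y) : psi (val u) \in rest a b by rewrite -mem psiK (valP u).
have memh (u : bdel a b) : phi (val u) \in rest x y by rewrite mem (valP u).
exists (fun u : bdel x y => Sub (psi (val u)) (memg u)); split.
  by exists (fun u : bdel a b => Sub (phi (val u)) (memh u)) => u; apply: val_inj; rewrite /= ?psiK ?phiK.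
move=> u v; change (@adj (bgraph r s) (psi (val u)) (psi (val v)) = @adj (bgraph r s) (val u) (val v)).
by rewrite -aphi !psiK.
Qed.

End Automorphisms.

Lemma ofl_bvtx r s (l m : seq nat) : size l = r -> ofl r s (l ++ m) = bvtx r s l m.
Proof.
move=> sl; congr pair; apply/ffunP => i; rewrite !ffunE nth_cat /= sl.
  by rewrite ltn_ord.
by rewrite ltnNge leq_addr addKn.
Qed.

Lemma sporadicE r s :
  sporadic_pairs r s = [seq (ofl r s ab.1, ofl r s ab.2) | ab <- sporadicl r s].
Proof.
by case: r => [|[|[|[|r]]]]; case: s => [|[|[|s]]] //=; rewrite -!ofl_bvtx.
Qed.

Lemma sporadicl_verts r s ab : ab \in sporadicl r s -> (ab.1 \in verts r s) && (ab.2 \in verts r s).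
Proof.
apply/allP: ab; by case: r => [|[|[|[|r]]]]; case: s => [|[|[|s]]] //.
Qed.

Lemma sporadicP r s (x y : bvert r s) :
  sporadic x y <-> exists2 ab, ab \in sporadicl r s & same_orbit (ofl r s ab.1) (ofl r s ab.2) x y.
Proof.
split=> [[ab]|[ab abs so]]; rewrite ?sporadicE.
  by case/mapP => ab' abs ->; exists ab'.
by exists (ofl r s ab.1, ofl r s ab.2); rewrite ?sporadicE ?map_f //; apply/mapP; exists ab.
Qed.

Lemma small_partial_cube r s (x y : bvert r s) : r + s <= 3 -> x != y -> partial_cube (bdel x y) ->
  [\/ corner x /\ corner y, boundary_P3_edge x y | sporadic x y].
Proof.
move=> rs3 nxy pc.
have : smalll r s (lst x) (lst y).
  have r4 : r \in iota 0 4 by rewrite mem_iota; lia.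
  have s4 : s \in iota 0 (4 - r) by rewrite mem_iota; lia.
  by move/allP/(_ r r4)/allP/(_ s s4)/allP/(_ _ (lst_verts x))/allP/(_ _ (lst_verts y)): small_check.
case/or4P => [/eqP/lst_inj e|/andP[/cornlP cx /cornlP cy]|/edgelP[k h]|].
- by rewrite e eqxx in nxy.
- by constructor 1.
- by constructor 2; apply/boundary_P3_edgeP; exists k; left.
case/or4P => [/edgelP[k h]|/boxlP//|/boxlP h|].
- by constructor 2; apply/boundary_P3_edgeP; exists k; right.
- by case: h; rewrite bdelC.
case/or4P => [/hexlP//|/hexlP h|/octlP//|].
- by case: h; rewrite bdelC.
case/orP => [/andP[_ /cutlP//]|/hasP[ab abs h]].
constructor 3; apply/sporadicP; exists ab => //.
by case/andP: (sporadicl_verts abs) => av bv; apply: samelP.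
Qed.

Lemma square_not_partial_cube (x y : bvert 0 2) : (forall k, vl x k != vl y k) ->
  ~ partial_cube (bdel x y).
Proof.
move=> h; apply: cutlP.
move/allP/(_ _ (lst_verts x))/allP/(_ _ (lst_verts y)): square_check => /implyP; apply.
have h0 := h (@Ordinal (0 + 2) 0 isT); have h1 := h (@Ordinal (0 + 2) 1 isT).
by rewrite -!nth_lst in h0 h1; apply/andP.
Qed.

(** Four or more coordinates fall to [corners_large]; for two, what remains of the square is a pair
    of nonadjacent vertices. *)
Lemma corners02_partial_cube r s (x y : bvert r s) : corner x -> corner y ->
  (pnum x y, qnum x y) = (0, 2) -> partial_cube (bdel x y) -> r + s = 3.
Proof.
move=> cx cy pq pc; have [k1 [k2 [n12 r1 r2 hd]]] := corners_differ2 cx cy pq.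
have k1s := ltn_ord k1; have k2s := ltn_ord k2.
have nk : k1 <> k2 :> nat by move/ord_inj => e; rewrite e eqxx in n12.
have [rs4|rs3] := leqP 4 (r + s); first by case: (corners_large rs4 cx cy pq pc).
case: (eqVneq (r + s) 3) => // n3; exfalso.
have [r0 s2] : r = 0 /\ s = 2 by lia.
subst r s; apply: (square_not_partial_cube _ pc) => k; rewrite hd.
by rewrite -!(inj_eq val_inj) /=; have := ltn_ord k; lia.
Qed.

(** * Explicit codes for the exceptional pairs *)

Section Certificates.

(** Least significant bit first, so that direction [i] has weight [2^i] in the certificates. *)
Fixpoint bits (n m : nat) : seq bool := if n is n'.+1 then odd m :: bits n' m./2 else [::].

Definition hamb n (u v : seq bool) := count (fun i => nth false u i != nth false v i) (iota 0 n).

Definition flipb n i (u : seq bool) := mkseq (fun j => nth false u j (+) (j == i)) n.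

Definition setb n k (u : seq bool) := mkseq (fun j => if j == k then false else nth false u j) n.

(** The decidable premise of [not_daisy]: for each candidate [z] some flip towards [z] leaves
    [C]. *)
Definition no_center n (C : seq (seq bool)) := all (fun z => has (fun v => has (fun i =>
  (nth false v i != nth false z i) && (flipb n i v \notin C)) (iota 0 n)) C) C.

(* The entries of L, in binary, are the images of the vertices other than a and b
   (in lexicographic order) under an isometric embedding into an n-cube. In all
   the cases below the contraction of direction 2 is again not a daisy cube. *)
Definition certified r s (a b : seq nat) n (L : seq nat) :=
  let K := [seq u <- verts r s | (u != a) && (u != b)] in
  let C := map (bits n) L in let T := zip K C in
  [&& [&& a \in verts r s, b \in verts r s, uniq K & size L == size K],
    all (fun p => all (fun q => adjl (r + s) p.1 q.1 == (hamb n p.2 q.2 == 1)) T) T,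
    all (fun p => all (fun q => (p.1 == q.1) || has (fun i =>
      (nth false p.2 i != nth false q.2 i) && (flipb n i p.2 \in C)) (iota 0 n)) T) T,
    (0 < size L) && no_center n C &
    [&& 2 < n, no_center n (map (setb n 2) C) & has (fun v => flipb n 2 v \in C) C]].

Definition certificates (r s : nat) : seq (seq nat * seq nat * (nat * seq nat)) :=
  match r, s with
  | 2, 0 =>
    [:: ([:: 1; 1], [:: 0; 0], (6, [:: 52; 53; 11; 55; 15; 31; 63]));
        ([:: 0; 1], [:: 2; 0], (5, [:: 2; 13; 3; 7; 15; 23; 31]));
        ([:: 1; 1], [:: 1; 0], (6, [:: 48; 49; 51; 55; 15; 31; 63]));
        ([:: 1; 0], [:: 1; 2], (6, [:: 16; 17; 19; 21; 13; 29; 61]))]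
  | 1, 2 =>
    [:: ([:: 1; 0; 0], [:: 0; 0; 1], (5, [:: 8; 9; 11; 7; 13; 15; 21; 23; 29; 31]));
        ([:: 1; 0; 0], [:: 1; 0; 1], (5, [:: 16; 17; 18; 19; 22; 23; 14; 15; 30; 31]));
        ([:: 0; 0; 0], [:: 0; 1; 1], (5, [:: 6; 9; 3; 7; 11; 15; 19; 23; 27; 31]))]
  | 2, 1 =>
    [:: ([:: 0; 1; 0], [:: 1; 0; 0],
          (6, [:: 16; 17; 19; 11; 27; 21; 7; 23; 15; 31; 37; 53; 39; 55; 47; 63]));
        ([:: 1; 1; 0], [:: 1; 1; 1],
          (5, [:: 0; 1; 2; 3; 10; 11; 4; 5; 26; 27; 20; 21; 28; 29; 30; 31]));
        ([:: 0; 1; 0], [:: 0; 0; 1],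
          (6, [:: 4; 25; 19; 27; 5; 13; 21; 29; 23; 31; 37; 45; 53; 61; 55; 63]));
        ([:: 0; 1; 0], [:: 0; 1; 1],
          (6, [:: 4; 5; 42; 43; 6; 7; 14; 15; 46; 47; 22; 23; 30; 31; 62; 63]))]
  | 3, 0 =>
    [:: ([:: 0; 0; 1], [:: 0; 1; 0],
          (7, [:: 4; 41; 35; 43; 19; 51; 59; 5; 37; 45; 7; 39; 47; 23; 55; 63; 69; 101; 109;
                  71; 103; 111; 87; 119; 127]))]
  | 0, 3 => [:: ([:: 0; 0; 0], [:: 0; 1; 1], (4, [:: 6; 9; 3; 7; 11; 15]))]
  | _, _ => [::]
  end.

Lemma certificates_check : all (fun rs => all (fun q => certified rs.1 rs.2 q.1.1 q.1.2 q.2.1 q.2.2)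
  (certificates rs.1 rs.2)) [:: (2, 0); (1, 2); (2, 1); (3, 0); (0, 3)].
Proof. by lazy. Qed.

Lemma size_bits n m : size (bits n m) = n.
Proof. by elim: n m => //= n IH m; rewrite IH. Qed.

Section Vectors.
Variable n : nat.
Implicit Types (u v : seq bool) (i : 'I_n).

Definition vec u : {ffun 'I_n -> bool} := [ffun i : 'I_n => nth false u i].

Lemma vec_inj u v : size u = n -> size v = n -> vec u = vec v -> u = v.
Proof.
move=> su sv /ffunP e; apply: (@eq_from_nth _ false) => [|i]; first by rewrite su sv.
by rewrite su => ni; have := e (Ordinal ni); rewrite !ffunE.
Qed.

Lemma vec_flip i u : vec (flipb n i u) = flip i (vec u).
Proof. by apply/ffunP => j; rewrite !ffunE nth_mkseq. Qed.

Lemma vec_set i u : vec (setb n i u) = setc i false (vec u).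
Proof. by apply/ffunP => j; rewrite !ffunE nth_mkseq. Qed.

Lemma ham_vec u v : ham (vec u) (vec v) = hamb n u v.
Proof.
rewrite /hamb -val_enum_ord count_map /ham cardE size_filter -enumT.
by apply: eq_count => i; rewrite !inE !ffunE.
Qed.

Lemma no_centerP (C : seq (seq bool)) z : all (fun v => size v == n) C -> no_center n C ->
  z \in C -> exists2 v, v \in C & exists i,
    vec v i != vec z i /\ forall w, w \in C -> vec w != flip i (vec v).
Proof.
move=> /allP sC /allP h /h /hasP[v vC /hasP[i]]; rewrite mem_iota => /= ni /andP[nvz nC].
exists v => //; exists (Ordinal ni); rewrite !ffunE; split=> // w wC.
rewrite -(vec_flip (Ordinal ni)); apply: contra nC => /eqP/vec_inj <- //.
  by apply/eqP/sC.
by rewrite size_mkseq.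
Qed.

End Vectors.
End Certificates.

Lemma nth_zip_mem (S T : eqType) (s0 : S) (t0 : T) (K : seq S) (C : seq T) u :
  size C = size K -> u \in K -> (u, nth t0 C (index u K)) \in zip K C.
Proof.
move=> e uK; have iK : index u K < size (zip K C) by rewrite size_zip e minnn index_mem.
by have := mem_nth (s0, t0) iK; rewrite nth_zip // nth_index.
Qed.

Lemma certifiedP r s (a b : seq nat) n (L : seq nat) (G : sgraph) :
  certified r s a b n L -> isomorphic G (bdel (ofl r s a) (ofl r s b)) ->
  [/\ partial_cube G, ~ daisy_cube G & ~ in_OD G].
Proof.
pose K := [seq u <- verts r s | (u != a) && (u != b)]; pose C := map (bits n) L.
case/and5P => /and4P[av bv uK /eqP sL] /allP hadj /allP hstep /andP[L0 nC]
  /and3P[n2 nC2 /hasP[e eC feC]] [g gi].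
have sC : size C = size K by rewrite size_map.
have sCn : all (fun v => size v == n) C.
  by apply/allP => _ /mapP[m _ ->]; rewrite size_bits.
set x := ofl r s a; set y := ofl r s b.
have KE : K = [seq u <- verts r s | (u != lst x) && (u != lst y)] by rewrite !oflK.
have memK u : (lst u \in K) = (u \in rest x y) by rewrite KE mem_remaining.
pose c (u : bdel x y) := nth [::] C (index (lst (val u)) K).
have uT u : (lst (val u), c u) \in zip K C.
  by apply: (nth_zip_mem [::]) => //; rewrite memK (valP u).
have cC u : c u \in C by rewrite mem_nth // sC index_mem memK (valP u).
have onto v : v \in C -> exists u, c u = v.
  move=> vC; have iK : index v C < size K by rewrite -sC index_mem.
  have := mem_nth [::] iK; rewrite KE => /remaining_sub[u]; rewrite -KE => e'; exists u.
  by rewrite /c -e' index_uniq // nth_index.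
pose f u := vec n (c u).
have gf : geodesic f.
  split=> [u v|u v nuv].
    have /allP/(_ _ (uT v)) := hadj _ (uT u); rewrite /= ham_vec adjl_sub.
    by move/eqP.
  have /allP/(_ _ (uT v)) := hstep _ (uT u); rewrite /= => /orP[/eqP/lst_inj/val_inj e'|].
    by rewrite e' eqxx in nuv.
  case/hasP => i; rewrite mem_iota => /= ni /andP[hi /onto[w cw]].
  exists w, (Ordinal ni); rewrite /f !ffunE; split=> //.
  by rewrite cw -(vec_flip (Ordinal ni)).
have gh := geodesic_iso gi gf; pose h := f \o g.
have ontoG v : v \in C -> exists u, h u = vec n v.
  by case/onto => u cu; case: gi => [[g' _ gK] _]; exists (g' u); rewrite /h /= gK /f cu.
have G0 : 0 < #|G|.
  have [u _] := ontoG e eC; by apply/card_gt0P; exists u.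
split; first exact: geodesic_partial_cube gh.
  apply: (not_daisy gh) => z; have [v vC [i [hi hw]]] := no_centerP sCn nC (cC (g z)).
  have [t ht] := ontoG v vC; exists t, i; rewrite -/(h t) ht; split=> // w.
  exact/hw/cC.
pose k := Ordinal n2; have [p hp] := ontoG e eC; have [q hq] := ontoG _ feC.
have fb : h q = flip k (h p) by rewrite hq hp -(vec_flip k).
apply: (contraction_not_OD gh fb); apply: (contraction_not_daisy gh fb) => z.
have sC2 : all (fun v => size v == n) (map (setb n 2) C).
  by apply/allP => _ /mapP[m _ ->]; rewrite size_mkseq.
have [v vC [i [hi hw]]] := no_centerP sC2 nC2 (map_f (setb n 2) (cC (g z))).
case/mapP: vC hi hw => v' v'C -> hi hw; have [t ht] := ontoG v' v'C.
have vecs u : setc k false (vec n u) = vec n (setb n 2 u) by rewrite (vec_set k).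
exists t, i; rewrite -/(h t) ht !vecs; split=> // w.
by rewrite vecs; apply/hw/map_f/cC.
Qed.

Lemma certificates_of r s ab : ab \in sporadicl r s \/
    (ab = ([:: 0; 0; 0], [:: 0; 1; 1]) /\ (r, s) \in [:: (0, 3); (1, 2)]) ->
  exists n L, certified r s ab.1 ab.2 n L.
Proof.
move=> h; suff /mapP[q qc ->] : ab \in [seq q.1 | q <- certificates r s].
  exists q.2.1, q.2.2; move/allP: certificates_check => /(_ (r, s)).
  have -> : (r, s) \in [:: (2, 0); (1, 2); (2, 1); (3, 0); (0, 3)].
    by move: qc; case: r {h} => [|[|[|[|r]]]]; case: s => [|[|[|[|s]]]].
  by move=> /(_ isT)/allP/(_ q qc).
case: h => [|[-> rs]]; last first.
  by move: rs; rewrite !inE !xpair_eqE => /orP[] /andP[/eqP -> /eqP ->].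
by apply/allP: ab; case: r => [|[|[|[|r]]]]; case: s => [|[|[|s]]].
Qed.

Lemma square_orbit_check : all (fun rs => all (fun l => all (fun m =>
  (cornl rs.1 3 l && cornl rs.1 3 m && has (fun k1 => has (fun k2 =>
     [&& k1 != k2, rs.1 <= k1, rs.1 <= k2 &
       all (fun j => (nth 0 l j != nth 0 m j) == (j == k1) || (j == k2)) (iota 0 3)])
     (iota 0 3)) (iota 0 3)) ==> samel rs.1 3 [:: 0; 0; 0] [:: 0; 1; 1] l m)
  (verts rs.1 rs.2)) (verts rs.1 rs.2)) [:: (0, 3); (1, 2)].
Proof. by lazy. Qed.

(** * The classification *)

Section Classification.
Variables r s : nat.
Implicit Types (x y : bvert r s) (k j : 'I_(r + s)).

Lemma square_orbit x y : corner x -> corner y -> (pnum x y, qnum x y) = (0, 2) -> r + s = 3 ->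
  (r, s) \in [:: (0, 3); (1, 2)] /\ same_orbit (ofl r s [:: 0; 0; 0]) (ofl r s [:: 0; 1; 1]) x y.
Proof.
move=> cx cy /(corners_differ2 cx cy)[k1 [k2 [n12 r1 r2 hd]]] rs3.
have l1 := ltn_ord k1; have l2 := ltn_ord k2.
have n12' : k1 != k2 :> nat by rewrite (inj_eq val_inj).
have rs : (r, s) \in [:: (0, 3); (1, 2)].
  by rewrite !inE !xpair_eqE; move/eqP: n12'; lia.
split=> //.
have := allP square_orbit_check _ rs.
move=> /allP/(_ _ (lst_verts x))/allP/(_ _ (lst_verts y))/implyP h.
have vs l : size l = 3 -> all (fun v => v <= 1) l -> l \in verts r s.
  move=> sl /allP al; apply/vertsP; split=> [|k]; first by rewrite sl rs3.
  apply: leq_trans (cap_gt0 k); apply/al/mem_nth; rewrite sl -rs3; exact: ltn_ord.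
rewrite -rs3 in h; apply: samelP; rewrite ?vs //; apply: h.
apply/andP; split; first by apply/andP; split; exact/cornlP.
apply/has_iotaP; exists k1; apply/has_iotaP; exists k2; rewrite n12' r1 r2.
by apply/all_iotaP => j; rewrite !nth_lst hd !(inj_eq val_inj).
Qed.

Lemma special_deletions x y :
  sporadic x y \/ [/\ corner x, corner y, (pnum x y, qnum x y) = (0, 2) & r + s = 3] ->
  [/\ partial_cube (bdel x y), ~ daisy_cube (bdel x y) & ~ in_OD (bdel x y)].
Proof.
case=> [/sporadicP[ab abs so]|[cx cy pq rs3]].
  have [n [L ok]] := certificates_of (or_introl abs).
  exact: certifiedP ok (same_orbit_isomorphic so).
have [rs so] := square_orbit cx cy pq rs3.
have [n [L ok]] := certificates_of (or_intror (conj erefl rs)).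
exact: certifiedP ok (same_orbit_isomorphic so).
Qed.

Lemma boundary_cases x y : boundary_P3_edge x y ->
  exists x' y' k, corner_edge x' y' k /\ rest x y = rest x' y'.
Proof.
case/boundary_P3_edgeP => k [h|h]; first by exists x, y, k.
by exists y, x, k; rewrite restC.
Qed.

Lemma partial_cube_cases x y : x != y -> partial_cube (bdel x y) ->
  [\/ [/\ corner x, corner y &
        (pnum x y, qnum x y) <> (0, 2) \/ (pnum x y, qnum x y) = (0, 2) /\ r + s = 3],
     boundary_P3_edge x y | sporadic x y].
Proof.
move=> nxy pc.
have corners : corner x -> corner y -> [/\ corner x, corner y &
    (pnum x y, qnum x y) <> (0, 2) \/ (pnum x y, qnum x y) = (0, 2) /\ r + s = 3].
  move=> cx cy; split=> //; case: (eqVneq (pnum x y, qnum x y) (0, 2)) => [pq|/eqP]; last by left.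
  by right; split=> //; apply: corners02_partial_cube pq pc.
have [rs4|rs3] := leqP 4 (r + s); last first.
  case: (small_partial_cube rs3 nxy pc) => [[cx cy]|h|h]; [|by constructor 2|by constructor 3].
  by constructor 1; apply: corners.
have /orP[cx|nx] := orbN (corner x); last first.
  have [k h] := not_corner_large rs4 nxy nx pc.
  by constructor 2; apply/boundary_P3_edgeP; exists k; right.
have /orP[cy|ny] := orbN (corner y); first by constructor 1; apply: corners.
rewrite bdelC in pc; rewrite eq_sym in nxy.
have [k h] := not_corner_large rs4 nxy ny pc.
by constructor 2; apply/boundary_P3_edgeP; exists k; left.
Qed.

Lemma daisy_partial_cube (G : sgraph) : daisy_cube G -> partial_cube G.
Proof.
move=> dG; have [n [f [z [fi fa fc]]]] := daisy_centered dG.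
exact: geodesic_partial_cube (daisy_gt0 dG) (centered_geodesic fi fa fc).
Qed.

Lemma corners_two_differ x y : qnum x y <> 0 -> (pnum x y, qnum x y) <> (0, 1) ->
  exists j i, [/\ r <= j, vl x j != vl y j, i != j & vl x i != vl y i].
Proof.
move=> /qnum_gt0[j rj nj] n01.
have [i /andP[nij ni]|no] := pickP (fun i => (i != j) && (vl x i != vl y i)).
  by exists j, i.
case: n01; apply: (pq_differ1 rj nj) => i nij.
by have := no i; rewrite nij => /negbFE/eqP.
Qed.

Lemma daisy_cases x y : x != y -> daisy_cube (bdel x y) ->
  [/\ corner x, corner y & qnum x y = 0 \/ (pnum x y, qnum x y) = (0, 1)] \/
  ((r, s) = (1, 0) /\ boundary_P3_edge x y).
Proof.
move=> nxy dG; case: (partial_cube_cases nxy (daisy_partial_cube dG)) => [[cx cy pq]|bd|sp].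
- left; split=> //; case: (eqVneq (qnum x y) 0) => [|/eqP q0]; first by left.
  right; case: (eqVneq (pnum x y, qnum x y) (0, 1)) => // /eqP n01.
  case: pq => [n02|[pq rs3]]; last first.
    by have [_ nd _] := special_deletions (or_intror (And4 cx cy pq rs3)).
  have [j [i [rj nj nij ni]]] := corners_two_differ q0 n01.
  by case: (corners_not_daisy (corners_geodesic cx cy n02) rj nj nij ni).
- right; split=> //; have [x' [y' [k [ce e]]]] := boundary_cases bd.
  have [k2 nk|one] := pickP (fun k2 => k2 != k).
    by move: dG; rewrite /bdel e => /(boundary_not_daisy ce nk).
  have : #|'I_(r + s)| = 1.
    by rewrite -(cards1 k) -cardsT; apply: eq_card => j; rewrite !inE; have := one j => /negbFE ->.
  by rewrite card_ord; case: ce => kr _ _ _ rs1; congr pair; lia.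
- by have [_ nd _] := special_deletions (or_introl sp).
Qed.

Lemma OD_cases x y : x != y -> 0 < #|bdel x y| -> in_OD (bdel x y) ->
  [/\ opposite_corners x y, 1 <= s & 3 <= 2 * r + s] \/
  ((r, s) = (1, 1) /\ boundary_P3_edge x y).
Proof.
move=> nxy H0 od; case: (od) => pc nd _.
case: (partial_cube_cases nxy pc) => [[cx cy pq]|bd|sp].
- left; have q0 : qnum x y <> 0 by move=> q0; apply/nd/corners_daisy => //; left.
  have n01 : (pnum x y, qnum x y) <> (0, 1).
    by move=> q1; apply/nd/corners_daisy => //; right.
  have n02 : (pnum x y, qnum x y) <> (0, 2).
    case: pq => [//|[pq rs3]].
    by have [_ _ []] := special_deletions (or_intror (And4 cx cy pq rs3)).
  have [j [i [rj nj nij ni]]] := corners_two_differ q0 n01.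
  have [epq|/eqP npq] := eqVneq (pnum x y, qnum x y) (r, s).
    case: epq n01 n02 q0 => pr qs; rewrite pr qs => n01 n02 q0; split; first by split.
      by lia.
    (* For [s >= 1] the bound [2r + s >= 3] excludes exactly [(0, 1)] and [(0, 2)], the two daisy
       and square exceptions for [(p, q) = (r, s)]. *)
    by case: r s n01 n02 q0 => [|r'] [|[|[|s']]] //; lia.
  have [k ek] := not_opposite cx cy npq.
  by case: (corners_not_OD (corners_geodesic cx cy n02) cx cy rj nj nij ni ek od).
- right; split=> //; have [x' [y' [k [ce e]]]] := boundary_cases bd.
  have kr : k < r by case: ce.
  (* A second coordinate must therefore be binary with [r + s <= 2], which leaves [(1, 1)]; with no
     second coordinate the graph is a daisy cube. *)
  have hk k2 : k2 != k -> ~ (2 < r + s \/ k2 < r).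
    by move=> nk h; move: od; rewrite /bdel e => /(boundary_not_OD ce nk h).
  have [k2 nk|one] := pickP (fun k2 => k2 != k); last first.
    case: nd; rewrite /bdel e; apply: (boundary_P2_daisy _ ce); last by rewrite /bdel -e.
    rewrite -[LHS]card_ord -(cards1 k) -cardsT; apply: eq_card => j; rewrite !inE.
    by have := one j => /negbFE ->.
  have h := hk k2 nk; have nk' : k2 != k :> nat by rewrite (inj_eq val_inj).
  have l2 := ltn_ord k2; have l := ltn_ord k.
  by congr pair; move/eqP: nk'; lia.
- by have [_ _ []] := special_deletions (or_introl sp).
Qed.

Lemma opposite_OD x y : x != y -> opposite_corners x y -> 1 <= s -> 3 <= 2 * r + s ->
  in_OD (bdel x y).
Proof.
move=> nxy op s1 rs3; case: (op) => cx cy pr qs.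
have n02 : (pnum x y, qnum x y) <> (0, 2) by rewrite pr qs => -[]; lia.
have n01 : (pnum x y, qnum x y) <> (0, 1) by rewrite pr qs => -[]; lia.
have gf := corners_geodesic cx cy n02.
have q0 : qnum x y <> 0 by rewrite qs; lia.
have [j [i [rj nj nij ni]]] := corners_two_differ q0 n01.
have [t [v [_ vA _ _ _]]] := corners_missing x rj nj nij ni.
split.
- by apply: geodesic_partial_cube gf; apply/card_gt0P; exists (Sub v vA).
- exact: corners_not_daisy gf rj nj nij ni.
- apply: minors_daisy => K a b; apply: opposite_minors => //; last by lia.
  by move=> k; apply: opposite_neq.
Qed.

End Classification.

Lemma card_bvert11 : #|bvert 1 1| = 6.
Proof. by rewrite card_prod !card_ffun !card_ord card_bool. Qed.

(** The graph has four vertices, so each one-step minor has at most three and is covered by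
    [geodesic_small_daisy]. *)
Lemma path4_OD (x y : bvert 1 1) k : corner_edge x y k -> in_OD (bdel x y).
Proof.
move=> ce; have gf := corner_edge_geodesic ce.
have nxy : x != y.
  case: ce => kr cx yk _; apply/eqP => e.
  by have := corner_P3 kr cx; rewrite e yk; case.
have c4 : #|bdel x y| = 4.
  have -> : #|bdel x y| = #|rest x y| by apply: card_sig.
  have := cardsC [set x; y]; rewrite cards2 nxy card_bvert11 /rest => e.
  by apply/eqP; rewrite -(eqn_add2l 2); apply/eqP.
have [k2 nk] : exists k2 : 'I_(1 + 1), k2 != k.
  by exists (if k == ord0 then ord_max else ord0); case: (eqVneq k ord0) => [->|]; rewrite // eq_sym.
split.
- by apply: geodesic_partial_cube gf; rewrite c4.
- exact: boundary_not_daisy ce nk.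
apply: minors_daisy => K a b iso ab; have cK := isomorphic_card iso; rewrite c4 in cK.
case: iso => g gi; have gh := geodesic_iso gi gf.
have [d fb] := adj_flip gh ab; split.
  apply: (geodesic_small_daisy (restriction_geodesic gh fb)).
  by rewrite (restriction_gt0 gh fb) -ltnS -cK (restriction_lt gh fb).
have [h [gc _ _]] := contraction_geodesic gh fb false.
apply: (geodesic_small_daisy gc).
by rewrite (contraction_gt0 gh fb) -ltnS -cK (contraction_lt gh fb).
Qed.

Theorem theorem23 (r s : nat) (x y : bvert r s) (hxy : x <> y)
    (hH : 0 < #|bdel x y|) :
  let H := bdel x y in
  let p := pnum x y in
  let q := qnum x y in
  [/\ partial_cube H <->
        [\/ [/\ corner x, corner y &
               (p, q) <> (0, 2) \/ ((p, q) = (0, 2) /\ r + s = 3)],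
            boundary_P3_edge x y
          | sporadic x y],
      daisy_cube H <->
        [/\ corner x, corner y & q = 0 \/ (p, q) = (0, 1)] \/
        ((r, s) = (1, 0) /\ boundary_P3_edge x y),
      in_OD H <->
        [/\ opposite_corners x y, 1 <= s & 3 <= 2 * r + s] \/
        ((r, s) = (1, 1) /\ boundary_P3_edge x y)
    & ~ (corner x /\ corner y) -> ~ isometric_set (rest x y) -> ~ in_OD H].
Proof.
move=> H p q; have nxy : x != y by apply/eqP.
have bdP : boundary_P3_edge x y -> isometric_set (rest x y) /\ partial_cube H.
  case/boundary_cases => x' [y' [k [ce e]]]; have gf := corner_edge_geodesic ce.
  rewrite /H /bdel e; split; first exact: geodesic_isometric (@geodesic_bgraph r s) gf.
  by apply: geodesic_partial_cube gf; rewrite /bdel -e.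
split.
- split=> [/(partial_cube_cases nxy)//|]; case=> [[cx cy]|/bdP[]//|sp].
    case=> [n02|[pq rs3]]; first exact: geodesic_partial_cube (corners_geodesic cx cy n02).
    by have [] := special_deletions (or_intror (And4 cx cy pq rs3)).
  by have [] := special_deletions (or_introl sp).
- split=> [/(daisy_cases nxy)//|]; case=> [[cx cy pq]|[[r1 s0] bd]].
    exact: corners_daisy.
  have [x' [y' [k [ce e]]]] := boundary_cases bd.
  rewrite /H /bdel e; apply: (boundary_P2_daisy _ ce); first by rewrite r1 s0.
  by rewrite /bdel -e.
- split=> [/(OD_cases nxy hH)//|]; case=> [[op s1 rs3]|[[r1 s1] bd]].
    exact: opposite_OD.
  rewrite /H; clear - bd r1 s1; subst r s.
  have [x' [y' [k [ce e]]]] := boundary_cases bd.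
  by rewrite /bdel e; apply: path4_OD ce.
(* Of the two kinds of members of the class, one deletes corners and the other leaves an isometric
   subgraph. *)
- move=> nc ni od; case: (OD_cases nxy hH od) => [[[cx cy _ _] _ _]|[_ /bdP[]//]].
  by apply: nc.
Qed.
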